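(* Let $(\mu_t)_{t\in[0,1]}$ be an $\mathsf{HK}$ geodesic in the finite nonnegative Borel measures on $\mathbb R^d$ with $\mu_s\ll\mathcal L^d$ for some (hence all) $s\in(0,1)$, and fix $s\in(0,1)$. For $t\in(0,1)$ and $x\in\mathfrak D_s$ let $$\gamma_s(t,x):=q_{s\to t}(x),\qquad \rho_s(t,x):=q_{s\to t}(x)\,\big(\det\mathrm D\boldsymbol T_{s\to t}(x)\big)^{1/d}.$$ Then, with dots denoting derivatives in $t$, for all $t\in(0,1)$ and $x\in\mathfrak D_s$: $$\frac{\ddot\gamma_s(t,x)}{\gamma_s(t,x)}\ge0,\qquad \frac{\ddot\rho_s(t,x)}{\rho_s(t,x)}\le\Big(1-\frac4d\Big)\frac{\ddot\gamma_s(t,x)}{\gamma_s(t,x)}\ \text{ if }d\ge2,\qquad \frac{\ddot\rho_s(t,x)}{\rho_s(t,x)}=\Big(1-\frac4d\Big)\frac{\ddot\gamma_s(t,x)}{\gamma_s(t,x)}\ \text{ if }d=1.$$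
   Context: $\mathcal L^d$ is Lebesgue measure. $\mathsf{HK}(\mu_0,\mu_1)^2=\min_{\boldsymbol\eta}\{\int F(\sigma_0)\mathrm d\mu_0+\int F(\sigma_1)\mathrm d\mu_1+\iint 2\mathrm L_1(x_0-x_1)\mathrm d\boldsymbol\eta\}$, where $\boldsymbol\eta$ ranges over finite nonnegative Borel measures on $\mathbb R^d\times\mathbb R^d$ with marginals $\sigma_i\mu_i$, $F(s)=s\log s-s+1$, $F(0)=1$, $\mathrm L_1(z)=-\log\cos|z|$ for $|z|<\pi/2$ and $+\infty$ otherwise. A geodesic is a curve with $\mathsf{HK}(\mu_s,\mu_t)=|s-t|\,\mathsf{HK}(\mu_0,\mu_1)$ for all $s,t\in[0,1]$. Fix a tight optimal pair for $(\mu_0,\mu_1)$: $\varphi_0,\varphi_1:\mathbb R^d\to[-\infty,+\infty]$, $\varphi_0$ l.s.c., $\varphi_1$ u.s.c., with $\varphi_0(x_0)=\sup_{|x_1-x_0|<\pi/2}\varphi_1(x_1)-\mathrm L_1(x_1-x_0)$ and $\varphi_1(x_1)=\inf_{|x_0-x_1|<\pi/2}\varphi_0(x_0)+\mathrm L_1(x_1-x_0)$ on $\mathbb R^d$, $\int e^{2\varphi_0}\mathrm d\mu_0<\infty$, $\int e^{-2\varphi_1}\mathrm d\mu_1<\infty$, and $\frac12\mathsf{HK}(\mu_0,\mu_1)^2=\int\frac12(1-e^{-2\varphi_1})\mathrm d\mu_1-\int\frac12(e^{2\varphi_0}-1)\mathrm d\mu_0$. Associated objects: $\xi_0=\frac12(e^{2\varphi_0}-1)$,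 $\bar\xi_1=\frac12(1-e^{-2\varphi_1})$, and for $t\in(0,1)$ $$\xi_t(x)=\inf_{|y-x|<\pi/2}\tfrac1{2t}\Big(1-\tfrac{\cos^2(|x-y|)}{1+2t\xi_0(y)}\Big),\qquad \bar\xi_t(x)=\sup_{|y-x|<\pi/2}\tfrac1{2(1-t)}\Big(\tfrac{\cos^2(|x-y|)}{1-2(1-t)\bar\xi_1(y)}-1\Big),$$ with $c/0=+\infty$, $c/(+\infty)=0$ for $c>0$; $\Xi_t=\{\xi_t=\bar\xi_t\}$. For $s\in(0,1)$, $\xi_s$ is differentiable at every point of $\Xi_s$ and $\nabla\xi_s$ is Lipschitz on $\Xi_s$. For $s,t\in(0,1)$, $x\in\Xi_s$, $\tau=t-s$ (then $1+2\tau\xi_s(x)>0$): $\boldsymbol T_{s\to t}(x)=x+\boldsymbol{\arctan}\big(\frac{\tau\nabla\xi_s(x)}{1+2\tau\xi_s(x)}\big)$ and $q_{s\to t}(x)=\big((1+2\tau\xi_s(x))^2+\tau^2|\nabla\xi_s(x)|^2\big)^{1/2}>0$, where $\boldsymbol{\arctan}(w)=\arctan(|w|)\frac w{|w|}$, $\boldsymbol{\arctan}(0)=0$. $\mathfrak D_s$ is the set of Lebesgue density points $x\in\Xi_s$ of $\Xi_s$ at which $\nabla\xi_s:\Xi_s\to\mathbb R^d$ is differentiable relative to $\Xi_s$ (i.e. $|\nabla\xi_s(y)-\nabla\xi_s(x)-\mathsf A(y-x)|=o(|y-x|)$ as $y\to x$, $y\in\Xi_s$, for some matrix $\mathsf A$);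 $\mathrm D\boldsymbol T_{s\to t}(x)$ is the differential of $\boldsymbol T_{s\to t}:\Xi_s\to\mathbb R^d$ in the same sense, which exists for $x\in\mathfrak D_s$ and has positive determinant. *)

(* Defs.v *)
From HB Require Import structures.
From mathcomp Require Import all_boot all_order all_algebra.
From mathcomp Require Import all_classical all_reals all_analysis.

Set Implicit Arguments.
Unset Strict Implicit.
Unset Printing Implicit Defensive.

Import Order.TTheory GRing.Theory Num.Theory.
Import numFieldNormedType.Exports.

Local Open Scope classical_set_scope.
Local Open Scope ring_scope.

(* R^d is 'rV[R]_d.  The library norm on 'rV[R]_d is the sup norm; it induces
   the same topology, but every length below is the Euclidean one. *)
Definition enorm (R : realType) (d : nat) (v : 'rV[R]_d) : R :=
  Num.sqrt (\sum_i v 0 i ^+ 2).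

Definition eball (R : realType) (d : nat) (x : 'rV[R]_d) (r : R) :
    set 'rV[R]_d := [set y | enorm (y - x) < r].

(* R^d with its Borel sigma-algebra. *)
Definition borel (R : realType) (d : nat) :=
  g_sigma_algebraType (@open 'rV[R]_d).

Notation finmeas R d := {finite_measure set (borel R d) -> \bar R}.

(* d-dimensional Lebesgue (outer) measure, by countable covers by closed boxes;
   it is used only for d > 0. *)
Definition box (R : realType) (d : nat) (a b : 'rV[R]_d) : set 'rV[R]_d :=
  [set x | forall i, a 0 i <= x 0 i <= b 0 i].

Definition lebesgue (R : realType) (d : nat) (A : set 'rV[R]_d) : \bar R :=
  ereal_inf [set v | exists a b : nat -> 'rV[R]_d,
    [/\ forall k i, a k 0 i <= b k 0 i,
        A `<=` \bigcup_k box (a k) (b k) &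
        v = (\sum_(0 <= k <oo) (\prod_i (b k 0 i - a k 0 i))%:E)%E]].

Definition abs_continuous (R : realType) (d : nat) (mu : finmeas R d) : Prop :=
  forall N : set (borel R d), measurable N -> lebesgue N = 0%E -> mu N = 0%E.

Definition density_point (R : realType) (d : nat) (A : set 'rV[R]_d)
    (x : 'rV[R]_d) : Prop :=
  fine (lebesgue (A `&` eball x r)) / fine (lebesgue (eball x r))
    @[r --> 0^'+] --> (1 : R).

Section HellingerKantorovich.
Variables (R : realType) (d : nat).
Implicit Types mu : finmeas R d.

(* ln 0 = 0 in the library, so that entropyF 0 = 1. *)
Definition entropyF (r : R) : R := r * ln r - r + 1.

Definition L1 (z : 'rV[R]_d) : \bar R :=
  if enorm z < pi / 2 then (- ln (cos (enorm z)))%:E else +oo%E.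

Definition is_density (sigma : borel R d -> R) : Prop :=
  measurable_fun setT sigma /\ forall x, 0 <= sigma x.

(* The measurable structure on the product type is the product
   sigma-algebra, which is the Borel sigma-algebra of R^d x R^d. *)
Definition has_marginals
    (eta : {finite_measure set (borel R d * borel R d)%type -> \bar R})
    mu0 mu1 (sigma0 sigma1 : borel R d -> R) : Prop :=
  forall A : set (borel R d), measurable A ->
    eta (A `*` setT) = (\int[mu0]_(x in A) (sigma0 x)%:E)%E /\
    eta (setT `*` A) = (\int[mu1]_(x in A) (sigma1 x)%:E)%E.

Definition HKcost
    (eta : {finite_measure set (borel R d * borel R d)%type -> \bar R})
    mu0 mu1 (sigma0 sigma1 : borel R d -> R) : \bar R :=
  (\int[mu0]_x (entropyF (sigma0 x))%:E + \int[mu1]_x (entropyF (sigma1 x))%:E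
   + \int[eta]_z (2%:E * L1 (z.1 - z.2 : 'rV[R]_d)%R))%E.

(* The infimum is at most mu0(R^d) + mu1(R^d), by taking eta = 0, hence
   finite. *)
Definition HKsq mu0 mu1 : \bar R :=
  ereal_inf [set c | exists
      (eta : {finite_measure set (borel R d * borel R d)%type -> \bar R})
      (sigma0 sigma1 : borel R d -> R),
    [/\ is_density sigma0, is_density sigma1,
        has_marginals eta mu0 mu1 sigma0 sigma1 &
        c = HKcost eta mu0 mu1 sigma0 sigma1]].

Definition HK mu0 mu1 : R := Num.sqrt (fine (HKsq mu0 mu1)).

Definition HK_geodesic (mu : R -> finmeas R d) : Prop :=
  forall s t, 0 <= s <= 1 -> 0 <= t <= 1 ->
    HK (mu s) (mu t) = `|s - t| * HK (mu 0) (mu 1).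

End HellingerKantorovich.

Section Potentials.
Variables (R : realType) (d : nat).
Local Notation V := ('rV[R]_d).

Local Open Scope ereal_scope.

Definition xi0 (phi0 : V -> \bar R) (x : V) : \bar R :=
  2^-1%:E * (expeR (2%:E * phi0 x) - 1).

Definition xibar1 (phi1 : V -> \bar R) (x : V) : \bar R :=
  2^-1%:E * (1 - expeR (- (2%:E * phi1 x))).

Record tight_optimal_pair (mu0 mu1 : finmeas R d)
    (phi0 phi1 : V -> \bar R) : Prop := {
  phi0_lsc : lower_semicontinuous phi0 ;
  phi1_usc : lower_semicontinuous (fun x => - phi1 x) ;
  phi0E : forall x0, phi0 x0 =
    ereal_sup [set phi1 x1 - L1 (x1 - x0)%R | x1 in eball x0 (pi / 2)%R] ;
  phi1E : forall x1, phi1 x1 =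
    ereal_inf [set phi0 x0 + L1 (x1 - x0)%R | x0 in eball x1 (pi / 2)%R] ;
  phi0_int : \int[mu0]_x expeR (2%:E * phi0 x) < +oo ;
  phi1_int : \int[mu1]_x expeR (- (2%:E * phi1 x)) < +oo ;
  dual_optimal : (2^-1 * HK mu0 mu1 ^+ 2)%:E =
    \int[mu1]_x xibar1 phi1 x - \int[mu0]_x xi0 phi0 x }.

(* Division on \bar R satisfies c / 0 = +oo and c / +oo = 0 for c > 0. *)
Definition xi (phi0 : V -> \bar R) (t : R) (x : V) : \bar R :=
  ereal_inf [set (2 * t)^-1%:E *
      (1 - (cos (enorm (x - y)) ^+ 2)%:E / (1 + (2 * t)%:E * xi0 phi0 y))
    | y in eball x (pi / 2)%R].

Definition xibar (phi1 : V -> \bar R) (t : R) (x : V) : \bar R :=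
  ereal_sup [set (2 * (1 - t))^-1%:E *
      ((cos (enorm (x - y)) ^+ 2)%:E /
         (1 - (2 * (1 - t))%:E * xibar1 phi1 y) - 1)
    | y in eball x (pi / 2)%R].

Definition Xi (phi0 phi1 : V -> \bar R) (t : R) : set V :=
  [set x | xi phi0 t x = xibar phi1 t x].

End Potentials.

Definition gradient (R : realType) (d : nat) (f : 'rV[R]_d -> R)
    (x : 'rV[R]_d) : 'rV[R]_d :=
  \row_i 'D_(delta_mx 0 i) f x.

(* Differentiability relative to A, only points of A being tested.  Matrices
   act on row vectors from the right, as for the library's [jacobian]: M is
   the transpose of the matrix acting on column vectors. *)
Definition is_reldiff (R : realType) (d : nat) (A : set 'rV[R]_d)
    (f : 'rV[R]_d -> 'rV[R]_d) (x : 'rV[R]_d) (M : 'M[R]_d) : Prop :=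
  forall e : R, 0 < e -> \forall y \near within A (nbhs x),
    enorm (f y - f x - (y - x) *m M) <= e * enorm (y - x).

(* M is unique when x is a density point of A. *)
Definition reldiff (R : realType) (d : nat) (A : set 'rV[R]_d)
    (f : 'rV[R]_d -> 'rV[R]_d) (x : 'rV[R]_d) : 'M[R]_d :=
  xget 0 [set M | is_reldiff A f x M].

Definition arctan_vec (R : realType) (d : nat) (w : 'rV[R]_d) : 'rV[R]_d :=
  (atan (enorm w) / enorm w) *: w.

Section Transport.
Variables (R : realType) (d : nat) (phi0 phi1 : 'rV[R]_d -> \bar R).
Implicit Types (s t : R) (x : 'rV[R]_d).

(* [xi phi0 s] takes finite values for 0 < s < 1. *)
Definition rxi s x : R := fine (xi phi0 s x).

Definition grad_xi s x : 'rV[R]_d := gradient (rxi s) x.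

Definition transport s t x : 'rV[R]_d :=
  x + arctan_vec (((t - s) / (1 + 2 * (t - s) * rxi s x)) *: grad_xi s x).

Definition growth s t x : R :=
  Num.sqrt ((1 + 2 * (t - s) * rxi s x) ^+ 2 +
            (t - s) ^+ 2 * enorm (grad_xi s x) ^+ 2).

Definition regular_set s : set 'rV[R]_d :=
  [set x | [/\ Xi phi0 phi1 s x, density_point (Xi phi0 phi1 s) x &
               exists M, is_reldiff (Xi phi0 phi1 s) (grad_xi s) x M]].

Definition Dtransport s t x : 'M[R]_d :=
  reldiff (Xi phi0 phi1 s) (transport s t) x.

Definition gamma_ s x t : R := growth s t x.

Definition rho_ s x t : R :=
  growth s t x * (\det (Dtransport s t x)) `^ (d%:R^-1).

End Transport.

Definition twice_derivable (R : realType) (f : R -> R) (t : R) : Prop :=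
  (\forall u \near t, derivable f u 1) /\ derivable (derive1 f) t 1.

(* Main.v *)
Require Import Defs.
From mathcomp Require Import all_boot all_order all_algebra.
From mathcomp Require Import all_classical all_reals all_analysis.
From mathcomp Require Import perm ring lra.
Import Order.TTheory GRing.Theory Num.Theory.
Import numFieldNormedType.Exports.
Local Open Scope classical_set_scope.
Local Open Scope ring_scope.
Set Implicit Arguments.
Unset Strict Implicit.

(** Only the values [a], [g], [A] of the potential [xi_s], its gradient and its
    Hessian at the point [x] matter: the transport map and the growth factor are
    explicit functions of the potential and its gradient, so along
    [tau = t - s] one finds [gamma = sqrt Q] with
    [Q = (1 + 2 tau a)^2 + tau^2 |g|^2], and the differential of the transport is
    an explicit matrix [M] in [a], [g], [A] and [tau] (lemma [ray_reldiff]).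

    The curve [M] solves the Jacobi equation
    [M'' = - (Q'/Q) M' - (4/Q^2) M g^T g] (lemma [mxder_flow_mx1]).  With [B = M^-1 M']
    the second logarithmic derivatives give [gamma''/gamma = |g|^2 / Q^2] and
    [rho''/rho = (1 - 4/d) |g|^2 / Q^2 - (tr (B^2) - (tr B)^2 / d) / d]
    (lemmas [gamma_second] and [rho_second]).  If [A] is symmetric, so is [B]
    (lemma [flow_mx1_sym]), and the last term is nonnegative by Cauchy-Schwarz; it
    vanishes in dimension one.

    It remains to justify the calculus at a regular point.

    - The duality of the potentials and a spherical triangle inequality
      (lemma [cone_interpolation]) show that the lower Hopf-Lax formula never
      exceeds the upper one.  At a point of contact, [xi_s] is therefore caught
      between two affine functions of the kernel [ckernel], the squared cosine of
      the distance (lemma [touched_compact]), which yields first-order expansions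
      with a uniform quadratic remainder (lemma [touched_taylor]).
    - Near a density point the contact set comes relatively close to every point
      (lemma [density_approx]).  Hence relative differentials are unique, and
      integrating the gradient along broken lines gives a second-order expansion
      of [xi_s] (lemma [edge_expansion]).  Going around a triangle shows that [A]
      is symmetric (lemma [reldiff_symmetric]).
    - The determinant of [M] is positive.  The kernels touching [xi_s] bound [A]
      from both sides (lemma [touching_hess_lower]) by Hessians for which [M]
      would degenerate at the end times [tau = 1 - s] and [tau = - s] only; for
      [M] to degenerate earlier, [A] would have to violate these bounds
      (lemma [flow_nondegenerate]).  As [M] is the identity at [tau = 0], its
      determinant stays positive (lemma [det_flow_gt0]). *)

(** * Euclidean geometry of row vectors *)
Section Euclid.
Variables (R : realType) (d : nat).
Implicit Types (u v w : 'rV[R]_d) (c : R).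

Definition dotv u v : R := \sum_i u 0 i * v 0 i.

Lemma dotvC u v : dotv u v = dotv v u.
Proof. by apply: eq_bigr => i _; rewrite mulrC. Qed.

Lemma dotvDl u v w : dotv (u + v) w = dotv u w + dotv v w.
Proof. by rewrite -big_split; apply: eq_bigr => i _; rewrite mxE mulrDl. Qed.

Lemma dotvZl c u v : dotv (c *: u) v = c * dotv u v.
Proof. by rewrite mulr_sumr; apply: eq_bigr => i _; rewrite mxE mulrA. Qed.

Lemma dotvDr u v w : dotv w (u + v) = dotv w u + dotv w v.
Proof. by rewrite !(dotvC w) dotvDl. Qed.

Lemma dotvZr c u v : dotv u (c *: v) = c * dotv u v.
Proof. by rewrite !(dotvC u) dotvZl. Qed.

Lemma dotvNl u v : dotv (- u) v = - dotv u v.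
Proof. by rewrite -scaleN1r dotvZl mulN1r. Qed.

Lemma dotvNr u v : dotv v (- u) = - dotv v u.
Proof. by rewrite !(dotvC v) dotvNl. Qed.

Lemma dotv0l v : dotv 0 v = 0.
Proof. by rewrite -(scale0r v) dotvZl mul0r. Qed.

Lemma dotv0r v : dotv v 0 = 0.
Proof. by rewrite dotvC dotv0l. Qed.

Definition dotvE := (dotvDl, dotvDr, dotvNl, dotvNr, dotvZl, dotvZr, dotv0l, dotv0r).

Lemma dotvv_ge0 v : 0 <= dotv v v.
Proof. by apply: sumr_ge0 => i _; rewrite -expr2 sqr_ge0. Qed.

Lemma dotvv_eq0 v : dotv v v = 0 -> v = 0.
Proof.
move=> /eqP; rewrite psumr_eq0; last by move=> i _; rewrite -expr2 sqr_ge0.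
move=> /allP v0; apply/rowP => i; rewrite mxE.
by have /eqP := v0 i (mem_index_enum i); rewrite -expr2 => /eqP; rewrite sqrf_eq0 => /eqP.
Qed.

Lemma enorm_def v : enorm v = Num.sqrt (dotv v v).
Proof. by congr Num.sqrt; apply: eq_bigr => i _; rewrite expr2. Qed.

Lemma enorm_ge0 v : 0 <= enorm v.
Proof. exact: sqrtr_ge0. Qed.

Lemma enorm_sq v : enorm v ^+ 2 = dotv v v.
Proof. by rewrite enorm_def sqr_sqrtr // dotvv_ge0. Qed.

Lemma enorm0 : enorm (0 : 'rV[R]_d) = 0.
Proof. by rewrite enorm_def dotv0l sqrtr0. Qed.

Lemma enorm_eq0 v : enorm v = 0 -> v = 0.
Proof. by move=> v0; apply: dotvv_eq0; rewrite -enorm_sq v0 expr0n. Qed.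

Lemma enormZ c v : enorm (c *: v) = `|c| * enorm v.
Proof.
by rewrite !enorm_def !dotvE mulrA -expr2 sqrtrM ?sqr_ge0 // sqrtr_sqr.
Qed.

Lemma enormN v : enorm (- v) = enorm v.
Proof. by rewrite -scaleN1r enormZ normrN normr1 mul1r. Qed.

Lemma enormB u v : enorm (u - v) = enorm (v - u).
Proof. by rewrite -enormN opprB. Qed.

Lemma cauchy_schwarz u v : `|dotv u v| <= enorm u * enorm v.
Proof.
rewrite -(ler_pXn2r (n := 2)) ?nnegrE ?mulr_ge0 ?enorm_ge0 //.
rewrite exprMn !enorm_sq real_normK ?num_real //.
have [u0|u0] := eqVneq (dotv u u) 0.
  by rewrite (dotvv_eq0 u0) !dotvE expr0n mul0r.
have up : 0 < dotv u u by rewrite lt0r u0 dotvv_ge0.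
have := dotvv_ge0 (dotv u u *: v - dotv u v *: u).
rewrite !dotvE (dotvC v u) => h.
have : 0 <= dotv u u * (dotv u u * dotv v v - dotv u v ^+ 2).
  by move: h; congr (_ <= _); ring.
by rewrite pmulr_rge0 // subr_ge0.
Qed.

Lemma dotv_le u v : dotv u v <= enorm u * enorm v.
Proof. exact: le_trans (ler_norm _) (cauchy_schwarz u v). Qed.

Lemma enormD u v : enorm (u + v) <= enorm u + enorm v.
Proof.
rewrite -(ler_pXn2r (n := 2)) ?nnegrE ?addr_ge0 ?enorm_ge0 //.
rewrite sqrrD !enorm_sq !dotvE (dotvC v u).
by have := dotv_le u v; lra.
Qed.

Lemma enormD_sq u v : enorm (u + v) ^+ 2 = enorm u ^+ 2 + 2 * dotv u v + enorm v ^+ 2.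
Proof. by rewrite !enorm_sq !dotvE (dotvC v u); ring. Qed.

Lemma enorm_coord v i : `|v 0 i| <= enorm v.
Proof.
rewrite -(ler_pXn2r (n := 2)) ?nnegrE ?enorm_ge0 // enorm_sq real_normK ?num_real //.
rewrite /dotv (bigD1 i) //= -expr2 lerDl.
by apply: sumr_ge0 => j _; rewrite -expr2 sqr_ge0.
Qed.

Lemma enorm_sum_le (I : Type) (r : seq I) (P : pred I) (F : I -> 'rV[R]_d) :
  enorm (\sum_(i <- r | P i) F i) <= \sum_(i <- r | P i) enorm (F i).
Proof.
elim/big_ind2 : _ => [|u a v b hu hv|//]; first by rewrite enorm0.
exact: le_trans (enormD _ _) (lerD hu hv).
Qed.

Lemma dotv_delta v i : dotv v (delta_mx 0 i) = v 0 i.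
Proof.
rewrite /dotv (bigD1 i) //= big1 ?addr0.
  by rewrite mxE !eqxx mulr1.
by move=> j ji; rewrite mxE (negPf ji) andbF mulr0.
Qed.

Lemma enorm_delta i : enorm (delta_mx 0 i : 'rV[R]_d) = 1.
Proof. by rewrite enorm_def dotv_delta mxE !eqxx sqrtr1. Qed.

(** The topology on row vectors is that of the sup norm; the next two
    bounds make Euclidean balls a basis of neighbourhoods. *)
Lemma sup_le_enorm v : `|v| <= enorm v.
Proof.
rewrite /Num.norm /= mx_normrE; apply: bigmax_le; first exact: enorm_ge0.
by move=> [i j] _ /=; rewrite ord1; exact: enorm_coord.
Qed.

Lemma sup_coord v i : `|v 0 i| <= `|v|.
Proof.
by rewrite [leRHS]/Num.norm /= mx_normrE (le_bigmax _ (fun i => `|v i.1 i.2|) (0, i)).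
Qed.

Lemma enorm_coord_le v c : 0 <= c -> (forall i, `|v 0 i| <= c) -> enorm v <= d%:R * c.
Proof.
move=> c0 h; rewrite (row_sum_delta v).
apply: le_trans (enorm_sum_le _ _ _) _.
apply: (@le_trans _ _ (\sum_(j < d) c)).
  by apply: ler_sum => i _; rewrite enormZ enorm_delta mulr1.
by rewrite sumr_const card_ord mulr_natl.
Qed.

Lemma enorm_le_sup v : enorm v <= d%:R * `|v|.
Proof. by apply: enorm_coord_le => // i; exact: sup_coord. Qed.

Lemma near_enorm (x : 'rV[R]_d) c : 0 < c -> \forall y \near x, enorm (y - x) < c.
Proof.
move=> c0; have d1 : 0 < (d%:R + 1 : R) by rewrite ltr_wpDl.
have := nbhsx_ballx x _ (divr_gt0 c0 d1).
apply: filterS => y; rewrite -ball_normE /= distrC ltr_pdivlMr // => h.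
apply: le_lt_trans (enorm_le_sup _) (le_lt_trans _ h).
by rewrite mulrC ler_wpM2l // lerDl.
Qed.

Lemma nbhs_enorm (x : 'rV[R]_d) (P : set 'rV[R]_d) : nbhs x P ->
  exists2 c, 0 < c & forall y, enorm (y - x) < c -> P y.
Proof.
move=> /nbhs_ballP[e /= e0 h]; exists e => // y yx; apply: h.
by rewrite -ball_normE /= distrC (le_lt_trans (sup_le_enorm _)).
Qed.

Lemma enorm_continuous : continuous (@enorm R d).
Proof.
move=> x; apply/(@cvgrPdist_lt _ R^o _ (nbhs x) (nbhs_filter x)) => e e0.
apply: (@filterS _ _ (nbhs_filter x) _ _ _ (near_enorm x e0)) => y; apply: le_lt_trans.
have h1 := enormD (x - y) y; have h2 := enormD (y - x) x.
rewrite !subrK in h1 h2; rewrite enormB in h1.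
by rewrite ler_norml; apply/andP; split; lra.
Qed.

Lemma enorm_mulmx (M : 'M[R]_d) : exists2 K, 0 <= K & forall v, enorm (v *m M) <= K * enorm v.
Proof.
exists (\sum_i enorm (row i M)); first by apply: sumr_ge0 => i _; exact: enorm_ge0.
move=> v; rewrite mulmx_sum_row; apply: le_trans (enorm_sum_le _ _ _) _.
rewrite mulr_suml; apply: ler_sum => i _; rewrite enormZ mulrC.
by rewrite ler_wpM2l ?enorm_ge0 // enorm_coord.
Qed.

End Euclid.

(** * Derivatives in one variable *)
Section Deriv.
Variable R : realType.
Implicit Types (f g : R -> R) (x a b : R).

(** A copy of [is_derive] in direction 1 that is not a type class, so that
    derivatives are computed by the rules below and unresolved values stay
    unification variables. *)
Definition hasder f x a : Prop := is_derive x (1 : R) f a.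

Lemma hasder_eq f x a b : hasder f x a -> a = b -> hasder f x b.
Proof. by move=> fa <-. Qed.

Lemma hasderD f g x a b : hasder f x a -> hasder g x b ->
  hasder (fun y => f y + g y) x (a + b).
Proof. by move=> fa gb; exact: is_deriveD. Qed.

Lemma hasderN f x a : hasder f x a -> hasder (fun y => - f y) x (- a).
Proof. by move=> fa; exact: is_deriveN. Qed.

Lemma hasderM f g x a b : hasder f x a -> hasder g x b ->
  hasder (fun y => f y * g y) x (a * g x + f x * b).
Proof.
move=> fa gb; apply: (is_derive_eq (is_deriveM fa gb) _).
by rewrite addrC [g x *: a]mulrC.
Qed.

Lemma hasderX f n x a : hasder f x a ->
  hasder (fun y => f y ^+ n) x (n%:R * f x ^+ n.-1 * a).
Proof.
move=> fa; have -> : (fun y => f y ^+ n) = f ^+ n.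
  by apply/funext => y; rewrite fctE.
exact: is_deriveX.
Qed.

Lemma hasderC c x : hasder (fun=> c : R) x 0.
Proof. exact: is_derive_cst. Qed.

Lemma hasderI x : hasder (fun y => y) x 1.
Proof. exact: is_derive_id. Qed.

Lemma hasderV f x a : f x != 0 -> hasder f x a ->
  hasder (fun y => (f y)^-1) x (- a / f x ^+ 2).
Proof.
move=> fx fa; apply: (is_derive_eq (is_deriveV fx fa) _).
by rewrite /GRing.scale /= mulrC mulrN mulNr.
Qed.

Lemma hasderComp f g x a b : hasder f (g x) a -> hasder g x b ->
  hasder (fun y => f (g y)) x (a * b).
Proof. by move=> fa gb; exact: is_derive1_comp. Qed.

Lemma hasderCos g x b : hasder g x b ->
  hasder (fun y => cos (g y)) x (- sin (g x) * b).
Proof. by apply: hasderComp; exact: is_derive_cos. Qed.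

Lemma hasderSin g x b : hasder g x b ->
  hasder (fun y => sin (g y)) x (cos (g x) * b).
Proof. by apply: hasderComp; exact: is_derive_sin. Qed.

Lemma hasderAtan g x b : hasder g x b ->
  hasder (fun y => atan (g y)) x ((1 + g x ^+ 2)^-1 * b).
Proof. by apply: hasderComp; exact: is_derive1_atan. Qed.

Lemma hasderExp g x b : hasder g x b ->
  hasder (fun y => expR (g y)) x (expR (g x) * b).
Proof. by apply: hasderComp; exact: is_derive_expR. Qed.

Lemma hasderLn g x b : 0 < g x -> hasder g x b ->
  hasder (fun y => ln (g y)) x ((g x)^-1 * b).
Proof. by move=> gx; apply: hasderComp; exact: is_derive1_ln. Qed.

Lemma hasderCont f x a : hasder f x a -> {for x, continuous f}.
Proof.
move=> fa; have {}fa : is_derive x 1 f a := fa.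
by apply: differentiable_continuous; apply/derivable1_diffP; exact: ex_derive.
Qed.

Lemma der_ge0_le f df a b : a <= b ->
  (forall x, a <= x <= b -> hasder f x (df x)) ->
  (forall x, a < x < b -> 0 <= df x) -> f a <= f b.
Proof.
rewrite le_eqVlt => /predU1P[->//|ab] fd df0.
have [||c] := @MVT R f df a b ab.
- by move=> x; rewrite in_itv /= => /andP[ax xb]; apply: fd; rewrite !ltW.
- apply: continuous_in_subspaceT => x; rewrite inE /= in_itv /= => xab.
  exact: hasderCont (fd x xab).
rewrite in_itv /= => cab e; rewrite -subr_ge0 e mulr_ge0 ?df0 //.
by rewrite subr_ge0 ltW.
Qed.

Lemma der_le0_ge f df a b : a <= b ->
  (forall x, a <= x <= b -> hasder f x (df x)) ->
  (forall x, a < x < b -> df x <= 0) -> f b <= f a.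
Proof.
move=> ab fd df0.
rewrite -lerN2; apply: (@der_ge0_le (fun x => - f x) (fun x => - df x) _ _ ab).
  by move=> x xab; apply: hasderN; exact: fd.
by move=> x xab; rewrite oppr_ge0; exact: df0.
Qed.

End Deriv.

Ltac der := repeat first
  [ apply: hasderD | apply: hasderN | apply: hasderM | apply: hasderX
  | apply: hasderCos | apply: hasderSin | apply: hasderAtan
  | apply: hasderExp | apply: hasderC | apply: hasderI ].

(** * The truncated squared cosine and the cone inequality *)
Section Kernel.
Variable R : realType.
Implicit Types (x y r : R).

Lemma pi2_gt0 : 0 < (pi : R) / 2. Proof. by rewrite divr_gt0 // pi_gt0. Qed.

Lemma sin_ge_xcos x : 0 <= x <= pi -> x * cos x <= sin x.
Proof.
move=> /andP[x0 xpi]; rewrite -subr_ge0.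
have -> : 0 = sin (0 : R) - 0 * cos 0 by rewrite sin0 mul0r subrr.
apply: (@der_ge0_le R (fun z => sin z - z * cos z) (fun z => z * sin z)) => // z.
  by move=> _; apply: hasder_eq; [der|cbv beta; ring].
move=> /andP[z0 zx]; rewrite mulr_ge0 ?(ltW z0) //.
by rewrite sin_ge0_pi // (ltW z0) (le_trans (ltW zx)).
Qed.

Lemma sinc_decr x y : 0 < x -> x <= y -> y <= pi -> sin y / y <= sin x / x.
Proof.
move=> x0 xy ypi.
apply: (@der_le0_ge R (fun z => sin z / z) (fun z => (z * cos z - sin z) / z ^+ 2)) => // z.
  move=> /andP[xz _]; have z0 : z != 0 by rewrite gt_eqF // (lt_le_trans x0).
  apply: hasder_eq; first by der; apply: hasderV; [exact: z0|der].
  by cbv beta; field.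
move=> /andP[xz zy]; have z0 := lt_trans x0 xz.
rewrite pmulr_lle0 ?invr_gt0 ?exprn_gt0 // subr_le0 sin_ge_xcos //.
by rewrite (ltW z0) (le_trans (ltW zy)).
Qed.

Lemma sin_le_id x : 0 <= x -> sin x <= x.
Proof.
move=> x0; rewrite -subr_ge0.
have -> : 0 = 0 - sin (0 : R) by rewrite sin0 subrr.
apply: (@der_ge0_le R (fun z => z - sin z) (fun z => 1 - cos z)) => // z _.
  by apply: hasder_eq; [der|cbv beta; ring].
Qed.

(** [sinc2 r] is minus the derivative of [u |-> cos^2 (sqrt u)] at [u = r^2]. *)

Definition sinc2 r : R := if r == 0 then 1 else sin (2 * r) / (2 * r).

Lemma sin2_ge0 x : 0 <= x <= pi / 2 -> 0 <= sin (2 * x).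
Proof. by move=> h; rewrite sin_ge0_pi //; lra. Qed.

Lemma sinc2_ge0 r : 0 <= r <= pi / 2 -> 0 <= sinc2 r.
Proof.
move=> h; rewrite /sinc2; case: eqP => // _.
by rewrite divr_ge0 ?sin2_ge0 //; lra.
Qed.

Lemma sinc2_le1 r : 0 <= r -> sinc2 r <= 1.
Proof.
rewrite /sinc2; case: eqP => // /eqP r0 h.
have rp : 0 < 2 * r by rewrite mulr_gt0 // lt_neqAle eq_sym r0.
by rewrite ler_pdivrMr // mul1r sin_le_id // ltW.
Qed.

Lemma sin2_sinc2 r : sin (2 * r) = 2 * r * sinc2 r.
Proof.
rewrite /sinc2; case: eqP => [->|/eqP r0]; first by rewrite !mulr0 sin0 mul0r.
by field.
Qed.

Lemma sinc2_decr x y : 0 <= x -> x <= y -> y <= pi / 2 -> sinc2 y <= sinc2 x.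
Proof.
move=> x0 xy ypi; have [->|xn0] := eqVneq x 0.
  by rewrite {2}/sinc2 eqxx sinc2_le1 // (le_trans x0).
have xp : 0 < x by rewrite lt_neqAle eq_sym xn0.
have yp := lt_le_trans xp xy.
rewrite /sinc2 !gt_eqF //; apply: sinc_decr; lra.
Qed.

(** Convexity of [u |-> cos^2 (sqrt u)] on [0, (pi/2)^2], as a tangent line
    inequality. *)
Lemma cos2_tangent r x : 0 <= r <= pi / 2 -> 0 <= x <= pi / 2 ->
  cos r ^+ 2 - sinc2 r * (x ^+ 2 - r ^+ 2) <= cos x ^+ 2.
Proof.
move=> /andP[r0 rp] /andP[x0 xp].
pose f z := cos z ^+ 2 + sinc2 r * z ^+ 2.
pose df z := 2 * z * (sinc2 r - sinc2 z).
have fd z : hasder f z (df z).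
  apply: hasder_eq; first by rewrite /f; der.
  rewrite /df mulrBr -sin2_sinc2 [2 * z]mulr_natl mulr2n sinD /=; ring.
suff : f r <= f x by rewrite /f; lra.
have [rx|/ltW xr] := leP r x.
  apply: (@der_ge0_le R f df) => // z /andP[rz zx].
  by rewrite /df mulr_ge0 ?subr_ge0 ?sinc2_decr //; lra.
apply: (@der_le0_ge R f df) => // z /andP[rz zx].
by rewrite /df mulr_ge0_le0 ?subr_le0 ?sinc2_decr //; lra.
Qed.

End Kernel.

Section KernelV.
Variables (R : realType) (d : nat).
Implicit Types (v w h : 'rV[R]_d).

(** The squared cosine of the distance, continued by 0 beyond [pi/2].  With this
    continuation both Hopf-Lax formulas become extrema over the whole space. *)
Definition ckernel w : R := cos (Num.min (enorm w) (pi / 2)) ^+ 2.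

Lemma ckernel_in w : enorm w <= pi / 2 -> ckernel w = cos (enorm w) ^+ 2.
Proof. by rewrite /ckernel => h; rewrite min_l. Qed.

Lemma ckernel_out w : pi / 2 <= enorm w -> ckernel w = 0.
Proof. by rewrite /ckernel => h; rewrite min_r // cos_pihalf expr0n. Qed.

Lemma ckernel_ge0 w : 0 <= ckernel w. Proof. exact: sqr_ge0. Qed.

Lemma ckernel_le1 w : ckernel w <= 1.
Proof. by rewrite /ckernel cos2sin2 gerBl sqr_ge0. Qed.

(** The gradient of [ckernel]; the factor [sinc2] keeps it meaningful at 0. *)
Definition grad_ckernel w : 'rV[R]_d := (- 2 * sinc2 (enorm w)) *: w.

(** [ckernel w] is a convex decreasing function of the squared norm, so the
    tangent line inequality in that variable gives a quadratic lower bound. *)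
Lemma ckernel_tangent w h : enorm w <= pi / 2 ->
  ckernel w + dotv (grad_ckernel w) h - sinc2 (enorm w) * enorm h ^+ 2 <= ckernel (w + h).
Proof.
move=> wp; have w0 := enorm_ge0 w; have pi0 := pi2_gt0 R.
set x := Num.min (enorm (w + h)) (pi / 2).
have x0 : 0 <= x by rewrite le_min enorm_ge0 ltW.
have xp : x <= pi / 2 by rewrite ge_min lexx orbT.
have wi : 0 <= enorm w <= pi / 2 by rewrite w0.
have xi : 0 <= x <= pi / 2 by rewrite x0.
have := cos2_tangent wi xi.
rewrite [ckernel (w + h)]/ckernel -/x (ckernel_in wp); apply: le_trans.
have : x ^+ 2 <= enorm (w + h) ^+ 2.
  by rewrite ler_pXn2r ?nnegrE ?enorm_ge0 // ge_min lexx.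
rewrite enormD_sq dotvZl => hx.
have := ler_wpM2l (sinc2_ge0 wi) hx; lra.
Qed.

Lemma ckernel_semiconvex w h : enorm w <= pi / 2 ->
  ckernel w + dotv (grad_ckernel w) h - enorm h ^+ 2 <= ckernel (w + h).
Proof.
move=> wp; apply: le_trans (ckernel_tangent h wp).
rewrite lerD2l lerN2 -[leRHS]mul1r ler_wpM2r ?sqr_ge0 //.
by rewrite sinc2_le1 ?enorm_ge0.
Qed.

Lemma ckernel_continuous : continuous ckernel.
Proof.
move=> w; rewrite /ckernel.
apply: (@continuous_comp _ _ _ (fun w => cos (Num.min (enorm w) (pi / 2))) (fun x => x ^+ 2));
  last exact: exprn_continuous.
apply: (@continuous_comp _ _ _ (fun w => Num.min (enorm w) (pi / 2)) cos);
  last exact: continuous_cos.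
by apply: continuous_min; [exact: enorm_continuous|exact: cst_continuous].
Qed.

(** Nonnegativity of the gap between the two Hopf-Lax formulas.  [x] is joined
    to [y] and [z] at angles [alpha] and [beta]; after clearing denominators the
    claim is [(r + sin alpha sin beta)^2 >= (cos alpha cos beta)^2] with
    [r = sqrt (p q) >= cos (alpha + beta)]. *)
Lemma cone_interpolation (t p q alpha beta r : R) : 0 < t < 1 -> 0 <= p -> 0 <= q ->
  0 <= alpha <= pi / 2 -> 0 <= beta <= pi / 2 -> 0 <= r -> r ^+ 2 = p * q ->
  cos (alpha + beta) <= r ->
  t * (cos beta ^+ 2 / (t + (1 - t) * q)) + (1 - t) * (cos alpha ^+ 2 / (1 - t + t * p)) <= 1.
Proof.
move=> /andP[t0 t1] p0 q0 al be r0 rpq.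
rewrite cosD => hr.
have sa : 0 <= sin alpha by rewrite sin_ge0_pi //; lra.
have sb : 0 <= sin beta by rewrite sin_ge0_pi //; lra.
have ca : 0 <= cos alpha by rewrite cos_ge0_pihalf //; lra.
have cb : 0 <= cos beta by rewrite cos_ge0_pihalf //; lra.
have D1 : 0 < t + (1 - t) * q by rewrite ltr_wpDr // mulr_ge0 //; lra.
have D2 : 0 < 1 - t + t * p by rewrite ltr_wpDr ?mulr_ge0 ?subr_gt0 // ltW.
have e1 : cos alpha ^+ 2 = 1 - sin alpha ^+ 2 by rewrite cos2sin2.
have e2 : cos beta ^+ 2 = 1 - sin beta ^+ 2 by rewrite cos2sin2.
have sab := mulr_ge0 sa sb.
have h1 : (cos alpha * cos beta) ^+ 2 <= (r + sin alpha * sin beta) ^+ 2.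
  rewrite ler_pXn2r ?nnegrE ?mulr_ge0 ?addr_ge0 //; lra.
rewrite exprMn e1 e2 in h1.
have h2 : 2 * (t * (1 - t)) * r * (sin alpha * sin beta) <=
    t ^+ 2 * p * sin beta ^+ 2 + (1 - t) ^+ 2 * q * sin alpha ^+ 2.
  set X := t ^+ 2 * p * sin beta ^+ 2; set Y := (1 - t) ^+ 2 * q * sin alpha ^+ 2.
  have X0 : 0 <= X by apply: mulr_ge0 (sqr_ge0 _); apply: mulr_ge0 p0; exact: sqr_ge0.
  have Y0 : 0 <= Y by apply: mulr_ge0 (sqr_ge0 _); apply: mulr_ge0 q0; exact: sqr_ge0.
  have t1' : 0 <= 1 - t by lra.
  rewrite -(ler_pXn2r (n := 2)) ?nnegrE ?addr_ge0 //; last first.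
    by rewrite !mulr_ge0 // ltW.
  have -> : (2 * (t * (1 - t)) * r * (sin alpha * sin beta)) ^+ 2 = 4 * X * Y.
    have -> : (2 * (t * (1 - t)) * r * (sin alpha * sin beta)) ^+ 2 =
      4 * t ^+ 2 * (1 - t) ^+ 2 * r ^+ 2 * sin alpha ^+ 2 * sin beta ^+ 2 by ring.
    by rewrite rpq /X /Y; ring.
  by rewrite -subr_ge0; have := sqr_ge0 (X - Y); congr (_ <= _); ring.
have t1t : 0 < t * (1 - t) by rewrite mulr_gt0 // subr_gt0.
have h3 := ler_wpM2l (ltW t1t) h1.
rewrite [t * (_ / _)]mulrA [(1 - t) * (_ / _)]mulrA -[leRHS](divff (lt0r_neq0 (mulr_gt0 D1 D2))).
rewrite addf_div ?lt0r_neq0 // ler_pM2r ?invr_gt0 ?mulr_gt0 //.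
rewrite e1 e2 -subr_ge0.
have -> : (t + (1 - t) * q) * (1 - t + t * p) - (t * (1 - sin beta ^+ 2) * (1 - t + t * p) +
    (1 - t) * (1 - sin alpha ^+ 2) * (t + (1 - t) * q)) =
  t ^+ 2 * p * sin beta ^+ 2 + (1 - t) ^+ 2 * q * sin alpha ^+ 2 +
  t * (1 - t) * (p * q) - t * (1 - t) * (1 - sin alpha ^+ 2 - sin beta ^+ 2) by ring.
rewrite -rpq; lra.
Qed.

End KernelV.

(** * The two Hopf-Lax formulas *)
Section HopfLax.
Variables (R : realType) (d : nat).
Local Notation V := ('rV[R]_d).
Variables (phi0 phi1 : V -> \bar R) (s : R).
Hypothesis hs : 0 < s < 1.

Let s0 : 0 < s. Proof. by case/andP: hs. Qed.
Let s1 : 0 < 1 - s. Proof. by rewrite subr_gt0; case/andP: hs. Qed.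

Let two0 : 0 < (2 : R). Proof. by []. Qed.

(** The weights of the two Hopf-Lax formulas as real numbers: an infinite
    denominator gives weight 0. *)
Definition weight0 (y : V) : R :=
  if expeR (2%:E * phi0 y)%E is r%:E then (1 - s + s * r)^-1 else 0.

Definition weight1 (z : V) : R :=
  if expeR (- (2%:E * phi1 z))%E is r%:E then (s + (1 - s) * r)^-1 else 0.

Lemma weight0_bounds y : 0 <= weight0 y <= (1 - s)^-1.
Proof.
rewrite /weight0; have := expeR_ge0 (2%:E * phi0 y)%E.
case: expeR => [r| |//] r0; last by rewrite lexx invr_ge0 ltW.
rewrite lee_fin in r0; have sr := mulr_ge0 (ltW s0) r0.
rewrite invr_ge0 addr_ge0 ?(ltW s1) //=.
by rewrite lef_pV2 ?lerDl ?posrE // ltr_wpDr.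
Qed.

Lemma weight1_bounds z : 0 <= weight1 z <= s^-1.
Proof.
rewrite /weight1; have := expeR_ge0 (- (2%:E * phi1 z))%E.
case: expeR => [r| |//] r0; last by rewrite lexx invr_ge0 ltW.
rewrite lee_fin in r0; have sr := mulr_ge0 (ltW s1) r0.
by rewrite invr_ge0 addr_ge0 ?(ltW s0) //= lef_pV2 ?lerDl ?posrE // ltr_wpDr.
Qed.

Lemma xi_term (x y : V) (c : R) :
  ((2 * s)^-1%:E * (1 - c%:E / (1 + (2 * s)%:E * xi0 phi0 y)))%E =
  ((2 * s)^-1 * (1 - c * weight0 y))%:E.
Proof.
rewrite /xi0 /weight0; have := expeR_ge0 (2%:E * phi0 y)%E.
case: expeR => [r| |//] r0.
  rewrite lee_fin in r0; have sr := mulr_ge0 (ltW s0) r0.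
  have n0 : 1 + 2 * s * (2^-1 * (r - 1)) = 1 - s + s * r by field.
  by rewrite -!(EFinB, EFinM, EFinD) n0 inver gt_eqF // ltr_wpDr.
by rewrite /= !gt0_muley ?lte_fin ?mulr_gt0 //= ?invr_gt0 // mule0 mulr0 subr0 sube0.
Qed.

Lemma xibar_term (x z : V) (c : R) :
  ((2 * (1 - s))^-1%:E * (c%:E / (1 - (2 * (1 - s))%:E * xibar1 phi1 z) - 1))%E =
  ((2 * (1 - s))^-1 * (c * weight1 z - 1))%:E.
Proof.
rewrite /xibar1 /weight1; have := expeR_ge0 (- (2%:E * phi1 z))%E.
case: expeR => [r| |//] r0.
  rewrite lee_fin in r0; have sr := mulr_ge0 (ltW s1) r0.
  have n0 : 1 - 2 * (1 - s) * (2^-1 * (1 - r)) = s + (1 - s) * r by field.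
  by rewrite -!(EFinB, EFinM, EFinD) n0 inver gt_eqF // ltr_wpDr.
by rewrite /= !gt0_muleNy ?lte_fin ?mulr_gt0 //= ?invr_gt0 // mule0 mulr0 sub0r.
Qed.

Lemma eball_ckernel (x y : V) : eball x (pi / 2) y -> cos (enorm (x - y)) ^+ 2 = ckernel (x - y).
Proof.
by rewrite /eball /= (enormB y x) => h; rewrite ckernel_in ?(ltW h).
Qed.

Lemma eball_center (x : V) (r : R) : 0 < r -> eball x r x.
Proof. by rewrite /eball /= subrr enorm0. Qed.

Lemma xi_le x y : (xi phi0 s x <= ((2 * s)^-1 * (1 - ckernel (x - y) * weight0 y))%:E)%E.
Proof.
have [yx|yx] := pselect (eball x (pi / 2) y).
  by apply: ereal_inf_lbound; exists y => //; rewrite -(xi_term x) eball_ckernel.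
rewrite ckernel_out; last by rewrite leNgt; apply/negP; rewrite enormB.
rewrite mul0r subr0 mulr1; apply: ge_ereal_inf.
exists ((2 * s)^-1 * (1 - ckernel (x - x) * weight0 x))%:E.
  by have cx := eball_center x (pi2_gt0 R); exists x => //; rewrite -(xi_term x) eball_ckernel.
rewrite lee_fin ger_pMr ?invr_gt0 ?mulr_gt0 // gerBl mulr_ge0 ?ckernel_ge0 //.
by case/andP: (weight0_bounds x).
Qed.

Lemma xibar_ge x z : (((2 * (1 - s))^-1 * (ckernel (x - z) * weight1 z - 1))%:E <= xibar phi1 s x)%E.
Proof.
have [zx|zx] := pselect (eball x (pi / 2) z).
  by apply: ereal_sup_ubound; exists z => //; rewrite -(xibar_term x) eball_ckernel.
rewrite ckernel_out; last by rewrite leNgt; apply/negP; rewrite enormB.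
rewrite mul0r sub0r; apply: le_ereal_sup_tmp.
exists ((2 * (1 - s))^-1 * (ckernel (x - x) * weight1 x - 1))%:E.
  by have cx := eball_center x (pi2_gt0 R); exists x => //; rewrite -(xibar_term x) eball_ckernel.
rewrite lee_fin ler_pM2l ?invr_gt0 ?mulr_gt0 // lerBrDr addNr mulr_ge0 ?ckernel_ge0 //.
by case/andP: (weight1_bounds x).
Qed.

Lemma xi_glb x (c : \bar R) :
  (forall y, enorm (x - y) < pi / 2 -> (c <= ((2 * s)^-1 * (1 - ckernel (x - y) * weight0 y))%:E)%E) ->
  (c <= xi phi0 s x)%E.
Proof.
move=> h; apply: le_ereal_inf_tmp => _ [y yx <-].
by rewrite (xi_term x) (eball_ckernel yx) h // enormB.
Qed.

Lemma xibar_lub x (c : \bar R) :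
  (forall z, enorm (x - z) < pi / 2 ->
    (((2 * (1 - s))^-1 * (ckernel (x - z) * weight1 z - 1))%:E <= c)%E) ->
  (xibar phi1 s x <= c)%E.
Proof.
move=> h; apply: ge_ereal_sup => _ [z zx <-].
by rewrite (xibar_term x) (eball_ckernel zx) h // enormB.
Qed.

Hypothesis phi1E : forall x1, phi1 x1 =
    ereal_inf [set phi0 x0 + L1 (x1 - x0)%R | x0 in eball x1 (pi / 2)%R]%E.

(** The inequality [phi1 z <= phi0 y + L1 (z - y)], exponentiated.  Infinite
    values of the potentials make one of the two weights vanish. *)
Lemma weights_dual (y z : V) : enorm (y - z) < pi / 2 ->
  weight1 z = 0 \/ weight0 y = 0 \/ exists a b, [/\ phi0 y = a%:E, phi1 z = b%:E &
     cos (enorm (y - z)) <= expR (a - b)].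
Proof.
move=> yz; have : (phi1 z <= phi0 y + (- ln (cos (enorm (y - z))))%:E)%E.
  rewrite phi1E; apply: ereal_inf_lbound; exists y => //.
  by rewrite /L1 enormB yz.
have c0 : 0 < cos (enorm (y - z)).
  by rewrite cos_gt0_pihalf // yz andbT (lt_le_trans _ (enorm_ge0 _)) // oppr_lt0 pi2_gt0.
rewrite /weight0 /weight1; case: (phi0 y) => [a| |].
- case: (phi1 z) => [b| |] //= h; last first.
    by left; rewrite gt0_muleNy ?lte_fin.
  right; right; exists a, b; split=> //.
  rewrite -[leLHS]lnK ?posrE // ler_expR.
  by move: h; rewrite -EFinD lee_fin; lra.
- by right; left; rewrite gt0_muley ?lte_fin.
- by rewrite addNye leeNy_eq => /eqP ->; left; rewrite gt0_muleNy ?lte_fin.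
Qed.

(** For every pair of points the duality of the potentials feeds the cone
    inequality, with [r] the square root of the product of the two exponentials;
    at distance at least [pi/2] the cosine of the angle sum is nonpositive. *)
Lemma xibar_le_xi x : (xibar phi1 s x <= xi phi0 s x)%E.
Proof.
apply: xibar_lub => z xz; apply: xi_glb => y xy; rewrite lee_fin.
suff h : s * (ckernel (x - z) * weight1 z) + (1 - s) * (ckernel (x - y) * weight0 y) <= 1.
  rewrite -(ler_pM2l (mulr_gt0 (mulr_gt0 two0 s0) s1)).
  have -> : 2 * s * (1 - s) * ((2 * (1 - s))^-1 * (ckernel (x - z) * weight1 z - 1)) =
    s * (ckernel (x - z) * weight1 z - 1) by field; rewrite gt_eqF.
  have -> : 2 * s * (1 - s) * ((2 * s)^-1 * (1 - ckernel (x - y) * weight0 y)) =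
    (1 - s) * (1 - ckernel (x - y) * weight0 y) by field; rewrite gt_eqF.
  lra.
have kz0 := ckernel_ge0 (x - z); have kz1 := ckernel_le1 (x - z).
have ky0 := ckernel_ge0 (x - y); have ky1 := ckernel_le1 (x - y).
have /andP[w0 w0'] := weight0_bounds y; have /andP[w1 w1'] := weight1_bounds z.
have hy : (1 - s) * (ckernel (x - y) * weight0 y) <= 1.
  rewrite -[leRHS](mulfV (lt0r_neq0 s1)) ler_pM2l //.
  by apply: le_trans w0'; rewrite -[leRHS](mul1r (weight0 y)) ler_wpM2r.
have hz : s * (ckernel (x - z) * weight1 z) <= 1.
  rewrite -[leRHS](mulfV (lt0r_neq0 s0)) ler_pM2l //.
  by apply: le_trans w1'; rewrite -[leRHS](mul1r (weight1 z)) ler_wpM2r.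
have [wz|wz] := eqVneq (weight1 z) 0; first by rewrite wz !mulr0 add0r.
have [wy|wy] := eqVneq (weight0 y) 0; first by rewrite wy !mulr0 addr0.
have tri : enorm (y - z) <= enorm (x - y) + enorm (x - z).
  by rewrite (enormB x y) (_ : y - z = (y - x) + (x - z)) ?enormD // addrA subrK.
have yx0 := enorm_ge0 (x - y); have zx0 := enorm_ge0 (x - z); have yz0 := enorm_ge0 (y - z).
rewrite !ckernel_in ?(ltW xz) ?(ltW xy) //.
have key (p q r : R) : 0 <= p -> 0 <= q -> 0 <= r -> r ^+ 2 = p * q ->
    cos (enorm (x - y) + enorm (x - z)) <= r ->
    s * (cos (enorm (x - z)) ^+ 2 * (s + (1 - s) * q)^-1) +
    (1 - s) * (cos (enorm (x - y)) ^+ 2 * (1 - s + s * p)^-1) <= 1.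
  by move=> p0 q0 r0 rpq hr; apply: (cone_interpolation hs p0 q0 _ _ r0 rpq hr);
     rewrite ?yx0 ?zx0 ltW.
have [yz|yz] := ltP (enorm (y - z)) (pi / 2).
  have [/eqP|[/eqP|[a [b [pa pb hab]]]]] := weights_dual yz.
  - by rewrite (negPf wz).
  - by rewrite (negPf wy).
  rewrite /weight0 /weight1 pa pb /=.
  apply: (key _ _ (expR (a - b))); rewrite ?expR_ge0 //.
    by rewrite expr2 -!expRD; congr expR; ring.
  apply: le_trans hab; move: tri; rewrite le_eqVlt => /predU1P[->//|tri].
  by rewrite ltW // ltr_cos ?in_itv /= ?yz0 /=; lra.
have cneg : cos (enorm (x - y) + enorm (x - z)) <= 0.
  rewrite -(subrK (pi / 2) (enorm (x - y) + enorm (x - z))) cosDpihalf oppr_le0.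
  by rewrite sin_ge0_pi //; lra.
move: wz wy; rewrite /weight0 /weight1.
have := expeR_ge0 (2%:E * phi0 y)%E; case: expeR => [p| |//]; last by rewrite eqxx.
have := expeR_ge0 (- (2%:E * phi1 z))%E; case: expeR => [q| |//]; last by rewrite eqxx.
rewrite !lee_fin => q0 p0 _ _; apply: (key _ _ (Num.sqrt (p * q))); rewrite ?sqrtr_ge0 //.
  by rewrite sqr_sqrtr // mulr_ge0.
by apply: le_trans cneg _; rewrite sqrtr_ge0.
Qed.

Lemma xi_bounds x : exists2 a : R, xi phi0 s x = a%:E & - (2 * (1 - s))^-1 <= a <= (2 * s)^-1.
Proof.
have h1 : (xi phi0 s x <= ((2 * s)^-1)%:E)%E.
  apply: le_trans (xi_le x x) _; rewrite lee_fin ger_pMr ?invr_gt0 ?mulr_gt0 //.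
  by rewrite gerBl mulr_ge0 ?ckernel_ge0 //; case/andP: (weight0_bounds x).
have h2 : ((- (2 * (1 - s))^-1)%:E <= xi phi0 s x)%E.
  apply: le_trans (le_trans (xibar_ge x x) (xibar_le_xi x)); rewrite lee_fin.
  rewrite -[leLHS]mulrN1 ler_pM2l ?invr_gt0 ?mulr_gt0 // lerBrDr addNr mulr_ge0 ?ckernel_ge0 //.
  by case/andP: (weight1_bounds x).
by case: (xi phi0 s x) h1 h2 => [a| |] // h1 h2; exists a => //; rewrite -!lee_fin h1 h2.
Qed.

Lemma xiE x : xi phi0 s x = (rxi phi0 s x)%:E.
Proof. by rewrite /rxi; have [a ->] := xi_bounds x. Qed.

Lemma rxi_le x y : 1 - 2 * s * rxi phi0 s x >= weight0 y * ckernel (x - y).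
Proof.
have := xi_le x y; rewrite xiE lee_fin => h.
have := ler_wpM2l (ltW (mulr_gt0 two0 s0)) h.
by rewrite mulrA mulfV ?mul1r ?gt_eqF ?mulr_gt0 //; lra.
Qed.

Lemma rxi_ge x z : weight1 z * ckernel (x - z) <= 1 + 2 * (1 - s) * rxi phi0 s x.
Proof.
have := le_trans (xibar_ge x z) (xibar_le_xi x); rewrite xiE lee_fin => h.
have := ler_wpM2l (ltW (mulr_gt0 two0 s1)) h.
by rewrite mulrA mulfV ?mul1r ?gt_eqF ?mulr_gt0 //; lra.
Qed.

Lemma rxi_approx_inf x (e : R) : 0 < e -> exists2 y, enorm (x - y) < pi / 2 &
  1 - 2 * s * rxi phi0 s x - e <= weight0 y * ckernel (x - y).
Proof.
move=> e0; apply: contrapT => hn; have ss := mulr_gt0 two0 s0.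
have : ((rxi phi0 s x + e / (2 * s))%:E <= xi phi0 s x)%E.
  apply: xi_glb => y xy; rewrite lee_fin leNgt; apply/negP => h.
  apply: hn; exists y => //; move: h.
  by rewrite -(ltr_pM2l ss) mulVKf ?gt_eqF // mulrDr mulrCA mulfV ?gt_eqF //; lra.
by rewrite xiE lee_fin gerDl leNgt divr_gt0.
Qed.

Lemma rxi_approx_sup x (e : R) : Xi phi0 phi1 s x -> 0 < e ->
  exists2 z, enorm (x - z) < pi / 2 &
  1 + 2 * (1 - s) * rxi phi0 s x - e <= weight1 z * ckernel (x - z).
Proof.
move=> Xx e0; apply: contrapT => hn; have ss := mulr_gt0 two0 s1.
have : (xibar phi1 s x <= (rxi phi0 s x - e / (2 * (1 - s)))%:E)%E.
  apply: xibar_lub => z xz; rewrite lee_fin leNgt; apply/negP => h.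
  apply: hn; exists z => //; move: h.
  by rewrite -(ltr_pM2l ss) mulVKf ?gt_eqF // mulrBr mulrCA mulfV ?gt_eqF //; lra.
by rewrite -Xx xiE lee_fin lerBrDr gerDl leNgt divr_gt0.
Qed.

End HopfLax.

Section Touching.
Variables (R : realType) (d : nat).
Local Notation V := ('rV[R]_d).

(** The multiplier is bounded by a constant, so that the first-order remainders
    obtained from touching are uniform in the base point. *)
Definition touched (Mx : R) (G : V -> R) : Prop :=
  exists m w, [/\ 0 <= m <= Mx, enorm w <= pi / 2, G 0 = m * ckernel w &
    forall h, m * ckernel (w + h) <= G h].

(** The extremum in a Hopf-Lax formula need not be attained, because the
    potentials are only semicontinuous and the weights may vanish in the limit;
    but weights and base points range in a compact set, so that a limit of
    almost optimal kernels touches. *)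
Lemma touched_compact Mx G : (forall e, 0 < e -> exists m w,
    [/\ 0 <= m <= Mx, enorm w <= pi / 2, G 0 - e <= m * ckernel w &
    forall h, m * ckernel (w + h) <= G h]) -> touched Mx G.
Proof.
move=> happ.
pose P n (z : R * V) := [/\ 0 <= z.1 <= Mx, enorm z.2 <= pi / 2,
    G 0 - n.+1%:R^-1 <= z.1 * ckernel z.2 & forall h, z.1 * ckernel (z.2 + h) <= G h].
have [z hz] : {z : nat -> R * V & forall n, P n (z n)}.
  apply: choice => n; have [|m [w hmw]] := happ (n.+1%:R^-1); first by rewrite invr_gt0.
  by exists (m, w).
have K1 : compact [set w : V | enorm w <= pi / 2].
  apply: bounded_closed_compact.
    exists (pi / 2); split; first exact: num_real.
    move=> M hM w /= hw.
    by apply: le_trans (sup_le_enorm w) (le_trans hw (ltW hM)).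
  by apply: preimage_closed (@closed_le R (pi / 2)) => x _; exact: enorm_continuous.
have K2 : compact [set m : R | 0 <= m <= Mx].
  rewrite (_ : [set m | _] = `[0, Mx]%classic); first exact: segment_compact.
  by apply/seteqP; split => m; rewrite /= in_itv.
have [|[m w] [[/= hm hw] hcl]] := compact_setX K2 K1 (F := z @ \oo).
  by exists 0%N => // n _ /=; have [] := hz n.
have cont h : {for (m, w), continuous (fun p : R * V => p.1 * ckernel (p.2 + h))}.
  apply: cvgM; first exact: cvg_fst.
  apply: (@continuous_comp _ _ _ (fun p : R * V => p.2 + h) (@ckernel R d)); last exact: ckernel_continuous.
  by apply: cvgD; [exact: cvg_snd|exact: cvg_cst].
have below h : m * ckernel (w + h) <= G h.
  rewrite leNgt; apply/negP => Gh.
  have : nbhs (m, w) [set p : R * V | G h < p.1 * ckernel (p.2 + h)].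
    exact: (cont h) _ (lt_nbhsr Gh).
  move=> /(hcl [set p | p.1 * ckernel (p.2 + h) <= G h]) [|p [/= h1 h2]].
    by exists 0%N => // n _ /=; have [] := hz n.
  by move: (le_lt_trans h1 h2); rewrite ltxx.
exists m, w; split=> //; apply/eqP; rewrite eq_le -{2}[w]addr0 below andbT leNgt.
apply/negP => G0; pose e := (G 0 - m * ckernel w) / 2.
have e0 : 0 < e by rewrite divr_gt0 // subr_gt0.
have : nbhs (m, w) [set p : R * V | p.1 * ckernel (p.2 + 0) < G 0 - e].
  have G0e : m * ckernel (w + 0) < G 0 - e by rewrite addr0 /e; lra.
  exact: (cont 0) _ (lt_nbhsl G0e).
move=> /(hcl [set p | G 0 - e <= p.1 * ckernel (p.2 + 0)]) [|p [/= h1 h2]].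
  have := near_infty_natSinv_lt (PosNum e0); apply: filterS => n /= ne.
  have [_ _ h _] := hz n; rewrite addr0; apply: le_trans h.
  by rewrite lerD2l lerN2 ltW.
by move: (le_lt_trans h1 h2); rewrite ltxx.
Qed.

End Touching.

(** * Lebesgue measure and density points *)
Section LebesgueOuter.
Variables (R : realType) (d : nat).
Local Notation V := ('rV[R]_d).
Implicit Types (A B S : set V) (a b : nat -> V).

Definition vol (p q : V) : R := \prod_i (q 0 i - p 0 i).

Definition boxcover A a b :=
  (forall k i, a k 0 i <= b k 0 i) /\ A `<=` \bigcup_k box (a k) (b k).

Definition volsum a b : \bar R := (\sum_(0 <= k <oo) (vol (a k) (b k))%:E)%E.

Lemma vol_ge0 a b k : (forall k i, a k 0 i <= b k 0 i) -> (0 <= (vol (a k) (b k))%:E)%E.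
Proof. by move=> ab; rewrite lee_fin; apply: prodr_ge0 => i _; rewrite subr_ge0. Qed.

Lemma lebesgue_le_cover A a b : boxcover A a b -> (lebesgue A <= volsum a b)%E.
Proof. by move=> [ab Aab]; apply: ereal_inf_lbound; exists a, b; split. Qed.

Lemma lebesgue_glb A x :
  (forall a b, boxcover A a b -> (x <= volsum a b)%E) -> (x <= lebesgue A)%E.
Proof. by move=> h; apply: le_ereal_inf_tmp => _ [a [b [ab Aab ->]]]; apply: h. Qed.

Lemma lebesgue_lt A x : (lebesgue A < x)%E -> exists a b, boxcover A a b /\ (volsum a b < x)%E.
Proof. by move=> /ereal_inf_lt[_ [a [b [ab Aab ->]]] h]; exists a, b. Qed.

Lemma lebesgue_ge0 A : (0 <= lebesgue A)%E.
Proof.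
by apply: lebesgue_glb => a b [ab _]; apply: nneseries_ge0 => k _ _; exact: vol_ge0.
Qed.

Lemma lebesgue_mono A B : A `<=` B -> (lebesgue A <= lebesgue B)%E.
Proof.
move=> AB; apply: lebesgue_glb => a b [ab Bab].
by apply: lebesgue_le_cover; split=> //; exact: subset_trans Bab.
Qed.

(** Almost optimal covers of the two sets are interleaved into one. *)
Lemma lebesgue_subadd A B : (lebesgue (A `|` B) <= lebesgue A + lebesgue B)%E.
Proof.
have [/eqP|Afin] := eqVneq (lebesgue A + lebesgue B)%E +oo%E.
  by move=> /eqP ->; rewrite leey.
have [Af Bf] : (lebesgue A < +oo /\ lebesgue B < +oo)%E.
  rewrite -ltey in Afin; split; apply: le_lt_trans Afin.
    by rewrite leeDl ?lebesgue_ge0.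
  by rewrite leeDr ?lebesgue_ge0.
apply/lee_addgt0Pr => e e0.
have lt_half (C : set V) : (lebesgue C < +oo)%E -> (lebesgue C < lebesgue C + (e / 2)%:E)%E.
  move=> Cf; rewrite lteDl ?lte_fin ?divr_gt0 //.
  by rewrite ge0_fin_numE ?lebesgue_ge0.
have [a [b [[ab Aab] sab]]] := lebesgue_lt (lt_half _ Af).
have [a' [b' [[ab' Bab'] sab']]] := lebesgue_lt (lt_half _ Bf).
pose c k := if odd k then a' k./2 else a k./2.
pose c' k := if odd k then b' k./2 else b k./2.
have cc' k i : c k 0 i <= c' k 0 i by rewrite /c /c'; case: ifP.
apply: (@le_trans _ _ (volsum c c')).
  apply: lebesgue_le_cover; split=> // x [/Aab[k _ xk]|/Bab'[k _ xk]].
    by exists k.*2 => //; rewrite /c /c' odd_double doubleK.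
  by exists k.*2.+1 => //; rewrite /c /c' /= odd_double /= uphalf_double.
apply: (@le_trans _ _ (volsum a b + volsum a' b')%E); last first.
  rewrite [e]splitr EFinD addeACA; apply: leeD; exact: ltW.
rewrite /volsum -nneseriesD; [|by move=> k _ _; exact: vol_ge0..].
apply: lime_le; first by apply: is_cvg_nneseries => k _ _; exact: vol_ge0.
apply: nearW => n.
have vp (p q : nat -> V) k : (forall k i, p k 0 i <= q k 0 i) -> (0 <= (vol (p k) (q k))%:E)%E.
  exact: vol_ge0.
apply: (@le_trans _ _ (\sum_(0 <= k < n.*2) (vol (c k) (c' k))%:E)%E).
  rewrite (@big_cat_nat _ _ _ n 0 n.*2) //= -?addnn ?leq_addr //.
  by rewrite leeDl //; apply: sume_ge0 => k _; exact: vp.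
have -> : (\sum_(0 <= k < n.*2) (vol (c k) (c' k))%:E =
    \sum_(0 <= k < n) ((vol (a k) (b k))%:E + (vol (a' k) (b' k))%:E))%E.
  elim: n => [|n IH]; first by rewrite !big_geq.
  rewrite doubleS !big_nat_recr //= IH -addeA; congr (_ + (_ + _))%E.
    by rewrite /c /c' odd_double doubleK.
  by rewrite /c /c' /= odd_double /= uphalf_double.
by apply: nneseries_lim_ge => k _ _; rewrite adde_ge0 // vp.
Qed.

(** Caratheodory measurability of [S], in the direction that is not automatic. *)
Definition splits S :=
  forall A, (lebesgue (A `&` S) + lebesgue (A `\` S) <= lebesgue A)%E.

Lemma splitsI S T : splits S -> splits T -> splits (S `&` T).
Proof.
move=> sS sT A; apply: le_trans (sS A).
apply: (@le_trans _ _ (lebesgue (A `&` S `&` T) + (lebesgue ((A `&` S) `\` T) + lebesgue (A `\` S)))%E).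
  rewrite setIA leeD2l //; apply: le_trans (lebesgue_subadd _ _).
  apply: lebesgue_mono => x [Ax nST].
  have [Sx|nSx] := pselect (S x); last by right.
  by left; split => // Tx; exact: nST.
by rewrite addeA leeD2r // sT.
Qed.

Lemma lebesgue_set0 : (0 < d)%N -> lebesgue (set0 : set V) = 0%E.
Proof.
move=> d0; apply/eqP; rewrite eq_le lebesgue_ge0 andbT.
apply: (@le_trans _ _ (volsum (fun=> 0) (fun=> 0))).
  by apply: lebesgue_le_cover; split => // k i; exact: lexx.
rewrite /volsum eseries0 // => k _ _.
by rewrite /vol (bigD1 (Ordinal d0)) //= subrr mul0r.
Qed.

Lemma splits_all (I : eqType) (s : seq I) (F : I -> set V) : (0 < d)%N ->
  (forall i, splits (F i)) -> splits [set x | forall i, i \in s -> F i x].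
Proof.
move=> d0 sF; elim: s => [|i s IH].
  move=> A; rewrite (_ : A `\` _ = set0); last by apply/seteqP; split => x // [_]; apply.
  by rewrite lebesgue_set0 // adde0; apply: lebesgue_mono => x [].
have := splitsI (sF i) IH; congr splits; apply/seteqP; split => x /=.
  by move=> [Fi Fs] j; rewrite inE => /predU1P[->//|]; exact: Fs.
move=> Fs; split; first by apply: Fs; rewrite inE eqxx.
by move=> j js; apply: Fs; rewrite inE js orbT.
Qed.

(** Clamping [c] to the side makes one of the pieces degenerate when the
    hyperplane misses the box, so that no case distinction is needed. *)
Lemma vol_cut (p q : V) i c : p 0 i <= q 0 i ->
  let m := Num.min (q 0 i) (Num.max (p 0 i) c) in
  vol p q = vol p (\row_j if j == i then m else q 0 j) + vol (\row_j if j == i then m else p 0 j) q.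
Proof.
move=> pq m; rewrite /vol [LHS](bigD1 i) // [X in _ = X + _](bigD1 i) //.
rewrite [X in _ = _ + X](bigD1 i) //= !mxE eqxx.
rewrite [X in _ = _ * X + _](eq_bigr (fun j => q 0 j - p 0 j)); last first.
  by move=> j /negPf ji; rewrite mxE ji.
rewrite [X in _ = _ + _ * X](eq_bigr (fun j => q 0 j - p 0 j)); last first.
  by move=> j /negPf ji; rewrite mxE ji.
by ring.
Qed.

Lemma splits_le i c : splits [set x : V | x 0 i <= c].
Proof.
move=> A; apply: lebesgue_glb => a b [ab Aab].
pose m k := Num.min (b k 0 i) (Num.max (a k 0 i) c).
pose b' k := \row_j (if j == i then m k else b k 0 j).
pose a' k := \row_j (if j == i then m k else a k 0 j).
have ab' k j : a k 0 j <= b' k 0 j.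
  by rewrite mxE; case: eqP => // ->; rewrite le_min ab le_max lexx.
have a'b k j : a' k 0 j <= b k 0 j.
  by rewrite mxE; case: eqP => // ->; rewrite ge_min lexx.
have -> : volsum a b = (volsum a b' + volsum a' b)%E.
  rewrite /volsum -nneseriesD; [|by move=> k _ _; exact: vol_ge0..].
  by apply: eq_eseriesr => k _; rewrite -EFinD (vol_cut c (ab k i)).
apply: leeD; apply: lebesgue_le_cover; split=> // x [/Aab[k _ xk]] /= xc.
  exists k => // j; rewrite mxE; have /andP[h1 h2] := xk j; rewrite h1.
  by case: eqP => //= ji; rewrite le_min -ji h2 le_max ji xc orbT.
exists k => // j; rewrite mxE; have /andP[h1 h2] := xk j; rewrite h2 andbT.
case: eqP => //= ji; move/negP: xc; rewrite -ltNge -ji => /ltW xc.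
by rewrite ge_min ge_max -ji h1 xc orbT.
Qed.

Lemma splits_ge i c : splits [set x : V | c <= x 0 i].
Proof.
move=> A; apply: lebesgue_glb => a b [ab Aab].
pose m k := Num.min (b k 0 i) (Num.max (a k 0 i) c).
pose b' k := \row_j (if j == i then m k else b k 0 j).
pose a' k := \row_j (if j == i then m k else a k 0 j).
have ab' k j : a k 0 j <= b' k 0 j.
  by rewrite mxE; case: eqP => // ->; rewrite le_min ab le_max lexx.
have a'b k j : a' k 0 j <= b k 0 j.
  by rewrite mxE; case: eqP => // ->; rewrite ge_min lexx.
have -> : volsum a b = (volsum a' b + volsum a b')%E.
  rewrite /volsum -nneseriesD; [|by move=> k _ _; exact: vol_ge0..].
  by apply: eq_eseriesr => k _; rewrite -EFinD (vol_cut c (ab k i)) addrC.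
apply: leeD; apply: lebesgue_le_cover; split=> // x [/Aab[k _ xk]] /= xc.
  exists k => // j; rewrite mxE; have /andP[h1 h2] := xk j; rewrite h2 andbT.
  by case: eqP => //= ji; rewrite ge_min ge_max -ji h1 ji xc orbT.
exists k => // j; rewrite mxE; have /andP[h1 h2] := xk j; rewrite h1.
case: eqP => //= ji; move/negP: xc; rewrite -ltNge -ji => /ltW xc.
by rewrite le_min -ji h2 le_max xc orbT.
Qed.

Lemma splits_box (p q : V) : (0 < d)%N -> splits (box p q).
Proof.
move=> d0.
have := @splits_all _ (enum 'I_d) (fun i => [set x : V | p 0 i <= x 0 i] `&` [set x : V | x 0 i <= q 0 i]) d0
  (fun i => splitsI (@splits_ge i (p 0 i)) (@splits_le i (q 0 i))).
congr splits; apply/seteqP; split => x /= h i.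
  by have [|h1 h2] := h i; [rewrite mem_enum|apply/andP].
by move=> _; have /andP := h i.
Qed.

(** Covers of [A] are mapped to covers of the image, whose volumes are multiplied
    by the determinant of the map. *)
Lemma lebesgue_affine (v : V) (c : R) A : 0 < c ->
  ((c^-1 ^+ d)%:E * lebesgue ((fun y => v + c *: y)%R @` A) <= lebesgue A)%E.
Proof.
move=> c0; apply: lebesgue_glb => a b [ab Aab].
pose a' k := v + c *: a k; pose b' k := v + c *: b k.
have volc k : vol (a' k) (b' k) = c ^+ d * vol (a k) (b k).
  rewrite /vol -[d in c ^+ d]card_ord -prodr_const -big_split /=.
  by apply: eq_bigr => i _; rewrite !mxE; ring.
have cd0 : 0 <= c ^+ d by rewrite exprn_ge0 // ltW.
have -> : volsum a b = ((c^-1 ^+ d)%:E * volsum a' b')%E.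
  rewrite /volsum -nneseriesZl; last first.
    by move=> k _; rewrite lee_fin volc mulr_ge0 //; have := vol_ge0 k ab; rewrite lee_fin.
  apply: eq_eseriesr => k _; rewrite -EFinM volc mulrA -exprMn mulVf ?gt_eqF //.
  by rewrite expr1n mul1r.
rewrite lee_pmul2l ?lte_fin ?exprn_gt0 ?invr_gt0 //.
apply: lebesgue_le_cover; split.
  by move=> k i; rewrite !mxE lerD2l ler_pM2l.
move=> _ [y /Aab[k _ yk] <-]; exists k => // i.
by rewrite !mxE !lerD2l !ler_pM2l //; exact: yk.
Qed.

End LebesgueOuter.

Lemma near_right0 (R : realType) (P : R -> Prop) : (\forall r \near (0 : R)^'+, P r) ->
  exists2 r0 : R, 0 < r0 & forall r, 0 < r < r0 -> P r.
Proof.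
rewrite /at_right near_withinE => /nbhs_ballP[e /= e0 h]; exists e => // r /andP[r0 re].
by apply: h => //; rewrite /ball /= sub0r normrN gtr0_norm.
Qed.

(** A set is seen from each of its density points in every direction: removing
    from a ball a box of comparable size removes a fixed fraction of its measure. *)
Lemma density_approx (R : realType) (d : nat) (X : set 'rV[R]_d) (x v : 'rV[R]_d) (e : R) :
  (0 < d)%N -> density_point X x -> 0 < e ->
  exists2 r0, 0 < r0 & forall r, 0 < r < r0 ->
    exists2 y, X y & enorm (y - (x + r *: v)) < e * r.
Proof.
move=> d0 Xx e0.
pose e' := e / (d%:R + 1); pose K := enorm v + e.
have d1 : 0 < (d%:R + 1 : R) by rewrite ltr_wpDl.
have e'0 : 0 < e' by rewrite divr_gt0.
have de' : d%:R * e' < e.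
  by rewrite mulrCA gtr_pMr // ltr_pdivrMr // mul1r ltrDl.
have K0 : 0 < K by rewrite ltr_wpDl ?enorm_ge0.
(* the homothety of ratio [c] sends the box [D] below to a cube around the ball [B] *)
pose c := K / e'; have c0 : 0 < c by rewrite divr_gt0.
pose q := c^-1 ^+ d; have q0 : 0 < q by rewrite exprn_gt0 // invr_gt0.
have [r1 r10 hr1] : exists2 r1 : R, 0 < r1 & forall r, 0 < r < r1 ->
    let m := fine (lebesgue (X `&` eball x r)) / fine (lebesgue (eball x r)) in
    0 < m /\ 1 - q < m.
  apply: near_right0.
  have q1 : 0 < Num.min 1 q by rewrite lt_min ltr01 q0.
  move: Xx => /cvgrPdist_lt/(_ _ q1); apply: filterS => r /=.
  by rewrite lt_min !ltr_norml => /andP[/andP[_ h1] /andP[_ h2]]; split; lra.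
exists (r1 / K); first by rewrite divr_gt0.
move=> r /andP[r0]; rewrite ltr_pdivlMr // => rK.
have rK0 : 0 < K * r by rewrite mulr_gt0.
have [|m0 m1] := hr1 (K * r); first by rewrite rK0 mulrC.
move: m0 m1; set B := eball x (K * r) => m0 m1.
apply: contrapT => noy.
pose D := box (\row_i ((x + r *: v) 0 i - e' * r)) (\row_i ((x + r *: v) 0 i + e' * r)).
have DE y : D y <-> forall i, `|(y - (x + r *: v)) 0 i| <= e' * r.
  split=> h i; have := h i; rewrite !mxE ler_norml.
    by move=> /andP[? ?]; apply/andP; split; lra.
  by move=> /andP[? ?]; apply/andP; split; lra.
have Dnear y : D y -> enorm (y - (x + r *: v)) < e * r.
  move=> /DE h; apply: le_lt_trans (enorm_coord_le _ h) _.
    by rewrite mulr_ge0 // ltW.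
  by rewrite mulrA ltr_pM2r.
have DB : D `<=` B.
  move=> y /Dnear h; rewrite /B /eball /= (_ : y - x = (y - (x + r *: v)) + r *: v).
    apply: le_lt_trans (enormD _ _) _; rewrite enormZ gtr0_norm // /K; lra.
  by rewrite opprD addrA subrK.
have qB : (q%:E * lebesgue B <= lebesgue D)%E.
  apply: le_trans (lebesgue_affine (x - c *: (x + r *: v)) D c0).
  rewrite lee_pmul2l ?lte_fin //; apply: lebesgue_mono => z Bz.
  exists ((x + r *: v) + c^-1 *: (z - x)); last first.
    move: (x + r *: v) => P.
    by rewrite scalerDr scalerA divff ?gt_eqF // scale1r addrA subrK addrC subrK.
  apply/DE => i; rewrite addrAC subrr add0r mxE normrM gtr0_norm ?invr_gt0 //.
  rewrite ler_pdivrMl //; apply: le_trans (enorm_coord _ _) _.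
  have -> : c * (e' * r) = K * r by rewrite /c; field; rewrite gt_eqF.
  exact: ltW Bz.
have XB : (lebesgue (X `&` B) + q%:E * lebesgue B <= lebesgue B)%E.
  apply: le_trans (splits_box _ _ d0 B); rewrite addeC; apply: leeD.
    by apply: le_trans qB _; apply: lebesgue_mono => y Dy; split => //; exact: DB.
  apply: lebesgue_mono => y [Xy By]; split=> // Dy; apply: noy.
  by exists y => //; exact: Dnear.
have Bn0 : fine (lebesgue B) != 0.
  by apply: contraTneq m0 => ->; rewrite invr0 mulr0 ltxx.
have Bfin : (lebesgue B)%E = (fine (lebesgue B))%:E.
  by have := lebesgue_ge0 B; case: (lebesgue B) Bn0 => //=; rewrite eqxx.
have B0 : 0 < fine (lebesgue B).
  by rewrite lt0r Bn0 fine_ge0 // lebesgue_ge0.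
have XBfin : lebesgue (X `&` B) = (fine (lebesgue (X `&` B)))%:E.
  rewrite fineK // ge0_fin_numE ?lebesgue_ge0 //.
  by apply: le_lt_trans (lebesgue_mono (@subIsetr _ X B)) _; rewrite Bfin ltry.
move: XB; rewrite XBfin Bfin -EFinM -EFinD lee_fin => XB.
move: m1; rewrite ltr_pdivlMr //; lra.
Qed.

(** * First-order expansions *)
Section Taylor.
Variables (R : realType) (d : nat).
Local Notation V := ('rV[R]_d).

Lemma gradient_taylor (F : V -> R) (y p : V) (C : R) :
  (forall h, `|F (y + h) - F y - dotv p h| <= C * enorm h ^+ 2) -> gradient F y = p.
Proof.
move=> hF; apply/rowP => i; rewrite mxE; apply: cvg_lim; first exact: Rhausdorff.
apply/cvgrPdist_le => e e0.
have C1 : 0 < `|C| + 1 by rewrite ltr_wpDl.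
near=> h.
have h0 : h != 0 by near: h; exact: nbhs_dnbhs_neq.
have hh : `|h| < e / (`|C| + 1) by near: h; apply: dnbhs0_lt; rewrite divr_gt0.
have hp : 0 < `|h| by rewrite normr_gt0.
rewrite /= addrC -(dotv_delta p i) /GRing.scale /=.
have -> : - (h^-1 * (F (h *: delta_mx 0 i + y) - F y)) + dotv p (delta_mx 0 i) =
  - h^-1 * (F (y + h *: delta_mx 0 i) - F y - dotv p (h *: delta_mx 0 i)).
  by rewrite dotvZr [y + _]addrC; field.
rewrite normrM normrN normfV ler_pdivrMl //; apply: le_trans (hF _) _.
rewrite enormZ enorm_delta mulr1 expr2 mulrCA ler_pM2l //.
apply: (@le_trans _ _ ((`|C| + 1) * `|h|)).
  by rewrite ler_wpM2r // (le_trans (ler_norm C)) // lerDl.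
by move: hh; rewrite ltr_pdivlMr // mulrC => /ltW.
Unshelve. all: by end_near.
Qed.

(** A linear form bounded by a square is tested on small multiples of its own
    gradient. *)
Lemma linear_le_square (D : V) (C : R) : (forall h, dotv D h <= C * enorm h ^+ 2) -> D = 0.
Proof.
move=> hD; apply: enorm_eq0; apply/eqP; rewrite eq_le enorm_ge0 andbT leNgt.
apply/negP => D0; have C1 : 0 < 2 * (`|C| + 1) by rewrite mulr_gt0 // ltr_wpDl.
have := hD ((2 * (`|C| + 1))^-1 *: D).
rewrite dotvZr enormZ -enorm_sq exprMn real_normK ?num_real //.
rewrite [C * (_ * _)]mulrA ler_pM2r ?exprn_gt0 // expr2 mulrA -[leLHS]mul1r ler_pM2r ?invr_gt0 //.
rewrite ler_pdivlMr // mul1r; have := ler_norm C; have := normr_ge0 C; lra.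
Qed.

(** Two-sided touching at [y] pins down the gradient, with a remainder that is
    uniform in [y]. *)
Lemma touched_taylor (F : V -> R) (y : V) (s t M N : R) : 0 < s -> 0 < t ->
  touched M (fun h => 1 + 2 * t * F (y + h)) ->
  touched N (fun h => 1 - 2 * s * F (y + h)) ->
  forall h, `|F (y + h) - F y - dotv (gradient F y) h| <= (M / (2 * t) + N / (2 * s)) * enorm h ^+ 2.
Proof.
move=> s0 t0 [m [w [/andP[m0 mM] hw e0 hm]]] [n [v [/andP[n0 nN] hv e1 hn]]].
have tt : 0 < 2 * t by rewrite mulr_gt0.
have ss : 0 < 2 * s by rewrite mulr_gt0.
rewrite addr0 in e0 e1.
pose p := (m / (2 * t)) *: grad_ckernel w; pose q := (- (n / (2 * s))) *: grad_ckernel v.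
have M0 : 0 <= M / (2 * t) by rewrite divr_ge0 ?(ltW tt) // (le_trans m0).
have N0 : 0 <= N / (2 * s) by rewrite divr_ge0 ?(ltW ss) // (le_trans n0).
have low h : F y + dotv p h - M / (2 * t) * enorm h ^+ 2 <= F (y + h).
  have h2 := sqr_ge0 (enorm h).
  have := le_trans (ler_wpM2l m0 (ckernel_semiconvex h hw)) (hm h).
  have mM2 := ler_wpM2r h2 mM.
  rewrite mulrDr mulrDr -e0 => le1; rewrite -(ler_pM2l tt) dotvZl.
  have -> : 2 * t * (F y + m / (2 * t) * dotv (grad_ckernel w) h - M / (2 * t) * enorm h ^+ 2) =
    2 * t * F y + m * dotv (grad_ckernel w) h - M * enorm h ^+ 2 by field; rewrite gt_eqF.
  by lra.
have up h : F (y + h) <= F y + dotv q h + N / (2 * s) * enorm h ^+ 2.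
  have h2 := sqr_ge0 (enorm h).
  have := le_trans (ler_wpM2l n0 (ckernel_semiconvex h hv)) (hn h).
  have nN2 := ler_wpM2r h2 nN.
  rewrite mulrDr mulrDr -e1 => le1; rewrite -(ler_pM2l ss) dotvZl.
  have -> : 2 * s * (F y + - (n / (2 * s)) * dotv (grad_ckernel v) h + N / (2 * s) * enorm h ^+ 2) =
    2 * s * F y - n * dotv (grad_ckernel v) h + N * enorm h ^+ 2 by field; rewrite gt_eqF.
  by lra.
have pq : p = q.
  apply/eqP; rewrite -subr_eq0; apply/eqP.
  apply: (@linear_le_square _ (M / (2 * t) + N / (2 * s))) => h.
  have := le_trans (low h) (up h); rewrite dotvDl dotvNl mulrDl; lra.
have tay h : `|F (y + h) - F y - dotv p h| <= (M / (2 * t) + N / (2 * s)) * enorm h ^+ 2.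
  have hl := low h; have hu := up h; rewrite -pq in hu.
  have hM := mulr_ge0 M0 (sqr_ge0 (enorm h)); have hN := mulr_ge0 N0 (sqr_ge0 (enorm h)).
  by rewrite mulrDl ler_norml; apply/andP; split; lra.
by rewrite (gradient_taylor tay).
Qed.

(** The kernel lies below [F] with equality at [y], so the two gradients agree. *)
Lemma touched_gradient (F : V -> R) (y w : V) (t m C : R) : 0 < t -> 0 <= m ->
  enorm w <= pi / 2 -> 1 + 2 * t * F y = m * ckernel w ->
  (forall h, m * ckernel (w + h) <= 1 + 2 * t * F (y + h)) ->
  (forall h, `|F (y + h) - F y - dotv (gradient F y) h| <= C * enorm h ^+ 2) ->
  gradient F y = (m / (2 * t)) *: grad_ckernel w.
Proof.
move=> t0 m0 hw e0 hm tay; have tt : 0 < 2 * t by rewrite mulr_gt0.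
apply/esym/eqP; rewrite -subr_eq0; apply/eqP.
apply: (@linear_le_square _ (m / (2 * t) + C)) => h.
have le1 := le_trans (ler_wpM2l m0 (ckernel_semiconvex h hw)) (hm h).
have := tay h; rewrite ler_norml => /andP[_ le2].
rewrite dotvDl dotvNl dotvZl [(_ + C) * _]mulrDl -(ler_pM2l tt).
have -> : 2 * t * (m / (2 * t) * dotv (grad_ckernel w) h - dotv (gradient F y) h) =
  m * dotv (grad_ckernel w) h - 2 * t * dotv (gradient F y) h by field; rewrite gt_eqF.
have -> : 2 * t * (m / (2 * t) * enorm h ^+ 2 + C * enorm h ^+ 2) =
  m * enorm h ^+ 2 + 2 * t * (C * enorm h ^+ 2) by field; rewrite gt_eqF.
have := ler_wpM2l (ltW tt) le2.
move: le1; rewrite mulrDr mulrDr -e0; lra.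
Qed.

End Taylor.

(** * Second-order expansions at density points *)
Section SecondOrder.
Variables (R : realType) (d : nat).
Local Notation V := ('rV[R]_d).
Variables (X : set V) (x : V).

(** What remains of Lebesgue density in all later arguments: every ray from [x]
    is followed by points of [X], with an error that is small compared with the
    distance to [x]. *)
Definition surrounded := forall (v : V) (e : R), 0 < e ->
  \forall r \near 0^'+, exists2 y, X y & enorm (y - (x + r *: v)) < e * r.

Lemma density_surrounded : (0 < d)%N -> density_point X x -> surrounded.
Proof.
move=> d0 Xx v e e0; have [r0 r00 hr] := density_approx v d0 Xx e0.
near=> r; apply: hr; apply/andP; split; near: r; first exact: nbhs_right_gt.
exact: nbhs_right_lt.
Unshelve. all: by end_near.
Qed.

Hypothesis Xx : surrounded.

Lemma reldiffP (f : V -> V) (A : 'M[R]_d) : is_reldiff X f x A ->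
  forall e, 0 < e -> exists2 c, 0 < c & forall y, X y -> enorm (y - x) < c ->
    enorm (f y - f x - (y - x) *m A) <= e * enorm (y - x).
Proof.
move=> fA e e0; have := fA e e0; rewrite near_withinE => /nbhs_enorm[c c0 h].
by exists c => // y Xy yx; exact: h.
Qed.

(** The difference of two relative differentials is small on directions of [X],
    and these are dense. *)
Lemma reldiff_unique (f : V -> V) (A B : 'M[R]_d) :
  is_reldiff X f x A -> is_reldiff X f x B -> A = B.
Proof.
move=> fA fB; suff AB (v : V) : v *m (A - B) = 0.
  apply/eqP; rewrite -subr_eq0; apply/eqP/row_matrixP => i.
  by rewrite rowE AB row0.
apply: enorm_eq0; apply/eqP; rewrite eq_le enorm_ge0 andbT.
have [K K0 hK] := enorm_mulmx (A - B).
apply/ler_addgt0Pr => e e0; rewrite add0r.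
have v1 : 0 < enorm v + 1 by rewrite ltr_wpDl ?enorm_ge0.
pose a := e / 2 / (2 * (enorm v + 1)); have a0 : 0 < a by rewrite !divr_gt0 // mulr_gt0.
pose b := Num.min 1 (e / 2 / (K + 1)).
have K1 : 0 < K + 1 by rewrite ltr_wpDl.
have b0 : 0 < b by rewrite lt_min ltr01 !divr_gt0.
have [c c0 hc] := reldiffP fA a0; have [c' c'0 hc'] := reldiffP fB a0.
pose cc := Num.min c c'; have cc0 : 0 < cc by rewrite lt_min c0.
have : \forall r \near (0 : R)^'+, [/\ 0 < r, r < cc / (enorm v + 1) &
    exists2 y, X y & enorm (y - (x + r *: v)) < b * r].
  near=> r; split; near: r; [exact: nbhs_right_gt| |exact: Xx].
  by apply: nbhs_right_lt; rewrite divr_gt0.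
move=> /filter_ex[r [r0 rc [y Xy hy]]].
have b1 : b <= 1 by rewrite ge_min lexx.
have yx : enorm (y - x) <= r * (enorm v + 1).
  rewrite (_ : y - x = (y - (x + r *: v)) + r *: v); last by rewrite opprD addrA subrK.
  apply: le_trans (enormD _ _) _; rewrite enormZ gtr0_norm // mulrDr mulr1 addrC lerD2l.
  by apply: le_trans (ltW hy) _; rewrite ger_pMl.
have ycc : enorm (y - x) < cc.
  by apply: le_lt_trans yx _; rewrite -ltr_pdivlMr.
move: ycc; rewrite lt_min => /andP[yc yc'].
have h1 := hc y Xy yc; have h2 := hc' y Xy yc'.
have h3 : enorm ((y - x) *m (A - B)) <= r * (e / 2).
  rewrite mulmxBr (_ : _ - _ = (f y - f x - (y - x) *m B) - (f y - f x - (y - x) *m A)); last first.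
    by rewrite opprB [RHS]addrC addrA subrK.
  apply: le_trans (enormD _ _) _; rewrite enormN.
  apply: le_trans (lerD h2 h1) _; rewrite -mulr2n -mulrnAl -mulr_natl.
  apply: le_trans (ler_wpM2l _ yx) _; first by rewrite mulr_ge0 // ltW.
  by rewrite /a le_eqVlt; apply/orP; left; apply/eqP; field; rewrite gt_eqF.
have h4 : enorm ((y - (x + r *: v)) *m (A - B)) <= r * (e / 2).
  apply: le_trans (hK _) _; apply: le_trans (ler_wpM2l K0 (ltW hy)) _.
  rewrite mulrCA [leRHS]mulrC mulrA ler_pM2r //.
  have : b <= e / 2 / (K + 1) by rewrite ge_min lexx orbT.
  by rewrite ler_pdivlMr // mulrDr mulr1 => bK; apply: le_trans bK; rewrite lerDl ltW.
have : enorm (r *: (v *m (A - B))) <= r * e.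
  rewrite scalemxAl (_ : r *: v = (y - x) - (y - (x + r *: v))); last first.
    by rewrite opprB [RHS]addrC addrA subrK addrAC subrr add0r.
  rewrite mulmxBl; apply: le_trans (enormD _ _) _; rewrite enormN.
  by apply: le_trans (lerD h3 h4) _; rewrite -mulrDr -splitr.
by rewrite enormZ gtr0_norm // ler_pM2l.
Unshelve. all: by end_near.
Qed.

Lemma reldiff_eq (f : V -> V) (A : 'M[R]_d) : is_reldiff X f x A -> reldiff X f x = A.
Proof.
move=> fA; apply: xget_unique => // B fB; exact: (reldiff_unique fB fA).
Qed.

Variables (F : V -> R) (g : V -> V) (A : 'M[R]_d) (C : R).
Hypothesis C0 : 0 <= C.
Hypothesis tay : forall y, X y -> forall h, `|F (y + h) - F y - dotv (g y) h| <= C * enorm h ^+ 2.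
Hypothesis gA : is_reldiff X g x A.

(** Both endpoints of a short segment are compared with a nearby point [y] of
    [X], the only place where a first-order expansion is available. *)
Lemma short_step (K del r a : R) (p k y : V) :
  (forall v : V, enorm (v *m A) <= K * enorm v) -> 0 <= K -> 0 <= del -> 0 < r -> 0 < a -> X y ->
  enorm (y - (x + r *: p)) <= a * r ->
  enorm (g y - g x - (y - x) *m A) <= del * enorm (y - x) ->
  `|F (x + r *: (p + a *: k)) - F (x + r *: p) -
     (a * r) * dotv (g x) k - a * r ^+ 2 * dotv (p *m A) k| <=
  r ^+ 2 * (a ^+ 2 * (C * ((1 + enorm k) ^+ 2 + 1) + K * enorm k) + a * (del * (enorm p + a) * enorm k)).
Proof.
move=> hK K0 del0 r0 a0 Xy hy hg.
set z0 := x + r *: p; set z1 := x + r *: (p + a *: k).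
have z01 : z1 = z0 + (a * r) *: k.
  by rewrite /z1 /z0 scalerDr addrA scalerA (mulrC r).
have t1 := tay Xy (z1 - y); have t0 := tay Xy (z0 - y).
have yz z : y + (z - y) = z by rewrite addrC subrK.
rewrite yz in t1; rewrite yz in t0.
have n0 : enorm (z0 - y) <= a * r by rewrite enormB.
have ar0 : 0 < a * r by rewrite mulr_gt0.
have n1 : enorm (z1 - y) <= a * r * (1 + enorm k).
  rewrite z01 -addrA (addrC (_ *: k)) addrA; apply: le_trans (enormD _ _) _.
  by rewrite enormZ gtr0_norm // mulrDr mulr1 lerD2r.
have q1 : enorm (z1 - y) ^+ 2 <= (a * r * (1 + enorm k)) ^+ 2.
  rewrite ler_pXn2r ?nnegrE ?enorm_ge0 //.
  by rewrite mulr_ge0 ?(ltW ar0) // addr_ge0 ?enorm_ge0.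
have q0 : enorm (z0 - y) ^+ 2 <= (a * r) ^+ 2.
  by rewrite ler_pXn2r ?nnegrE ?enorm_ge0 // ltW.
have {}t1 := le_trans t1 (ler_wpM2l C0 q1); have {}t0 := le_trans t0 (ler_wpM2l C0 q0).
set E := g y - g x - (y - x) *m A in hg.
have gy : g y = g x + (r *: p) *m A + (y - z0) *m A + E.
  have -> : y - z0 = (y - x) - r *: p by rewrite /z0 opprD addrA.
  rewrite mulmxBl /E; move: (g y) (g x) ((y - x) *m A) ((r *: p) *m A) => a1 a2 a3 a4.
  by apply/rowP => i; rewrite !mxE; ring.
have yx : enorm (y - x) <= r * (enorm p + a).
  have -> : y - x = (y - z0) + r *: p by rewrite /z0 opprD addrA subrK.
  apply: le_trans (enormD _ _) _; rewrite enormZ gtr0_norm // mulrDr addrC lerD2l.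
  by rewrite [r * a]mulrC.
have dE : `|dotv E k| <= del * (r * (enorm p + a)) * enorm k.
  apply: le_trans (cauchy_schwarz _ _) _; rewrite ler_wpM2r ?enorm_ge0 //.
  exact: le_trans hg (ler_wpM2l del0 yx).
have dK : `|dotv ((y - z0) *m A) k| <= K * (a * r) * enorm k.
  apply: le_trans (cauchy_schwarz _ _) _; rewrite ler_wpM2r ?enorm_ge0 //.
  exact: le_trans (hK _) (ler_wpM2l K0 hy).
have dz : dotv (g y) (z1 - y) - dotv (g y) (z0 - y) =
   a * r * (dotv (g x) k + r * dotv (p *m A) k + dotv ((y - z0) *m A) k + dotv E k).
  rewrite -dotvNr -dotvDr opprB addrA subrK z01 addrC addKr dotvZr {1}gy.
  by rewrite !dotvDl -scalemxAl dotvZl.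
have -> : F z1 - F z0 - (a * r) * dotv (g x) k - a * r ^+ 2 * dotv (p *m A) k =
  (F z1 - F y - dotv (g y) (z1 - y)) - (F z0 - F y - dotv (g y) (z0 - y)) +
  a * r * (dotv ((y - z0) *m A) k + dotv E k).
  have -> : dotv (g y) (z1 - y) = dotv (g y) (z0 - y) + a * r * (dotv (g x) k + r * dotv (p *m A) k + dotv ((y - z0) *m A) k + dotv E k).
    by rewrite -dz; ring.
  ring.
apply: le_trans (ler_normD _ _) _.
apply: (@le_trans _ _ ((C * (a * r * (1 + enorm k)) ^+ 2 + C * (a * r) ^+ 2) +
   a * r * (K * (a * r) * enorm k + del * (r * (enorm p + a)) * enorm k))).
  apply: lerD.
    by apply: le_trans (ler_normB _ _) _; exact: lerD.
  rewrite normrM (gtr0_norm ar0) ler_pM2l //.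
  by apply: le_trans (ler_normD _ _) _; exact: lerD.
by rewrite le_eqVlt; apply/orP; left; apply/eqP; ring.
Qed.

(** The gradient is integrated along the segment from [x + r h] to [x + r (h + k)]
    in [N] steps; the error of order [r^2 / N^2] per step adds up to [r^2 / N].
    The segment itself may miss [X]. *)
Lemma edge_expansion (h k : V) (e : R) : 0 < e -> \forall r \near 0^'+,
  `|F (x + r *: (h + k)) - F (x + r *: h) - r * dotv (g x) k -
    r ^+ 2 * (dotv (h *m A) k + dotv (k *m A) k / 2)| <= e * r ^+ 2.
Proof.
move=> e0; have [K K0 hK] := enorm_mulmx A.
set G := dotv (g x) k; set H := dotv (h *m A) k; set Q := dotv (k *m A) k.
have h0 := enorm_ge0 h; have k0 := enorm_ge0 k.
pose L := enorm h + enorm k + 1; have L0 : 0 < L by rewrite /L; lra.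
pose B0 := C * ((1 + enorm k) ^+ 2 + 1) + K * enorm k.
have B00 : 0 <= B0 by rewrite addr_ge0 ?mulr_ge0 ?addr_ge0 ?sqr_ge0.
pose B := B0 + `|Q| / 2; have BB : 0 <= B by rewrite addr_ge0 // divr_ge0.
have B1 : 0 < B + 1 by lra.
(* [B] bounds the errors of the [N] steps, up to [r^2 / N]; half of [e] is left
   for the remainder of the relative differential, controlled by [del] *)
have eB : 0 < e / 2 / (B + 1) by rewrite !divr_gt0.
have [n] := filter_ex (near_infty_natSinv_lt (PosNum eB)); rewrite [X in _ < X]/=.
pose N := n.+1; rewrite -/N; pose a : R := N%:R^-1; rewrite -/a => aB.
have a0 : 0 < a by rewrite invr_gt0 ltr0n.
have Na : N%:R * a = 1 by rewrite mulfV // pnatr_eq0.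
have a1 : a <= 1 by rewrite invf_le1 ?ltr0n // ler1n.
have k1 : 0 < enorm k + 1 by lra.
pose del := e / 2 / (L * (enorm k + 1)).
have del0 : 0 < del by rewrite !divr_gt0 // mulr_gt0.
have [c c0 hc] := reldiffP gA del0.
pose p j := h + (j%:R * a) *: k.
near=> r.
have r0 : 0 < r by near: r; exact: nbhs_right_gt.
have rc : r * L < c.
  by rewrite -ltr_pdivlMr //; near: r; apply: nbhs_right_lt; rewrite divr_gt0.
have hy : forall j : 'I_N, exists2 y, X y & enorm (y - (x + r *: p j)) < a * r.
  by near: r; apply: filter_forall => j; exact: Xx.
have pj j : (j < N)%N -> enorm (p j) + a <= L.
  move=> jN; apply: (@le_trans _ _ (enorm h + enorm k + 1)) => //.
  rewrite lerD // /p; apply: le_trans (enormD _ _) _; rewrite lerD2l enormZ.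
  rewrite ger0_norm ?mulr_ge0 ?(ltW a0) // -[leRHS]mul1r ler_wpM2r //.
  by rewrite -[leRHS]Na ler_pM2r // ler_nat ltnW.
pose eps := r ^+ 2 * (a ^+ 2 * B0 + a * (del * L * enorm k)).
have step j : (j < N)%N -> `|F (x + r *: p j.+1) - F (x + r *: p j) - a * r * G -
    a * r ^+ 2 * (H + j%:R * a * Q)| <= eps.
  move=> jN; have [y Xy yp] := hy (Ordinal jN); rewrite /= in yp.
  have yx : enorm (y - x) < c.
    apply: le_lt_trans rc; rewrite (_ : y - x = (y - (x + r *: p j)) + r *: p j); last first.
      by rewrite opprD addrA subrK.
    apply: le_trans (enormD _ _) _; rewrite enormZ gtr0_norm //.
    by have := ler_wpM2l (ltW r0) (pj j jN); move: (ltW yp); lra.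
  have := short_step k hK K0 (ltW del0) r0 a0 Xy (ltW yp) (hc y Xy yx).
  have -> : p j + a *: k = p j.+1.
    by rewrite /p -addrA -scalerDl; congr (_ + _ *: _); rewrite -natr1; ring.
  have -> : dotv (p j *m A) k = H + j%:R * a * Q.
    by rewrite /p mulmxDl dotvDl -scalemxAl dotvZl.
  move=> hs; apply: le_trans hs _; rewrite ler_pM2l ?exprn_gt0 // lerD2l ler_pM2l //.
  by rewrite ler_wpM2r // ler_wpM2l ?(ltW del0) ?pj.
have sum j : (j <= N)%N -> `|F (x + r *: p j) - F (x + r *: h) - j%:R * a * r * G -
    r ^+ 2 * (j%:R * a * H + a ^+ 2 * Q * (j%:R * (j%:R - 1) / 2))| <= j%:R * eps.
  elim: j => [|j IH] jN.
    have -> : p 0%N = h by rewrite /p mul0r scale0r addr0.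
    by rewrite !mul0r !(mulr0, addr0, subr0) subrr normr0.
  have := lerD (IH (ltnW jN)) (step j jN); rewrite -(natr1 j).
  have -> : j%:R * eps + eps = (j%:R + 1) * eps by ring.
  apply: le_trans; apply: le_trans _ (ler_normD _ _).
  by rewrite le_eqVlt; apply/orP; left; apply/eqP; congr `|_|; field.
have := sum N (leqnn N).
have -> : p N = h + k by rewrite /p Na scale1r.
rewrite Na !mul1r.
have -> : a ^+ 2 * Q * (N%:R * (N%:R - 1) / 2) = Q / 2 - a * Q / 2.
  have -> : a ^+ 2 * Q * (N%:R * (N%:R - 1) / 2) = (N%:R * a) ^+ 2 * Q / 2 - (N%:R * a) * a * Q / 2 by field.
  by rewrite Na expr1n !mul1r.
have -> : N%:R * eps = r ^+ 2 * (a * B0 + del * L * enorm k).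
  have -> : N%:R * eps = r ^+ 2 * ((N%:R * a) * a * B0 + (N%:R * a) * (del * L * enorm k)) by rewrite /eps; ring.
  by rewrite Na !mul1r.
set T := F _ - F _ - _ => hT.
have -> : T - r ^+ 2 * (H + Q / 2) = (T - r ^+ 2 * (H + (Q / 2 - a * Q / 2))) - r ^+ 2 * (a * Q / 2) by ring.
apply: le_trans (ler_normB _ _) _.
have -> : `|r ^+ 2 * (a * Q / 2)| = r ^+ 2 * (a * (`|Q| / 2)).
  rewrite normrM (ger0_norm (sqr_ge0 r)) normrM normrM (gtr0_norm a0).
  by rewrite [`|2^-1|]ger0_norm ?invr_ge0 ?ler0n //; field.
apply: le_trans (lerD hT (lexx _)) _.
rewrite -mulrDr [leRHS]mulrC ler_pM2l ?exprn_gt0 //.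
have -> : a * B0 + del * L * enorm k + a * (`|Q| / 2) = a * B + del * L * enorm k by rewrite /B; ring.
rewrite [leRHS]splitr; apply: lerD.
  move: aB; rewrite ltr_pdivlMr // mulrDr mulr1 => aB; apply: le_trans (ltW aB).
  by rewrite lerDl ltW.
have -> : e / 2 = del * L * (enorm k + 1) by rewrite /del; field; rewrite !gt_eqF.
by apply: ler_wpM2l; [apply: mulr_ge0; exact: ltW|rewrite lerDl].
Unshelve. all: by end_near.
Qed.

Lemma second_order (k : V) (e : R) : 0 < e -> \forall r \near 0^'+,
  `|F (x + r *: k) - F x - r * dotv (g x) k - r ^+ 2 * (dotv (k *m A) k / 2)| <= e * r ^+ 2.
Proof.
move=> e0; have := edge_expansion 0 k e0; apply: filterS => r.
by rewrite add0r scaler0 addr0 mul0mx dotv0l add0r.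
Qed.

(** Going around the triangle [x, x + r v, x + r w], the increments of [F] add up
    to 0, whereas the second-order terms add up to [r^2] times the antisymmetric
    part of [A] at [v] and [w], up to sign. *)
Lemma reldiff_symmetric (v w : V) : dotv (v *m A) w = dotv (w *m A) v.
Proof.
apply/eqP; rewrite -subr_eq0 -normr_eq0 eq_le normr_ge0 andbT.
apply/ler_addgt0Pr => e e0; rewrite add0r.
have e6 : 0 < e / 6 by rewrite divr_gt0.
have : \forall r \near (0 : R)^'+, 0 < r by exact: nbhs_right_gt.
have := second_order v e6; have := second_order w e6; have := edge_expansion v (w - v) e6.
move=> h1 h2 h3 h4; have [r [[[]]]] := filter_ex (filterI (filterI (filterI h1 h2) h3) h4).
have vw : v + (w - v) = w by rewrite addrC subrK.
rewrite vw => {}h1 {}h2 {}h3 r0.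
have r2 : 0 < r ^+ 2 by rewrite exprn_gt0.
move: h1; set T1 := (X in `|X|) => h1; move: h2; set T2 := (X in `|X|) => h2.
move: h3; set T3 := (X in `|X|) => h3.
have key : T1 + T3 - T2 = - (r ^+ 2 * ((dotv (v *m A) w - dotv (w *m A) v) / 2)).
  by rewrite /T1 /T2 /T3 !mulmxBl !(dotvDl, dotvDr, dotvNl, dotvNr); field.
have := le_trans (ler_normB _ _) (lerD (le_trans (ler_normD _ _) (lerD h1 h3)) h2).
rewrite key normrN normrM (gtr0_norm r2) normrM [`|2^-1|]ger0_norm ?invr_ge0 ?ler0n //.
move=> hD; rewrite -(ler_pM2l r2); lra.
Qed.

End SecondOrder.

(** * The differential of the transport map *)
Section Flow.
Variables (R : realType) (d : nat) (a : R) (g : 'rV[R]_d) (A : 'M[R]_d).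
Implicit Type tau : R.

Definition flow_u tau : R := 1 + 2 * tau * a.
Definition flow_Q tau : R := flow_u tau ^+ 2 + tau ^+ 2 * enorm g ^+ 2.

(** [flow_kap] and [tau u / Q] are the eigenvalues, orthogonally to [g] and along
    [g], of the differential of the arctangent factor; [flow_kap] has its limit
    value at [g = 0].  [flow_eta] is their difference divided by the squared norm
    of [g], the coefficient of [g^T g]. *)
Definition flow_kap tau : R :=
  if enorm g == 0 then tau / flow_u tau else atan (tau / flow_u tau * enorm g) / enorm g.
Definition flow_eta tau : R := (tau * flow_u tau / flow_Q tau - flow_kap tau) / enorm g ^+ 2.
Definition flow_mu tau : R := 2 * tau ^+ 2 / flow_Q tau.
Definition flow_Gam : 'M[R]_d := g^T *m g.

(** The differential of the transport map where the potential has value [a],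
    gradient [g] and Hessian [A].  Matrices act on rows from the right. *)
Definition flow_mx tau : 'M[R]_d :=
  1%:M + flow_kap tau *: A + flow_eta tau *: (A *m flow_Gam) - flow_mu tau *: flow_Gam.

End Flow.

Section RelCalculus.
Variables (R : realType) (d : nat) (X : set 'rV[R]_d) (x : 'rV[R]_d).
Local Notation V := ('rV[R]_d).
Implicit Types (f h : V -> R) (l m : V).
Implicit Type P : V -> Prop.

(** A radius replaces the relative neighbourhood filter, so that finitely many
    conditions combine by taking a minimum. *)
Definition rnear P := exists2 c : R, 0 < c & forall y, X y -> enorm (y - x) < c -> P y.

Lemma rnearT P : (forall y, P y) -> rnear P.
Proof. by move=> h; exists 1. Qed.

Lemma rnearS P1 P2 : (forall y, P1 y -> P2 y) -> rnear P1 -> rnear P2.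
Proof. by move=> P12 [c c0 h]; exists c => // y Xy yc; exact/P12/h. Qed.

Lemma rnearI P1 P2 : rnear P1 -> rnear P2 -> rnear (fun y => P1 y /\ P2 y).
Proof.
move=> [c c0 h] [c' c'0 h']; exists (Num.min c c'); first by rewrite lt_min c0.
by move=> y Xy; rewrite lt_min => /andP[yc yc']; split; [exact: h|exact: h'].
Qed.

Lemma rnear_all n (Q : 'I_n -> V -> Prop) : (forall i, rnear (Q i)) ->
  rnear (fun y => forall i, Q i y).
Proof.
elim: n Q => [|n IH] Q hQ; first by apply: rnearT => y [].
have := rnearI (hQ ord0) (IH (fun i => Q (lift ord0 i)) (fun i => hQ _)).
by apply: rnearS => y [h0 h] i; case: (unliftP ord0 i) => [j|] ->.
Qed.

Lemma rnear_lt c : 0 < c -> rnear (fun y => enorm (y - x) < c).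
Proof. by exists c. Qed.

Lemma is_reldiffE (f : V -> V) (M : 'M[R]_d) : is_reldiff X f x M <->
  forall e, 0 < e -> rnear (fun y => enorm (f y - f x - (y - x) *m M) <= e * enorm (y - x)).
Proof.
split=> h e e0; have := h e e0.
  by rewrite near_withinE => /nbhs_enorm[c c0 {}h]; exists c => // y Xy yx; exact: h.
move=> [c c0 {}h]; rewrite near_withinE.
apply: (@filterS _ (nbhs x) (nbhs_filter x)) (near_enorm x c0) => y yx Xy.
exact: h.
Qed.

(** Scalar counterpart of [is_reldiff], the differential being represented by its
    gradient. *)
Definition rdiff f l := forall e : R, 0 < e -> rnear (fun y => `|f y - f x - dotv l (y - x)| <= e * enorm (y - x)).

Definition rcont f (c : R) := forall e : R, 0 < e -> rnear (fun y => `|f y - c| <= e).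

Lemma rdiff_eq f l m : rdiff f l -> l = m -> rdiff f m.
Proof. by move=> fl <-. Qed.

Lemma rdiff_lip f l : rdiff f l ->
  rnear (fun y => `|f y - f x| <= (enorm l + 1) * enorm (y - x)).
Proof.
move=> fl; have := fl 1 ltr01; apply: rnearS => y; rewrite mul1r => hy.
rewrite -(subrK (dotv l (y - x)) (f y - f x)); apply: le_trans (ler_normD _ _) _.
by rewrite mulrDl mul1r addrC lerD // cauchy_schwarz.
Qed.

Lemma rdiff_cont f l : rdiff f l -> rcont f (f x).
Proof.
move=> /rdiff_lip fl e e0; have l1 : 0 < enorm l + 1 by rewrite ltr_wpDl ?enorm_ge0.
have := rnearI fl (rnear_lt (divr_gt0 e0 l1)); apply: rnearS => y [h1 h2].
by apply: le_trans h1 _; move: h2; rewrite ltr_pdivlMr // mulrC => /ltW.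
Qed.

Lemma rdiff_cst c : rdiff (fun=> c) 0.
Proof.
move=> e e0; apply: rnearT => y.
by rewrite subrr dotv0l subr0 normr0 mulr_ge0 ?enorm_ge0 // ltW.
Qed.

Lemma rdiff_coord i : rdiff (fun y => y 0 i) (delta_mx 0 i).
Proof.
move=> e e0; apply: rnearT => y.
by rewrite dotvC dotv_delta !mxE subrr normr0 mulr_ge0 ?enorm_ge0 // ltW.
Qed.

Lemma rdiffD f h l m : rdiff f l -> rdiff h m -> rdiff (fun y => f y + h y) (l + m).
Proof.
move=> fl hm e e0; have e2 : 0 < e / 2 by rewrite divr_gt0.
have := rnearI (fl _ e2) (hm _ e2); apply: rnearS => y [h1 h2].
rewrite dotvDl (_ : _ - _ = (f y - f x - dotv l (y - x)) + (h y - h x - dotv m (y - x))); last by ring.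
apply: le_trans (ler_normD _ _) _; apply: le_trans (lerD h1 h2) _.
by rewrite -mulrDl -splitr.
Qed.

Lemma rdiff_sum (I : Type) (r : seq I) (f : I -> V -> R) (l : I -> V) :
  (forall i, rdiff (f i) (l i)) -> rdiff (fun y => \sum_(i <- r) f i y) (\sum_(i <- r) l i).
Proof.
move=> fl; elim: r => [|i r IH].
  rewrite big_nil (_ : (fun _ => _) = fun=> 0); first exact: rdiff_cst.
  by apply/funext => y; rewrite big_nil.
rewrite big_cons (_ : (fun _ => _) = fun y => f i y + \sum_(j <- r) f j y).
  exact: rdiffD.
by apply/funext => y; rewrite big_cons.
Qed.

(** A factor that is merely continuous is harmless in front of a function that
    vanishes at [x]. *)
Lemma rdiff_contM c c0 f l : rcont c c0 -> rdiff f l -> f x = 0 ->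
  rdiff (fun y => c y * f y) (c0 *: l).
Proof.
move=> cc fl fx e e0; have l1 : 0 < enorm l + 1 by rewrite ltr_wpDl ?enorm_ge0.
have c1 : 0 < `|c0| + 1 by rewrite ltr_wpDl.
have e1 : 0 < e / 2 / (enorm l + 1) by rewrite !divr_gt0.
have e2 : 0 < e / 2 / (`|c0| + 1) by rewrite !divr_gt0.
have := rnearI (rnearI (cc _ e1) (rdiff_lip fl)) (fl _ e2); apply: rnearS => y [[h1 h2] h3].
rewrite fx mulr0 subr0 in h2 *; rewrite fx subr0 in h3.
rewrite dotvZl (_ : _ - _ = (c y - c0) * f y + c0 * (f y - dotv l (y - x))); last by ring.
apply: le_trans (ler_normD _ _) _; rewrite !normrM.
have n0 := enorm_ge0 (y - x).
rewrite [e in leRHS]splitr mulrDl; apply: lerD.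
  apply: le_trans (ler_pM (normr_ge0 _) (normr_ge0 _) h1 h2) _.
  by rewrite mulrA divfK // gt_eqF.
apply: (@le_trans _ _ ((`|c0| + 1) * `|f y - dotv l (y - x)|)).
  by rewrite ler_wpM2r // lerDl.
apply: le_trans (ler_wpM2l (ltW c1) h3) _.
by rewrite mulrA [_ * (e / 2 / _)]mulrC divfK ?gt_eqF.
Qed.

Lemma rdiffM f h l m : rdiff f l -> rdiff h m ->
  rdiff (fun y => f y * h y) (h x *: l + f x *: m).
Proof.
move=> fl hm.
have fl0 : rdiff (fun y => f y - f x) l.
  by move=> e e0; have := fl e e0; apply: rnearS => y; rewrite subrr subr0.
have := rdiffD (rdiff_contM (rdiff_cont hm) fl0 (subrr _)) (rdiff_contM (c := fun=> f x) (c0 := f x) _ (f := fun y => h y - h x) (l := m) _ (subrr _)).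
move=> H; have {}H : rdiff (fun y => h y * (f y - f x) + f x * (h y - h x)) (h x *: l + f x *: m).
  apply: H => e e0; first by apply: rnearT => y; rewrite subrr normr0 ltW.
  by have := hm e e0; apply: rnearS => y; rewrite subrr subr0.
move=> e e0; have := H e e0; apply: rnearS => y.
by rewrite !subrr !mulr0 addr0 subr0; congr (`|_| <= _); ring.
Qed.

Lemma rcont_comp (p : R -> R) f (c : R) : {for c, continuous p} -> rcont f c ->
  rcont (fun y => p (f y)) (p c).
Proof.
move=> pc fc e e0.
have h := (@cvgrPdist_le _ _ _ (nbhs c) (nbhs_filter _) _ _).1 pc e e0.
have [r /= r0 hr] := (@nbhs_ballP R R c _).1 h.
have r2 : 0 < r / 2 by rewrite divr_gt0.
have := fc _ r2; apply: rnearS => y hy; rewrite distrC; apply: hr.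
by rewrite /ball /= distrC (le_lt_trans hy) // ltr_pdivrMr // ltr_pMr // ltr1n.
Qed.

Lemma rdiff_comp (p : R -> R) (p' : R) f l : hasder p (f x) p' -> rdiff f l ->
  rdiff (fun y => p (f y)) (p' *: l).
Proof.
move=> /is_derive1_caratheodory[G [hG Gc Gx]] fl.
have fl0 : rdiff (fun y => f y - f x) l.
  by move=> e e0; have := fl e e0; apply: rnearS => y; rewrite subrr subr0.
have Gf : rcont (fun y => G (f y)) p' by rewrite -Gx; exact: rcont_comp (rdiff_cont fl).
have H := rdiff_contM Gf fl0 (subrr _).
move=> e e0; have := H e e0; apply: rnearS => y.
by rewrite !hG subrr mulr0 subr0.
Qed.

Lemma is_reldiff_coord (f : V -> V) (M : 'M[R]_d) : is_reldiff X f x M ->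
  forall i, rdiff (fun y => f y 0 i) (col i M)^T.
Proof.
move=> /is_reldiffE fM i e e0; have := fM e e0; apply: rnearS => y; apply: le_trans.
apply: le_trans _ (enorm_coord _ i); rewrite le_eqVlt; apply/orP; left; apply/eqP.
congr `|_|; rewrite !mxE; congr (_ - _).
by apply: eq_bigr => j _; rewrite !mxE mulrC.
Qed.

Lemma coord_is_reldiff (f : V -> V) (M : 'M[R]_d) :
  (forall i, rdiff (fun y => f y 0 i) (col i M)^T) -> is_reldiff X f x M.
Proof.
move=> fM; apply/is_reldiffE => e e0; have d1 : 0 < (d%:R + 1 : R) by rewrite ltr_wpDl.
have e1 : 0 < e / (d%:R + 1) by rewrite divr_gt0.
have := rnear_all (fun i => fM i _ e1).
apply: rnearS => y hy; have n0 := enorm_ge0 (y - x).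
apply: le_trans (enorm_coord_le (c := e / (d%:R + 1) * enorm (y - x)) _ _) _.
- by rewrite mulr_ge0 // ltW.
- move=> i; apply: le_trans (hy i); rewrite le_eqVlt; apply/orP; left; apply/eqP.
  congr `|_|; rewrite !mxE; congr (_ - _).
  by apply: eq_bigr => j _; rewrite !mxE mulrC.
- rewrite mulrA ler_wpM2r // mulrA ler_pdivrMr // mulrC ler_pM2l // lerDl //.
Qed.

End RelCalculus.

Section Transport.
Variables (R : realType) (d : nat) (X : set 'rV[R]_d) (x : 'rV[R]_d).
Local Notation V := ('rV[R]_d).

Lemma arctan_vecE (c : R) (g : V) : arctan_vec (c *: g) = (atan (c * enorm g) / enorm g) *: g.
Proof.
rewrite /arctan_vec enormZ scalerA.
have [g0|g0] := eqVneq (enorm g) 0.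
  by rewrite (enorm_eq0 g0) !scaler0.
have [->|c0] := eqVneq c 0; first by rewrite mulr0 mul0r atan0 mul0r.
congr (_ *: _); case: (ltrgt0P c) c0 => // [cp|cn] _.
  by field; rewrite g0 gt_eqF.
by rewrite mulNr atanN; field; rewrite g0 lt_eqF.
Qed.

Variables (F : V -> R) (g : V -> V) (A : 'M[R]_d) (tau : R).
Hypothesis Fd : rdiff X x F (g x).
Hypothesis gA : is_reldiff X g x A.
Hypothesis u0 : 0 < flow_u (F x) tau.

Definition ray (y : V) : V := y + arctan_vec ((tau / (1 + 2 * tau * F y)) *: g y).

Lemma rdiff_speed : rdiff X x (fun y => tau / (1 + 2 * tau * F y))
  ((- (2 * tau ^+ 2) / flow_u (F x) tau ^+ 2) *: g x).
Proof.
have hu : rdiff X x (fun y => 1 + 2 * tau * F y) ((2 * tau) *: g x).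
  apply: rdiff_eq; first by apply: rdiffD; [exact: rdiff_cst|apply: rdiffM; [exact: rdiff_cst|exact: Fd]].
  by rewrite scaler0 !add0r.
apply: rdiff_eq.
  apply: (@rdiffM _ _ X x (fun=> tau) (fun y => (1 + 2 * tau * F y)^-1)); first exact: rdiff_cst.
  apply: (rdiff_comp (p := fun z => z^-1)); last exact: hu.
  by apply: hasderV; [rewrite gt_eqF|exact: hasderI].
by rewrite scaler0 add0r !scalerA /flow_u; congr (_ *: _); field; rewrite gt_eqF.
Qed.

Lemma rdiff_normsq : rdiff X x (fun y => dotv (g y) (g y)) (2 *: (g x *m A^T)).
Proof.
apply: rdiff_eq.
  by apply: rdiff_sum => i; apply: rdiffM; exact: is_reldiff_coord gA i.
apply/rowP => j; rewrite summxE !mxE mulr_sumr.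
by apply: eq_bigr => i _; rewrite !mxE; ring.
Qed.

Lemma mulmx_Gam (j i : 'I_d) : (A *m flow_Gam (g x)) j i = (g x *m A^T) 0 j * g x 0 i.
Proof.
rewrite /flow_Gam mulmxA mxE big_ord1; congr (_ * _).
by rewrite -[A in LHS]trmxK -trmx_mul mxE.
Qed.

(** Where [g] does not vanish this is the chain rule.  At a zero of [g] the norm
    is not differentiable, but the transport is [y] plus a continuous scalar
    times a map vanishing at [x]. *)
Lemma ray_reldiff : is_reldiff X ray x (flow_mx (F x) (g x) A tau).
Proof.
apply: coord_is_reldiff => i.
have gi := is_reldiff_coord gA i.
pose c y := tau / (1 + 2 * tau * F y).
have c_diff := rdiff_speed; have cx : c x = tau / flow_u (F x) tau by [].
have [b0|b0] := eqVneq (enorm (g x)) 0.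
  have gx0 : g x = 0 by exact: enorm_eq0.
  (* near a zero of [g] the scalar factor is only continuous *)
  have /is_derive1_caratheodory[G [hG Gc Gx]] := is_derive1_atan (0 : R).
  rewrite expr0n addr0 invr1 in Gx.
  have at0 (v : V) : arctan_vec v = G (enorm v) *: v.
    have [v0|v0] := eqVneq (enorm v) 0; first by rewrite (enorm_eq0 v0) /arctan_vec !scaler0.
    by have := hG (enorm v); rewrite atan0 !subr0 /arctan_vec => ->; rewrite mulfK.
  have cc : rcont X x c (c x) by exact: rdiff_cont c_diff.
  have ng : rcont X x (fun y => enorm (c y *: g y)) 0.
    move=> e e0; have [K K0 hK] := enorm_mulmx A.
    have c1 : 0 < `|c x| + 1 by rewrite ltr_wpDl.
    have K1 : 0 < K + 1 by rewrite ltr_wpDl.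
    have e1 : 0 < e / ((`|c x| + 1) * (K + 1)) by rewrite divr_gt0 // mulr_gt0.
    have := rnearI (rnearI (cc 1 ltr01) ((is_reldiffE _ _ _ _).1 gA 1 ltr01)) (rnear_lt X x e1).
    apply: rnearS => y [[h1 h2] h3].
    rewrite subr0 ger0_norm ?enorm_ge0 // enormZ.
    have {}h1 : `|c y| <= `|c x| + 1.
      by rewrite -[c y](subrK (c x)) addrC; apply: le_trans (ler_normD _ _) _; rewrite lerD2l.
    have {}h2 : enorm (g y) <= (K + 1) * enorm (y - x).
      rewrite gx0 subr0 mul1r in h2.
      rewrite -[g y](subrK ((y - x) *m A)) mulrDl mul1r addrC.
      by apply: le_trans (enormD _ _) _; rewrite lerD.
    apply: le_trans (ler_pM (normr_ge0 _) (enorm_ge0 _) h1 h2) _.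
    by move: h3; rewrite ltr_pdivlMr ?mulr_gt0 // mulrC -mulrA => /ltW.
  have gix : g x 0 i = 0 by rewrite gx0 mxE.
  have cg := rdiff_contM cc gi gix.
  have Gr : rcont X x (fun y => G (enorm (c y *: g y))) 1.
    by rewrite -Gx; exact: rcont_comp ng.
  have cgx : c x * g x 0 i = 0 by rewrite gix mulr0.
  have := rdiffD (rdiff_coord X x i) (rdiff_contM Gr cg cgx).
  rewrite (_ : (fun y => _) = fun y => ray y 0 i); last first.
    by apply/funext => y; rewrite /ray at0 !mxE.
  move=> H; apply: rdiff_eq H _.
  rewrite /flow_mx /flow_Gam gx0 trmx0 mul0mx mulmx0 !scaler0 addr0 subr0 /flow_kap enorm0 eqxx.
  by apply/rowP => j; rewrite !mxE eqxx /= mul1r cx.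
have bp : 0 < enorm (g x) by rewrite lt0r b0 enorm_ge0.
have b_diff : rdiff X x (fun y => enorm (g y)) ((enorm (g x))^-1 *: (g x *m A^T)).
  rewrite (_ : (fun y => _) = fun y => Num.sqrt (dotv (g y) (g y))); last first.
    by apply/funext => y; rewrite enorm_def.
  apply: rdiff_eq.
    apply: (rdiff_comp (p := Num.sqrt)); last exact: rdiff_normsq.
    by apply: is_derive1_sqrt; rewrite -enorm_sq exprn_gt0.
  by rewrite -enorm_def scalerA; congr (_ *: _); field.
have cb_diff := rdiffM c_diff b_diff.
have at_diff := rdiff_comp (is_derive1_atan _) cb_diff.
have bi_diff : rdiff X x (fun y => (enorm (g y))^-1)
    ((- 1 / enorm (g x) ^+ 2) *: ((enorm (g x))^-1 *: (g x *m A^T))).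
  by apply: (rdiff_comp (p := fun z => z^-1)) b_diff; apply: hasderV => //; exact: hasderI.
have := rdiffD (rdiff_coord X x i) (rdiffM (rdiffM at_diff bi_diff) gi).
rewrite (_ : (fun y => _) = fun y => ray y 0 i); last first.
  by apply/funext => y; rewrite /ray arctan_vecE !mxE.
move=> H; apply: rdiff_eq H _.
have hAG j := mulmx_Gam j i.
have hG j : flow_Gam (g x) j i = g x 0 j * g x 0 i by rewrite !mxE big_ord1 mxE.
rewrite /flow_mx; move: (A *m flow_Gam (g x)) (g x *m A^T) hAG => AG gA' hAG; move: (flow_Gam (g x)) hG => GG hG.
apply/rowP => j; rewrite !mxE hAG hG eqxx andTb (eq_sym j i).
rewrite /flow_eta /flow_mu /flow_kap (negPf b0) /flow_Q.
move: b0 bp u0; rewrite /flow_u.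
move: (1 + 2 * tau * F x) (enorm (g x)) (g x 0 i) (g x 0 j) (gA' 0 j) => u b gi' gj gAj b0 bp up.
have un : u != 0 by rewrite gt_eqF.
have Qn : u ^+ 2 + tau ^+ 2 * b ^+ 2 != 0.
  by rewrite gt_eqF // ltr_pwDl ?exprn_gt0 // mulr_ge0 ?sqr_ge0.
have -> : (1 + (tau / u * b) ^+ 2)^-1 = u ^+ 2 / (u ^+ 2 + tau ^+ 2 * b ^+ 2).
  by rewrite -[RHS]invf_div; congr (_^-1); field.
move: (u ^+ 2 + _) Qn => q Qn.
by field; rewrite un Qn b0.
Qed.

End Transport.

(** * Hessian bounds and nondegeneracy *)

Lemma near_right_cont (R : realType) (p : R -> R) (e : R) : {for 0, continuous p} -> 0 < e ->
  \forall r \near 0^'+, p 0 - e <= p r.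
Proof.
move=> pc e0; have h := (@cvgrPdist_le _ _ _ (nbhs (0 : R)) (nbhs_filter _) _ _).1 pc e e0.
apply: cvg_within; apply: (@filterS _ (nbhs (0 : R)) (nbhs_filter _)) h => r.
by rewrite ler_norml => /andP[_ ?]; lra.
Qed.

Section KernelSecond.
Variables (R : realType) (d : nat).
Local Notation V := ('rV[R]_d).
Implicit Types (w h : V).

(** The product of cosines is the mean of [cos] at the endpoints of the interval
    with midpoint [2 (th + c r^2)] and half-width [2 r eta].  The quotient of the
    right-hand side by [r^2] extends continuously to [r = 0] by means of the
    difference quotients of sine and cosine. *)
Lemma cos_second (th eta c e : R) : 0 < e -> \forall r \near 0^'+,
  (- 2 * c * sin (2 * th) - 2 * eta ^+ 2 * cos (2 * th) - e) * r ^+ 2 <=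
  cos (2 * th + 2 * c * r ^+ 2) * cos (2 * (r * eta)) - cos (2 * th).
Proof.
move=> e0.
have /is_derive1_caratheodory[G [hG Gc Gx]] := is_derive_cos (2 * th).
have /is_derive1_caratheodory[H [hH Hc Hx]] := is_derive_sin (0 : R).
rewrite cos0 in Hx.
pose p r := 2 * c * G (2 * th + 2 * c * r ^+ 2) -
  2 * eta ^+ 2 * cos (2 * th + 2 * c * r ^+ 2) * (H (r * eta) * H (r * eta)).
have qc : {for 0, continuous (fun r : R => 2 * th + 2 * c * r ^+ 2)}.
  by apply: cvgD; [exact: cvg_cst|apply: cvgM; [exact: cvg_cst|exact: exprn_continuous]].
have Hc' : {for 0, continuous (fun r : R => H (r * eta))}.
  apply: (@continuous_comp _ _ _ (fun r : R => r * eta) H).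
    by apply: cvgM; [exact: cvg_id|exact: cvg_cst].
  by rewrite mul0r; exact: Hc.
have pc : {for 0, continuous p}.
  apply: cvgB.
    apply: cvgM; first exact: cvg_cst.
    apply: (continuous_comp qc); rewrite expr0n mulr0 addr0; exact: Gc.
  apply: cvgM.
    apply: cvgM; first exact: cvg_cst.
    apply: (continuous_comp qc); exact: continuous_cos.
  by apply: cvgM; exact: Hc'.
have := near_right_cont pc e0; apply: filterS => r.
rewrite /p expr0n mul0r !mulr0 addr0 Gx Hx !mulr1 => hr.
have s1 : sin (r * eta) = H (r * eta) * (r * eta) by have := hH (r * eta); rewrite sin0 !subr0.
have c1 : cos (2 * th + 2 * c * r ^+ 2) - cos (2 * th) = G (2 * th + 2 * c * r ^+ 2) * (2 * c * r ^+ 2).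
  by rewrite hG; congr (_ * _); ring.
have c2 : cos (2 * (r * eta)) = 1 - 2 * sin (r * eta) ^+ 2.
  by rewrite mulr_natl cos_mulr2n cos2sin2; ring.
rewrite c2 s1.
have -> : cos (2 * th + 2 * c * r ^+ 2) * (1 - 2 * (H (r * eta) * (r * eta)) ^+ 2) - cos (2 * th) =
  (cos (2 * th + 2 * c * r ^+ 2) - cos (2 * th)) -
  cos (2 * th + 2 * c * r ^+ 2) * 2 * (H (r * eta) * (r * eta)) ^+ 2 by ring.
rewrite c1; have := ler_wpM2r (sqr_ge0 r) hr.
by congr (_ <= _); ring.
Qed.

(** The points [w + r h] and [w - r h] are at distances at most
    [th + r eta + c r^2] and [th - r eta + c r^2] from 0 as soon as [2 th c]
    exceeds the squared orthogonal part of [h] and [r] is small, and the squared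
    cosine decreases with the distance. *)
Lemma ckernel_second w h (e : R) : 0 < enorm w < pi / 2 -> 0 < e ->
  let eta := dotv w h / enorm w in \forall r \near 0^'+,
  (- ((enorm h ^+ 2 - eta ^+ 2) / enorm w) * sin (2 * enorm w)
     - 2 * eta ^+ 2 * cos (2 * enorm w) - e) * r ^+ 2 <=
  ckernel (w + r *: h) + ckernel (w - r *: h) - 2 * ckernel w.
Proof.
move=> /andP[th0 thpi] e0 eta; set th := enorm w in th0 thpi *.
set E := enorm h ^+ 2 - eta ^+ 2.
have E0 : 0 <= E.
  rewrite subr_ge0 -real_normK ?num_real // ler_pXn2r ?nnegrE ?enorm_ge0 //.
  rewrite normrM normfV (gtr0_norm th0) ler_pdivrMr // mulrC; exact: cauchy_schwarz.
have s2 : 0 <= sin (2 * th) by rewrite sin2_ge0 // (ltW th0) ltW.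
have s21 : 0 < 2 * sin (2 * th) + 1 by lra.
(* the slack [dl] in [c] costs at most half of [e] *)
pose dl := e / 2 / (2 * sin (2 * th) + 1); have dl0 : 0 < dl by rewrite !divr_gt0.
pose c := E / (2 * th) + dl.
have c0 : 0 < c by rewrite ltr_wpDl // divr_ge0 // mulr_ge0 // ltW.
have e2 : 0 < e / 2 by rewrite divr_gt0.
have pi0 := pi2_gt0 R.
(* [rad s r] bounds the distance from 0 to the point [w + s r h], for a sign [s] *)
pose rad (s r : R) := th + s * (r * eta) + c * r ^+ 2.
have rad_cont s : {for 0, continuous (rad s)}.
  apply: cvgD; last by apply: cvgM; [exact: cvg_cst|exact: exprn_continuous].
  apply: cvgD; first exact: cvg_cst.
  by apply: cvgM; [exact: cvg_cst|apply: cvgM; [exact: cvg_id|exact: cvg_cst]].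
have rad0 s : rad s 0 = th by rewrite /rad mul0r expr0n !mulr0 !addr0.
have radlo s : \forall r \near 0^'+, th / 2 <= rad s r.
  have t2 : 0 < th / 2 by rewrite divr_gt0.
  by have := near_right_cont (rad_cont s) t2; rewrite rad0; apply: filterS => r; lra.
have radhi s : \forall r \near 0^'+, rad s r <= pi / 2.
  have t2 : 0 < pi / 2 - th by rewrite subr_gt0.
  have nc : {for 0, continuous (fun r => - rad s r)} by apply: cvgN; exact: rad_cont.
  by have := near_right_cont nc t2; rewrite rad0; apply: filterS => r; lra.
have small s : \forall r \near 0^'+, 0 <= 2 * th * dl + 2 * c * (s * (r * eta)) + c ^+ 2 * r ^+ 2.
  pose p r := 2 * th * dl + 2 * c * (s * (r * eta)) + c ^+ 2 * r ^+ 2.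
  have pc : {for 0, continuous p}.
    apply: cvgD; last by apply: cvgM; [exact: cvg_cst|exact: exprn_continuous].
    apply: cvgD; first exact: cvg_cst.
    apply: cvgM; first exact: cvg_cst.
    by apply: cvgM; [exact: cvg_cst|apply: cvgM; [exact: cvg_id|exact: cvg_cst]].
  have p0 : 0 < p 0.
    by rewrite /p mul0r expr0n !mulr0 !addr0 (mulr_gt0 (mulr_gt0 _ th0) dl0).
  by have := near_right_cont pc p0; apply: filterS => r; rewrite subrr.
have low s : s ^+ 2 = 1 -> \forall r \near 0^'+, cos (rad s r) ^+ 2 <= ckernel (w + (s * r) *: h).
  move=> s1; near=> r.
  have r1 : th / 2 <= rad s r by near: r.
  have r2 : rad s r <= pi / 2 by near: r.
  have r3 : 0 <= 2 * th * dl + 2 * c * (s * (r * eta)) + c ^+ 2 * r ^+ 2 by near: r.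
  have rp : 0 <= rad s r by apply: le_trans r1; rewrite divr_ge0 // ltW.
  have nw : enorm (w + (s * r) *: h) <= rad s r.
    rewrite -(ler_pXn2r (n := 2)) ?nnegrE ?enorm_ge0 // enormD_sq dotvZr enormZ exprMn.
    rewrite real_normK ?num_real // exprMn s1 mul1r -/th.
    have -> : dotv w h = th * eta by rewrite /eta mulrCA mulfV ?mulr1 // gt_eqF.
    have -> : enorm h ^+ 2 = E + eta ^+ 2 by rewrite /E subrK.
    rewrite -subr_ge0.
    have -> : rad s r ^+ 2 - (th ^+ 2 + 2 * (s * r * (th * eta)) + r ^+ 2 * (E + eta ^+ 2)) =
      r ^+ 2 * (2 * th * c - E + 2 * c * (s * (r * eta)) + c ^+ 2 * r ^+ 2) + (s ^+ 2 - 1) * (r * eta) ^+ 2.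
      by rewrite /rad; ring.
    rewrite s1 subrr mul0r addr0 mulr_ge0 ?sqr_ge0 //.
    have -> // : 2 * th * c - E = 2 * th * dl by rewrite /c; field; rewrite gt_eqF.
  rewrite ckernel_in ?(le_trans nw) //.
  have n0 := enorm_ge0 (w + (s * r) *: h).
  rewrite ler_pXn2r ?nnegrE ?cos_ge0_pihalf //; [|by apply/andP; split; lra..].
  move: nw; rewrite le_eqVlt => /predU1P[->//|nw].
  by rewrite ltW // ltr_cos // in_itv /=; apply/andP; split; lra.
have := cos_second th eta c e2; move=> hcs; near=> r.
have l1 : cos (rad 1 r) ^+ 2 <= ckernel (w + (1 * r) *: h) by near: r; apply: low; rewrite expr1n.
have l2 : cos (rad (-1) r) ^+ 2 <= ckernel (w + (-1 * r) *: h) by near: r; apply: low; rewrite sqrrN expr1n.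
rewrite mul1r in l1; rewrite mulN1r scaleNr in l2.
have l3 : (- 2 * c * sin (2 * th) - 2 * eta ^+ 2 * cos (2 * th) - e / 2) * r ^+ 2 <=
  cos (2 * th + 2 * c * r ^+ 2) * cos (2 * (r * eta)) - cos (2 * th) by near: r.
have cos2 z : cos z ^+ 2 = (1 + cos (2 * z)) / 2 by rewrite mulr_natl cos_mulr2n; field.
rewrite [ckernel w]ckernel_in ?(ltW thpi) // -/th.
have sumc : cos (rad 1 r) ^+ 2 + cos (rad (-1) r) ^+ 2 - 2 * cos th ^+ 2 =
  cos (2 * th + 2 * c * r ^+ 2) * cos (2 * (r * eta)) - cos (2 * th).
  rewrite !cos2.
  have -> : 2 * rad 1 r = (2 * th + 2 * c * r ^+ 2) + 2 * (r * eta) by rewrite /rad; ring.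
  have -> : 2 * rad (-1) r = (2 * th + 2 * c * r ^+ 2) - 2 * (r * eta) by rewrite /rad; ring.
  by rewrite cosD cosB; field.
apply: (@le_trans _ _ ((- 2 * c * sin (2 * th) - 2 * eta ^+ 2 * cos (2 * th) - e / 2) * r ^+ 2)); last first.
  by apply: le_trans l3 _; rewrite -sumc; lra.
rewrite ler_wpM2r ?sqr_ge0 //.
have -> : - 2 * c * sin (2 * th) = - (E / th) * sin (2 * th) - 2 * sin (2 * th) * dl.
  by rewrite /c; field; rewrite gt_eqF.
have : (2 * sin (2 * th) + 1) * dl = e / 2 by rewrite /dl mulrC divfK ?gt_eqF.
by rewrite mulrDl mul1r; lra.
Unshelve. all: by end_near.
Qed.

End KernelSecond.

Section Nondegenerate.
Variables (R : realType) (d : nat).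
Local Notation V := ('rV[R]_d).

(** The Hessian of the kernel [(m ckernel - 1) / (2 sigma)] at a point where it has
    value [a] and gradient [g] has eigenvalue [- (lam - |g|^2 / lam)] along [g] and
    [- |g| / atan (|g| / lam)] orthogonally to it; for [g = 0] both limits are
    [- lam]. *)
Definition hess_lower (a : R) (g : V) (A : 'M[R]_d) (sigma : R) : Prop :=
  let lam := sigma^-1 + 2 * a in
  if enorm g == 0 then 0 <= lam /\ forall h : V, - lam * enorm h ^+ 2 <= dotv (h *m A) h
  else 0 < lam /\ forall h : V, let eta2 := dotv h g ^+ 2 / enorm g ^+ 2 in
    - (enorm g / atan (enorm g / lam)) * (enorm h ^+ 2 - eta2) -
    (lam - enorm g ^+ 2 / lam) * eta2 <= dotv (h *m A) h.

Section FromTouching.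
Variables (F : V -> R) (x g : V) (A : 'M[R]_d) (sigma m : R) (w : V).
Hypothesis hso : forall (k : V) (e : R), 0 < e -> \forall r \near 0^'+,
  `|F (x + r *: k) - F x - r * dotv g k - r ^+ 2 * (dotv (k *m A) k / 2)| <= e * r ^+ 2.
Hypotheses (s0 : 0 < sigma) (m0 : 0 <= m) (hw : enorm w <= pi / 2).
Hypothesis e0 : 1 + 2 * sigma * F x = m * ckernel w.
Hypothesis hm : forall h : V, m * ckernel (w + h) <= 1 + 2 * sigma * F (x + h).

(** Second differences cancel the first-order terms on both sides. *)
Lemma touching_hessian (c : R) (h : V) :
  (\forall r \near 0^'+, c * r ^+ 2 <= ckernel (w + r *: h) + ckernel (w - r *: h) - 2 * ckernel w) ->
  m / (2 * sigma) * c <= dotv (h *m A) h.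
Proof.
move=> hc; apply/ler_addgt0Pr => e ep; have e2 : 0 < e / 2 by rewrite divr_gt0.
have h1 := hso h e2; have h2 := hso (- h) e2.
have h3 : \forall r \near (0 : R)^'+, 0 < r by exact: nbhs_right_gt.
have [r [[[]]]] := filter_ex (filterI (filterI (filterI h1 h2) hc) h3).
rewrite !ler_norml => /andP[_ {}h1] /andP[_ {}h2] {}hc r0.
rewrite mulNmx dotvNl !dotvNr opprK in h2.
have r2 : 0 < r ^+ 2 by rewrite exprn_gt0.
have ss : 0 < 2 * sigma by rewrite mulr_gt0.
have t1 := hm (r *: h); have t2 := hm (- (r *: h)); rewrite -scalerN in t2 *.
have t3 := ler_wpM2l m0 hc; rewrite -scalerN in t3.
have : m * (c * r ^+ 2) <= 2 * sigma * (r ^+ 2 * (dotv (h *m A) h + e)).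
  apply: le_trans t3 _.
  have : F (x + r *: h) + F (x + r *: - h) - 2 * F x <= r ^+ 2 * (dotv (h *m A) h + e) by lra.
  move=> /(ler_wpM2l (ltW ss)); apply: le_trans.
  move: t1 t2 e0; clear.
  move: (ckernel (w + r *: h)) (ckernel (w + r *: - h)) (ckernel w) => k1 k2 k0.
  move: (F (x + r *: h)) (F (x + r *: - h)) (F x) => F1 F2 F0; lra.
have -> : m * (c * r ^+ 2) = 2 * sigma * (r ^+ 2 * (m / (2 * sigma) * c)) by field; rewrite gt_eqF.
by rewrite !ler_pM2l.
Qed.

Lemma touching_hessian_sinc (h : V) :
  - (m / sigma * sinc2 (enorm w)) * enorm h ^+ 2 <= dotv (h *m A) h.
Proof.
have -> : - (m / sigma * sinc2 (enorm w)) * enorm h ^+ 2 =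
  m / (2 * sigma) * (- 2 * sinc2 (enorm w) * enorm h ^+ 2) by field; rewrite gt_eqF.
apply: touching_hessian; apply: nearW => r.
have := ckernel_tangent (r *: h) hw; have := ckernel_tangent (- (r *: h)) hw.
by rewrite dotvNr enormN enormZ exprMn real_normK ?num_real //; lra.
Qed.

Hypothesis gE : g = (m / (2 * sigma)) *: grad_ckernel w.

(** Value and gradient at the touching point determine the kernel: the angle
    [r = |w|] satisfies [tan r = |g| / lam] and [m cos r ^ 2 = sigma lam].  If the
    gradient vanishes, either the kernel is centred at the point or its lower
    bound on the Hessian is 0. *)
Lemma touching_hess_lower : hess_lower (F x) g A sigma.
Proof.
rewrite /hess_lower; set r := enorm w; have r0 : 0 <= r := enorm_ge0 w.
set lam := sigma^-1 + 2 * F x; have pi0 := pi2_gt0 R.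
have lamE : lam = m * ckernel w / sigma by rewrite -e0 /lam; field; rewrite gt_eqF.
have lam0 : 0 <= lam.
  by rewrite lamE; apply: divr_ge0; [apply: mulr_ge0 m0 _; exact: ckernel_ge0|exact: ltW].
have sc0 : 0 <= sinc2 r by rewrite sinc2_ge0 // r0.
have gN : g = (- (m / sigma * sinc2 r)) *: w.
  by rewrite gE /grad_ckernel scalerA; congr (_ *: _); field; rewrite gt_eqF.
have gn : enorm g = m / sigma * sinc2 r * r.
  by rewrite gN enormZ normrN ger0_norm // mulr_ge0 // divr_ge0 // ltW.
have ms0 : 0 <= m / sigma by rewrite divr_ge0 // ltW.
have [b0|bn] := eqVneq (enorm g) 0.
  split=> // h; apply: le_trans (touching_hessian_sinc h).
  rewrite ler_wpM2r ?sqr_ge0 // lerN2 -/r.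
  move/eqP: b0; rewrite gn !mulf_eq0 => /orP[/orP[ms|/eqP ->]|/eqP r00].
  - by rewrite (_ : m / sigma = 0) ?mul0r //; apply/eqP; rewrite mulf_eq0.
  - by rewrite mulr0.
  by rewrite lamE ckernel_in // -/r r00 cos0 expr1n mulr1 -{2}[m / sigma]mulr1 ler_wpM2l ?sinc2_le1.
have mn : m != 0 by apply: contraNneq bn => m00; rewrite gn m00 !mul0r.
have mp : 0 < m by rewrite lt0r mn.
have rn : r != 0 by apply: contraNneq bn => r00; rewrite gn r00 mulr0.
have rp : 0 < r by rewrite lt0r rn.
have rpi : r < pi / 2.
  rewrite lt_neqAle hw andbT; apply: contraNneq bn => rpi.
  rewrite gn /sinc2 (negPf rn) rpi (_ : 2 * (pi / 2) = pi); last by field.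
  by rewrite sinpi !(mul0r, mulr0).
have cp : 0 < cos r by rewrite cos_gt0_pihalf // rpi andbT; lra.
have lamc : lam = m * cos r ^+ 2 / sigma by rewrite lamE ckernel_in.
have lamp : 0 < lam by rewrite lamc divr_gt0 // mulr_gt0 // exprn_gt0.
have s2 : sin (2 * r) = 2 * (sin r * cos r) by rewrite mulr_natl sin_mulr2n [sin r * _]mulrC mulr_natl.
have c2 : cos (2 * r) = cos r ^+ 2 - sin r ^+ 2.
  by rewrite mulr_natl cos_mulr2n sin2cos2; ring.
have gb : enorm g = m / sigma * (sin r * cos r).
  by rewrite gn /sinc2 (negPf rn) s2; field; rewrite rn gt_eqF.
have at_r : atan (enorm g / lam) = r.
  have -> : enorm g / lam = tan r.
    by rewrite gb lamc /tan; field; rewrite !gt_eqF.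
  by rewrite tanK // in_itv /=; apply/andP; split; lra.
split=> // h; rewrite at_r; set eta2 := dotv h g ^+ 2 / _.
pose eta := dotv w h / r.
have etaE : eta2 = eta ^+ 2.
  rewrite /eta2 /eta gn gN dotvZr (dotvC h); field.
  have := bn; rewrite gn !mulf_eq0 !negb_or => /andP[/andP[/andP[_ _] scn] _].
  by rewrite rn scn mn gt_eqF.
apply/ler_addgt0Pr => e ep.
pose e' := e / (m / (2 * sigma)).
have msp : 0 < m / (2 * sigma) by rewrite divr_gt0 // mulr_gt0.
have e'p : 0 < e' by rewrite divr_gt0.
have rr : 0 < enorm w < pi / 2 by rewrite rp.
have := touching_hessian (ckernel_second h rr e'p); rewrite -/r -/eta -etaE.
move=> H; rewrite -lerBlDr; apply: le_trans H.
rewrite le_eqVlt; apply/orP; left; apply/eqP.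
have -> : e = m / (2 * sigma) * e' by rewrite /e' mulrC divfK // gt_eqF.
rewrite s2 c2 gb lamc; field.
by rewrite !gt_eqF.
Qed.

End FromTouching.

Lemma mulmx_rank1 (v g : V) : v *m (g^T *m g) = dotv v g *: g.
Proof.
apply/rowP => i; rewrite mulmxA !mxE big_ord1 !mxE; congr (_ * _).
by apply: eq_bigr => j _; rewrite !mxE.
Qed.

(** If [v] is a null vector of the transposed differential, then [hAh] for
    [h = kap v + eta (v.g) g] equals minus the quadratic form with eigenvalues
    [lam - |g|^2 / lam] and [|g| / atan (|g| / lam)] at [h], where
    [lam = 1 / tau + 2 a].  Both eigenvalues increase strictly with [lam], hence
    decrease with [tau], so the bound valid at time [sigma] forbids this before
    [sigma]. *)
Lemma flow_nondegenerate (a : R) (g : V) (A : 'M[R]_d) (sigma tau : R) :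
  A^T = A -> hess_lower a g A sigma -> 0 < tau < sigma -> \det (flow_mx a g A tau) != 0.
Proof.
move=> AT; rewrite /hess_lower; set lams := sigma^-1 + 2 * a => hA /andP[t0 ts].
pose lam := tau^-1 + 2 * a.
have s0 := lt_trans t0 ts.
have lamlt : lams < lam by rewrite ltrD2r ltf_pV2.
have uE : flow_u a tau = tau * lam by rewrite /flow_u /lam; field; rewrite gt_eqF.
have lam0 : 0 < lam by case: ifP hA => _ [h _]; [exact: le_lt_trans h lamlt|exact: lt_trans h lamlt].
have up : 0 < flow_u a tau by rewrite uE mulr_gt0.
rewrite -det_tr; apply/negP => /det0P[v vn0 vM].
set b := enorm g in hA *.
have vn : 0 < enorm v.
  by rewrite lt0r enorm_ge0 andbT; apply: contraNneq vn0 => /enorm_eq0 ->.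
set S := dotv v g.
pose h := flow_kap a g tau *: v + (flow_eta a g tau * S) *: g.
have hv : v - (flow_mu a g tau * S) *: g + h *m A = 0.
  have GT : (flow_Gam g)^T = flow_Gam g by rewrite /flow_Gam trmx_mul trmxK.
  have MT : (flow_mx a g A tau)^T = 1%:M + flow_kap a g tau *: A +
      flow_eta a g tau *: (flow_Gam g *m A) - flow_mu a g tau *: flow_Gam g.
    by rewrite /flow_mx raddfB /= !raddfD /= !linearZ /= trmx1 trmx_mul GT AT.
  rewrite -vM MT mulmxBr !mulmxDr mulmx1 -!scalemxAr mulmxA mulmx_rank1 -/S.
  rewrite /h mulmxDl -!scalemxAl !scalerA; move: (v *m A) (g *m A) => y z.
  by apply/rowP => i; rewrite !mxE; ring.
have hAh : dotv (h *m A) h = - (flow_kap a g tau * dotv v v +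
    (flow_eta a g tau - flow_mu a g tau * (flow_kap a g tau + flow_eta a g tau * b ^+ 2)) * S ^+ 2).
  have -> : h *m A = - (v - (flow_mu a g tau * S) *: g).
    by apply/eqP; rewrite -subr_eq0 opprK addrC hv.
  by rewrite /h !(dotvDl, dotvDr, dotvNl, dotvNr, dotvZl, dotvZr) (dotvC g v) -/S /b enorm_sq; ring.
move: hA; case: ifPn => [/eqP b0|bn] [hA1 hA].
  have g0 : g = 0 by exact: enorm_eq0.
  have S0 : S = 0 by rewrite /S g0 dotv0r.
  have kE : flow_kap a g tau = lam^-1.
    by rewrite /flow_kap -/b b0 eqxx uE; field; rewrite !gt_eqF.
  have := hA h; rewrite hAh /h S0 mulr0 scale0r addr0 enormZ expr0n mulr0 addr0.
  rewrite exprMn real_normK ?num_real // kE -enorm_sq.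
  have -> : - lams * (lam^-1 ^+ 2 * enorm v ^+ 2) = - (lam^-1 * enorm v ^+ 2) * (lams / lam) by field; rewrite gt_eqF.
  have vv : 0 < lam^-1 * enorm v ^+ 2 by rewrite mulr_gt0 ?invr_gt0 // exprn_gt0.
  rewrite mulNr lerN2 ler_pMr // ler_pdivlMr // mul1r => lh.
  by move: (le_lt_trans lh lamlt); rewrite ltxx.
have bp : 0 < b by rewrite lt0r bn enorm_ge0.
set th := atan (b / lam); set ths := atan (b / lams) in hA.
have th0 : 0 < th by rewrite -[ltLHS]atan0; apply: lt_atan; rewrite divr_gt0.
have thlt : th < ths.
  by apply: lt_atan; rewrite ltr_pM2l // ltf_pV2.
have kE : flow_kap a g tau = th / b.
  rewrite /flow_kap -/b (negPf bn) uE; congr (atan _ / _); field.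
  by rewrite !gt_eqF.
have Qp : 0 < lam ^+ 2 + b ^+ 2 by rewrite ltr_pwDl ?exprn_gt0 // sqr_ge0.
have QE : flow_Q a g tau = tau ^+ 2 * (lam ^+ 2 + b ^+ 2).
  by rewrite /flow_Q uE -/b; ring.
pose be := lam / (lam ^+ 2 + b ^+ 2).
have bE : flow_kap a g tau + flow_eta a g tau * b ^+ 2 = be.
  rewrite /flow_eta -/b divfK ?sqrf_eq0 // addrC subrK QE uE /be.
  by move: (lam ^+ 2 + b ^+ 2) Qp => q Qp; field; rewrite !gt_eqF.
have mE : flow_mu a g tau = 2 / (lam ^+ 2 + b ^+ 2).
  by rewrite /flow_mu QE; move: (lam ^+ 2 + b ^+ 2) Qp => q Qp; field; rewrite !gt_eqF.
have etE : flow_eta a g tau = (be - flow_kap a g tau) / b ^+ 2 by rewrite -bE; field.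
pose c2 := S ^+ 2 / b ^+ 2; pose E := enorm v ^+ 2 - c2.
have E0 : 0 <= E.
  rewrite subr_ge0 ler_pdivrMr ?exprn_gt0 // -exprMn -real_normK ?num_real //.
  by rewrite ler_pXn2r ?nnegrE ?mulr_ge0 ?enorm_ge0 // cauchy_schwarz.
have c20 : 0 <= c2 by rewrite divr_ge0 ?sqr_ge0.
have hg : dotv h g = be * S.
  by rewrite /h !(dotvDl, dotvZl) -enorm_sq -/b -/S -bE; ring.
have hh : enorm h ^+ 2 - (be * S) ^+ 2 / b ^+ 2 = (th / b) ^+ 2 * E.
  rewrite enorm_sq /h !(dotvDl, dotvDr, dotvZl, dotvZr) (dotvC g v) -!enorm_sq -/b -/S.
  by rewrite etE kE /E /c2; field.
have := hA h; rewrite hg hh hAh -enorm_sq bE kE.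
have -> : flow_eta a g tau - flow_mu a g tau * be = (be * (1 - flow_mu a g tau * b ^+ 2) - th / b) / b ^+ 2.
  by rewrite etE kE; field.
have -> : th / b * enorm v ^+ 2 + (be * (1 - flow_mu a g tau * b ^+ 2) - th / b) / b ^+ 2 * S ^+ 2 =
  th / b * E + be * (1 - flow_mu a g tau * b ^+ 2) * c2 by rewrite /E /c2; field.
have -> : (be * S) ^+ 2 / b ^+ 2 = be ^+ 2 * c2 by rewrite /c2; field.
have -> : be * (1 - flow_mu a g tau * b ^+ 2) = be ^+ 2 * (lam - b ^+ 2 / lam).
  rewrite mE /be; have := Qp; rewrite lt0r => /andP[qn _].
  field; by rewrite qn gt_eqF.
move=> hfin.
have be0 : 0 < be by rewrite divr_gt0.
have radial : 0 <= be ^+ 2 * c2 * ((lam - b ^+ 2 / lam) - (lams - b ^+ 2 / lams)).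
  apply: mulr_ge0; first exact: mulr_ge0 (sqr_ge0 _) c20.
  rewrite subr_ge0 lerB ?(ltW lamlt) //.
  by rewrite ler_pM2l ?exprn_gt0 // lef_pV2 // ltW.
have tangential : 0 <= (th / b) ^+ 2 * E * (b / th - b / ths).
  apply: mulr_ge0; first exact: mulr_ge0 (sqr_ge0 _) E0.
  rewrite subr_ge0 ler_pM2l // lef_pV2 ?posrE // ?ltW //.
  exact: lt_trans thlt.
have : 0 < be ^+ 2 * c2 * ((lam - b ^+ 2 / lam) - (lams - b ^+ 2 / lams)) +
    (th / b) ^+ 2 * E * (b / th - b / ths).
  have [c2z|c2n] := eqVneq c2 0.
    rewrite ltr_wpDl // mulr_gt0 //.
      rewrite mulr_gt0 ?exprn_gt0 ?divr_gt0 // /E c2z subr0 exprn_gt0 //.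
    by rewrite subr_gt0 ltr_pM2l // ltf_pV2 ?posrE //; exact: lt_trans thlt.
  rewrite ltr_wpDr // mulr_gt0 //.
    by rewrite mulr_gt0 ?exprn_gt0 // lt0r c2n.
  by rewrite subr_gt0 ltr_leB // ler_pM2l ?exprn_gt0 // lef_pV2 // ltW.
have -> : (th / b) ^+ 2 * E * (b / th - b / ths) = th / b * E - (th / b) ^+ 2 * E * (b / ths).
  by field; rewrite bn !gt_eqF // (lt_trans th0).
by move: hfin; rewrite mulNr; lra.
Qed.

End Nondegenerate.

(** * Matrix calculus *)
Section MatrixCalculus.
Variable R : realType.

Lemma hasder_sum (I : Type) (r : seq I) (P : pred I) (f : I -> R -> R) (f' : I -> R) (t : R) :
  (forall i, hasder (f i) t (f' i)) ->
  hasder (fun u => \sum_(i <- r | P i) f i u) t (\sum_(i <- r | P i) f' i).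
Proof.
move=> fd; elim: r => [|i r IH].
  rewrite big_nil (_ : (fun _ => _) = fun=> 0); first exact: hasderC.
  by apply/funext => u; rewrite big_nil.
rewrite big_cons; case: ifP => Pi.
  rewrite (_ : (fun _ => _) = fun u => f i u + \sum_(j <- r | P j) f j u); first exact: hasderD.
  by apply/funext => u; rewrite big_cons Pi.
rewrite (_ : (fun _ => _) = fun u => \sum_(j <- r | P j) f j u) //.
by apply/funext => u; rewrite big_cons Pi.
Qed.

Lemma hasder_prod (I : finType) (f : I -> R -> R) (f' : I -> R) (t : R) :
  (forall i, hasder (f i) t (f' i)) ->
  hasder (fun u => \prod_i f i u) t (\sum_i f' i * \prod_(j | i != j) f j t).
Proof.
move=> fd; pose D (s : seq I) := \sum_(i <- s) f' i * \prod_(j <- s | i != j) f j t.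
suff H (s : seq I) : uniq s -> hasder (fun u => \prod_(i <- s) f i u) t (D s).
  by have := H _ (index_enum_uniq I).
elim: s => [|i s IH] /=.
  move=> _; rewrite /D big_nil (_ : (fun _ => _) = fun=> 1); first exact: hasderC.
  by apply/funext => u; rewrite big_nil.
move=> /andP[ins us]; rewrite (_ : (fun _ => _) = fun u => f i u * \prod_(j <- s) f j u); last first.
  by apply/funext => u; rewrite big_cons.
apply: hasder_eq; first exact: hasderM (fd i) (IH us).
rewrite /D big_cons big_cons eqxx /=; congr (_ * _ + _).
  rewrite big_seq [RHS]big_seq_cond; apply: eq_bigl => j.
  have [js|//] := boolP (j \in s); rewrite /=; apply/esym.
  by apply: contraNneq ins => ->.
rewrite mulr_sumr; apply: eq_big_seq => j js; rewrite big_cons.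
by rewrite ifT; [ring|apply: contraNneq ins => <-].
Qed.

Definition mxder (m n : nat) (f : R -> 'M[R]_(m, n)) (t : R) (F : 'M[R]_(m, n)) :=
  forall i j, hasder (fun u => f u i j) t (F i j).

Lemma mxderM m n p (f : R -> 'M[R]_(m, n)) (h : R -> 'M[R]_(n, p)) t F H :
  mxder f t F -> mxder h t H -> mxder (fun u => f u *m h u) t (F *m h t + f t *m H).
Proof.
move=> fF hH i k; apply: hasder_eq.
  rewrite (_ : (fun u => _) = fun u => \sum_j f u i j * h u j k); last first.
    by apply/funext => u; rewrite mxE.
  by apply: hasder_sum => j; apply: hasderM; [exact: fF|exact: hH].
by rewrite !mxE -big_split.
Qed.

Lemma hasder_tr n (f : R -> 'M[R]_n) t F : mxder f t F -> hasder (fun u => \tr (f u)) t (\tr F).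
Proof. by move=> fF; apply: hasder_sum => i; exact: fF. Qed.

(** Differentiating the Leibniz formula replaces one factor at a time; grouping
    the permutations by the image of the row concerned gives the cofactors. *)
Lemma hasder_det n (f : R -> 'M[R]_n) t F : mxder f t F ->
  hasder (fun u => \det (f u)) t (\tr (F *m \adj (f t))).
Proof.
move=> fF; apply: hasder_eq.
  apply: hasder_sum => s; apply: hasderM; first exact: hasderC.
  by apply: hasder_prod => i; exact: fF.
rewrite /mxtrace.
transitivity (\sum_(i < n) \sum_(s : 'S_n) (-1) ^+ s * (F i (s i) * \prod_(k | i != k) f t k (s k))).
  rewrite exchange_big; apply: eq_bigr => s _ /=; rewrite mul0r add0r mulr_sumr.
  by apply: eq_bigr => i _.
apply: eq_bigr => i _; rewrite mxE.
rewrite (partition_big (fun s : 'S_n => s i) xpredT) //=.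
apply: eq_bigr => j _; rewrite mxE expand_cofactor mulr_sumr.
by apply: eq_bigr => s /eqP <-; rewrite mulrCA.
Qed.

Lemma mxder_adj n (f : R -> 'M[R]_n) t F : mxder f t F ->
  exists N, mxder (fun u => \adj (f u)) t N.
Proof.
move=> fF.
exists (\matrix_(i, j) ((-1) ^+ (j + i) * \tr (row' j (col' i F) *m \adj (row' j (col' i (f t)))))).
move=> i j; apply: hasder_eq.
  rewrite (_ : (fun u => _) = fun u => (-1) ^+ (j + i) * \det (row' j (col' i (f u)))); last first.
    by apply/funext => u; rewrite mxE.
  apply: hasderM; first exact: hasderC.
  apply: (@hasder_det _ _ _ (row' j (col' i F))) => k l.
  rewrite !mxE (_ : (fun u => _) = fun u => f u (lift j k) (lift i l)); first exact: fF.
  by apply/funext => u; rewrite !mxE.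
by rewrite mul0r add0r mxE.
Qed.

(** The derivative of the adjugate is not computed from its definition: it is
    solved for in the derivative of [f *m \adj f = \det f]. *)
Lemma hasder_logdet n (f f1 : R -> 'M[R]_n) t F2 :
  mxder f t (f1 t) -> mxder f1 t F2 -> \det (f t) != 0 ->
  hasder (fun u => \tr (f1 u *m \adj (f u)) / \det (f u)) t
    (\tr (F2 *m invmx (f t)) - \tr (f1 t *m invmx (f t) *m (f1 t *m invmx (f t)))).
Proof.
move=> ff1 f1F2 d0; have [N fN] := mxder_adj ff1.
have un : f t \in unitmx by rewrite unitmxE unitfE.
have adjE : \adj (f t) = \det (f t) *: invmx (f t).
  by rewrite /invmx un scalerA divff // scale1r.
set P := invmx (f t); set D := \det (f t); set T := \tr (f1 t *m P).
have d1 : hasder (fun u => \det (f u)) t (D * T).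
  apply: hasder_eq (hasder_det ff1) _.
  by rewrite adjE -scalemxAr mxtraceZ.
have NE : N = (D * T) *: P - P *m f1 t *m (D *: P).
  have e1 := mxderM ff1 fN.
  have e2 : mxder (fun u => f u *m \adj (f u)) t ((D * T)%:M).
    move=> i j; rewrite (_ : (fun u => _) = fun u => \det (f u) *+ (i == j)); last first.
      by apply/funext => u; rewrite mul_mx_adj mxE.
    rewrite mxE; case: eqP => _; last first.
      rewrite mulr0n (_ : (fun _ => _) = fun=> 0); first exact: hasderC.
      by apply/funext => u; rewrite mulr0n.
    by rewrite mulr1n.
  have e3 : f1 t *m \adj (f t) + f t *m N = (D * T)%:M.
    apply/matrixP => i j.
    have h1 : is_derive t (1 : R) (fun u => (f u *m \adj (f u)) i j) _ := e1 i j.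
    have h2 : is_derive t (1 : R) (fun u => (f u *m \adj (f u)) i j) _ := e2 i j.
    by rewrite -(@derive_val _ _ _ _ _ _ _ h1) (@derive_val _ _ _ _ _ _ _ h2).
  have : P *m (f t *m N) = P *m ((D * T)%:M - f1 t *m \adj (f t)).
    by rewrite -e3 addrC addKr.
  rewrite mulmxA mulVmx // mul1mx => ->.
  by rewrite mulmxBr mul_mx_scalar adjE mulmxA.
have num := hasder_tr (mxderM f1F2 fN).
apply: hasder_eq; first by apply: hasderM; [exact: num|apply: hasderV; [exact: d0|exact: d1]].
cbv beta; rewrite adjE NE mulmxBr -!scalemxAr mxtraceD mxtraceZ raddfB /= !mxtraceZ -/P -/D.
by rewrite !mulmxA -/T; field.
Qed.

End MatrixCalculus.

(** * Time derivatives of the differential *)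
Section FlowDerivatives.
Variables (R : realType) (d : nat) (a : R) (g : 'rV[R]_d) (A : 'M[R]_d).
Implicit Type tau : R.
Let b := enorm g.
Let u := flow_u a.
Let Q := flow_Q a g.
Let kap := flow_kap a g.
Let eta := flow_eta a g.
Let mu := flow_mu a g.
Let Gam := flow_Gam g.
Let M := flow_mx a g A.

Definition flow_dQ tau : R := 4 * a * flow_u a tau + 2 * tau * enorm g ^+ 2.
Let dQ := flow_dQ.

(** First and second derivative of [flow_mx] in time.  The second one is written as
    the Jacobi equation along a characteristic of the Hamilton-Jacobi equation,
    on which the logarithmic derivative of [Q] is four times the potential. *)
Definition flow_mx1 tau : 'M[R]_d :=
  (Q tau)^-1 *: A - (2 * tau ^+ 2 / Q tau ^+ 2) *: (A *m Gam) - (4 * tau * u tau / Q tau ^+ 2) *: Gam.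
Definition flow_mx2 tau : 'M[R]_d :=
  - (dQ tau / Q tau) *: flow_mx1 tau - (4 / Q tau ^+ 2) *: (M tau *m Gam).

Section AtTime.
Variable tau : R.
Hypothesis u0 : 0 < u tau.

Lemma flow_Q_gt0 : 0 < Q tau.
Proof. by rewrite /Q /flow_Q ltr_wpDr ?exprn_gt0 // mulr_ge0 ?sqr_ge0. Qed.

Let un : u tau != 0. Proof. by rewrite gt_eqF. Qed.
Let Qn : Q tau != 0. Proof. by rewrite gt_eqF // flow_Q_gt0. Qed.

Lemma hasder_flow_u : hasder u tau (2 * a).
Proof. by apply: hasder_eq; [rewrite /u /flow_u; der|cbv beta; ring]. Qed.

Lemma hasder_flow_Q : hasder Q tau (dQ tau).
Proof.
apply: hasder_eq; first by rewrite /Q /flow_Q /flow_u; der.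
by cbv beta; rewrite /dQ /flow_dQ /flow_u /=; ring.
Qed.

Lemma hasder_flow_kap : hasder kap tau (Q tau)^-1.
Proof.
have hu := hasder_flow_u; rewrite /kap /flow_kap -/b; case: eqP => [b0|/eqP bn].
  apply: hasder_eq; first by apply: hasderM; [exact: hasderI|apply: hasderV; [exact: un|exact: hu]].
  rewrite /Q /flow_Q -/b b0 expr0n mulr0 addr0 -/u; move: un; rewrite /u /flow_u => un'.
  by cbv beta; field.
apply: hasder_eq.
  apply: hasderM; last exact: hasderC.
  apply: hasderAtan; apply: hasderM; last exact: hasderC.
  by apply: hasderM; [exact: hasderI|apply: hasderV; [exact: un|exact: hu]].
cbv beta.
have -> : 1 + (tau / u tau * b) ^+ 2 = Q tau / u tau ^+ 2 by rewrite /Q /flow_Q -/b -/u; field.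
have -> : (1 * (u tau)^-1 + tau * (- (2 * a) / u tau ^+ 2)) = (u tau) ^- 2.
  by move: un; rewrite /u /flow_u => un'; field.
by field; rewrite un Qn bn.
Qed.

(** Used to eliminate the derivative of [Q], which keeps the rational identities
    below in the two variables [u] and [Q]. *)
Lemma flow_dQ_tau : tau * dQ tau = 2 * Q tau - 2 * u tau.
Proof. by rewrite /dQ /flow_dQ /Q /flow_Q /u /flow_u; ring. Qed.

Lemma hasder_flow_mu : hasder mu tau (4 * tau * u tau / Q tau ^+ 2).
Proof.
have hQ := hasder_flow_Q; have e := flow_dQ_tau; apply: hasder_eq.
  rewrite /mu /flow_mu; apply: hasderM; last by apply: hasderV; [exact: Qn|exact: hQ].
  by apply: hasderM; [exact: hasderC|apply: hasderX; exact: hasderI].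
have -> : 4 * tau * u tau / Q tau ^+ 2 = 4 * tau / Q tau - 2 * tau * (tau * dQ tau) / Q tau ^+ 2.
  by rewrite e; field.
by rewrite /= -/Q; field.
Qed.

Lemma kap_eta : b != 0 -> kap tau + eta tau * b ^+ 2 = tau * u tau / Q tau.
Proof. by move=> bn; rewrite /eta /flow_eta -/b divfK ?sqrf_eq0 // addrC subrK. Qed.

Lemma hasder_flow_eta : b != 0 -> hasder eta tau (- (2 * tau ^+ 2) / Q tau ^+ 2).
Proof.
move=> bn; have hQ := hasder_flow_Q; have hu := hasder_flow_u; have hk := hasder_flow_kap; have e := flow_dQ_tau.
apply: hasder_eq.
  rewrite /eta /flow_eta; apply: hasderM; last exact: hasderC.
  apply: hasderD; last by apply: hasderN; exact: hk.
  apply: hasderM; last by apply: hasderV; [exact: Qn|exact: hQ].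
  by apply: hasderM; [exact: hasderI|exact: hu].
cbv beta; rewrite -/b -/u -/Q.
have -> : (1 * u tau + tau * (2 * a)) * (Q tau)^-1 + tau * u tau * (- dQ tau / Q tau ^+ 2) - (Q tau)^-1 =
  ((u tau + tau * (2 * a)) * Q tau - u tau * (tau * dQ tau) - Q tau) / Q tau ^+ 2 by field.
rewrite e mulr0 addr0.
have -> : (u tau + tau * (2 * a)) * Q tau - u tau * (2 * Q tau - 2 * u tau) - Q tau =
  - 2 * tau ^+ 2 * b ^+ 2 by rewrite /Q /flow_Q -/b /u /flow_u; ring.
by field; rewrite bn Qn.
Qed.

Let GG : Gam *m Gam = b ^+ 2 *: Gam.
Proof.
rewrite /Gam /flow_Gam mulmxA -[g^T *m g *m g^T]mulmxA (_ : g *m g^T = (b ^+ 2)%:M).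
  by rewrite mul_mx_scalar -scalemxAl.
apply/matrixP => i j; rewrite !ord1 !mxE eqxx /b enorm_sq.
by apply: eq_bigr => k _; rewrite !mxE.
Qed.

Let G0 : b = 0 -> Gam = 0.
Proof. by move=> /enorm_eq0 g0; rewrite /Gam /flow_Gam g0 mulmx0. Qed.

Lemma mxderD (m n : nat) (f h : R -> 'M[R]_(m, n)) F H :
  mxder f tau F -> mxder h tau H -> mxder (fun v => f v + h v) tau (F + H).
Proof.
move=> fF hH i j; rewrite mxE (_ : (fun v => _) = fun v => f v i j + h v i j).
  by apply: hasderD; [exact: fF|exact: hH].
by apply/funext => v; rewrite mxE.
Qed.

Lemma mxderZ (m n : nat) (c : R -> R) c' (B : 'M[R]_(m, n)) :
  hasder c tau c' -> mxder (fun v => c v *: B) tau (c' *: B).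
Proof.
move=> cc i j; rewrite (_ : (fun v => _) = fun v => c v * B i j).
  by apply: hasder_eq; [apply: hasderM; [exact: cc|exact: hasderC]|rewrite mxE; ring].
by apply/funext => v; rewrite mxE.
Qed.

Lemma mxderC (m n : nat) (B : 'M[R]_(m, n)) : mxder (fun=> B) tau 0.
Proof. by move=> i j; rewrite mxE; exact: hasderC. Qed.

Lemma mxder_flow_mx : mxder M tau (flow_mx1 tau).
Proof.
have hk := mxderZ A hasder_flow_kap.
have hm : mxder (fun v => - mu v *: Gam) tau (- (4 * tau * u tau / Q tau ^+ 2) *: Gam).
  by apply: mxderZ; apply: hasderN; exact: hasder_flow_mu.
have he : mxder (fun v => eta v *: (A *m Gam)) tau (- (2 * tau ^+ 2) / Q tau ^+ 2 *: (A *m Gam)).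
  have [b0|bn] := eqVneq b 0; last exact: mxderZ (hasder_flow_eta bn).
  rewrite (G0 b0) mulmx0 scaler0 (_ : (fun v => _) = fun=> 0); first exact: mxderC.
  by apply/funext => v; rewrite scaler0.
have := mxderD (mxderD (mxderD (mxderC 1%:M) hk) he) hm.
rewrite (_ : (fun v => _) = M); last first.
  by apply/funext => v; rewrite /M /flow_mx -/Gam scaleNr.
by rewrite /flow_mx1 add0r !mulNr !scaleNr.
Qed.

Lemma flow_mx_Gam : M tau *m Gam = (1 - mu tau * b ^+ 2) *: Gam + (tau * u tau / Q tau) *: (A *m Gam).
Proof.
have -> : (tau * u tau / Q tau) *: (A *m Gam) = (kap tau + eta tau * b ^+ 2) *: (A *m Gam).
  by have [b0|bn] := eqVneq b 0; [rewrite (G0 b0) mulmx0 !scaler0|rewrite kap_eta].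
rewrite /M /flow_mx -/Gam mulmxBl !mulmxDl mul1mx -!scalemxAl -mulmxA GG -scalemxAr.
rewrite -/kap -/eta -/mu; move: Gam (A *m Gam) => G AG.
by apply/matrixP => i j; rewrite !mxE; ring.
Qed.

Lemma mxder_flow_mx1 : mxder flow_mx1 tau (flow_mx2 tau).
Proof.
have hQ := hasder_flow_Q; have hu := hasder_flow_u; have e := flow_dQ_tau.
have Q2 : hasder (fun v => (Q v ^+ 2)^-1) tau (- 2 * dQ tau / Q tau ^+ 3).
  apply: hasder_eq; first by apply: hasderV; [rewrite expf_neq0|apply: hasderX; exact: hQ].
  by rewrite /=; field.
have h1 : mxder (fun v => (Q v)^-1 *: A) tau (- dQ tau / Q tau ^+ 2 *: A).
  by apply: mxderZ; apply: hasderV.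
have h2 : mxder (fun v => (- (2 * v ^+ 2 / Q v ^+ 2)) *: (A *m Gam)) tau
    ((- (4 * tau / Q tau ^+ 2) + 4 * tau * (tau * dQ tau) / Q tau ^+ 3) *: (A *m Gam)).
  apply: mxderZ; apply: hasder_eq.
    apply: hasderN; apply: hasderM; last exact: Q2.
    by apply: hasderM; [exact: hasderC|apply: hasderX; exact: hasderI].
  by rewrite /=; field.
have h3 : mxder (fun v => (- (4 * v * u v / Q v ^+ 2)) *: Gam) tau
    ((- (4 * (u tau + 2 * a * tau) / Q tau ^+ 2) + 8 * u tau * (tau * dQ tau) / Q tau ^+ 3) *: Gam).
  apply: mxderZ; apply: hasder_eq.
    apply: hasderN; apply: hasderM; last exact: Q2.
    apply: hasderM; last exact: hu.
    by apply: hasderM; [exact: hasderC|exact: hasderI].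
  by cbv beta; field.
have := mxderD (mxderD h1 h2) h3.
rewrite (_ : (fun v => _) = flow_mx1); last first.
  by apply/funext => v; rewrite /flow_mx1 !scaleNr.
rewrite /flow_mx2 flow_mx_Gam /flow_mx1; move: Gam (A *m Gam) => G AG.
rewrite e => H; move: H; congr (mxder _ _ _); apply/matrixP => i j; rewrite !mxE.
have e1 : tau * (dQ tau / Q tau ^+ 3) = 2 / Q tau ^+ 2 - 2 * u tau / Q tau ^+ 3.
  by rewrite mulrA e; field.
have -> : - (dQ tau / Q tau) * ((Q tau)^-1 * A i j - 2 * tau ^+ 2 / Q tau ^+ 2 * AG i j - 4 * tau * u tau / Q tau ^+ 2 * G i j)
  = - (dQ tau / Q tau ^+ 2) * A i j + 2 * tau * (tau * (dQ tau / Q tau ^+ 3)) * AG i j +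
    4 * u tau * (tau * (dQ tau / Q tau ^+ 3)) * G i j by field.
rewrite e1 /mu /flow_mu -/Q.
have uE : 2 * a * tau = u tau - 1 by rewrite /u /flow_u; ring.
have bE : tau ^+ 2 * b ^+ 2 = Q tau - u tau ^+ 2 by rewrite /Q /flow_Q -/b -/u; ring.
have -> : 1 - 2 * tau ^+ 2 / Q tau * b ^+ 2 = 1 - 2 / Q tau * (tau ^+ 2 * b ^+ 2) by ring.
by rewrite uE bE; field.
Qed.

Hypothesis AT : A^T = A.

(** This says that [M^-1 M1], the differential of the velocity field, is
    symmetric.  The products of the coefficients of [M] and [M1] differ by
    commutators with [A], which vanish because the Wronskians along [g] and
    orthogonally to [g] are both [1 / Q]. *)
Lemma flow_mx1_sym : flow_mx1 tau *m (M tau)^T = M tau *m (flow_mx1 tau)^T.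
Proof.
have GT : Gam^T = Gam by rewrite /Gam /flow_Gam trmx_mul trmxK.
suff S : (flow_mx1 tau *m (M tau)^T)^T = flow_mx1 tau *m (M tau)^T by rewrite -{1}S trmx_mul trmxK.
have MT : (M tau)^T = 1%:M + kap tau *: A + eta tau *: (Gam *m A) - mu tau *: Gam.
  by rewrite /M /flow_mx raddfB /= !raddfD /= !linearZ /= trmx1 trmx_mul GT AT.
set k1 := (Q tau)^-1; set e1 := 2 * tau ^+ 2 / Q tau ^+ 2; set m1 := 4 * tau * u tau / Q tau ^+ 2.
pose c := m1 * (kap tau + eta tau * b ^+ 2).
have hc : (k1 * mu tau + e1 - e1 * mu tau * b ^+ 2) *: (A *m Gam) = c *: (A *m Gam).
  have [b0|bn] := eqVneq b 0; first by rewrite (G0 b0) mulmx0 !scaler0.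
  congr (_ *: _); rewrite /c kap_eta // /k1 /e1 /m1 /mu /flow_mu -/Q.
  have bE : tau ^+ 2 * b ^+ 2 = Q tau - u tau ^+ 2 by rewrite /Q /flow_Q -/b -/u; ring.
  have -> : 2 * tau ^+ 2 / Q tau ^+ 2 * (2 * tau ^+ 2 / Q tau) * b ^+ 2 =
    4 * tau ^+ 2 * (tau ^+ 2 * b ^+ 2) / Q tau ^+ 3 by field.
  by rewrite bE; field.
have -> : flow_mx1 tau *m (M tau)^T = k1 *: A + (k1 * kap tau) *: (A *m A) +
    (k1 * eta tau - e1 * kap tau - e1 * eta tau * b ^+ 2) *: (A *m Gam *m A)
    - (m1 - m1 * mu tau * b ^+ 2) *: Gam - c *: (A *m Gam) - c *: (Gam *m A).
  rewrite -hc MT /flow_mx1 -/k1 -/e1 -/m1.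
  rewrite !(mulmxBl, mulmxBr, mulmxDr, mulmxDl, mulmx1) -!(scalemxAl, scalemxAr).
  rewrite !mulmxN -!scalemxAr.
  have AGG : A *m Gam *m Gam = b ^+ 2 *: (A *m Gam) by rewrite -mulmxA GG -scalemxAr.
  rewrite [A *m (Gam *m A)]mulmxA [Gam *m (Gam *m A)]mulmxA [A *m Gam *m (Gam *m A)]mulmxA.
  rewrite AGG GG -!scalemxAl.
  move: Gam (A *m A) (A *m Gam) (Gam *m A) (A *m Gam *m A) => y5 y4 y3 y2 y1.
  by apply/matrixP => i j; rewrite !mxE /c; ring.
have T1 : (A *m Gam)^T = Gam *m A by rewrite trmx_mul GT AT.
have T2 : (Gam *m A)^T = A *m Gam by rewrite trmx_mul GT AT.
have T3 : (A *m Gam *m A)^T = A *m Gam *m A by rewrite trmx_mul T1 AT mulmxA.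
have T4 : (A *m A)^T = A *m A by rewrite trmx_mul AT.
rewrite !(raddfB, raddfD) /= !linearZ /= T1 T2 T3 T4 AT GT.
by rewrite addrAC.
Qed.

End AtTime.
End FlowDerivatives.

(** * Second derivatives of growth and distortion *)
Section LogDerivatives.
Variable R : realType.
Implicit Types (f L l : R -> R) (t s m : R).

Lemma hasder_shift f t s m : hasder f (t - s) m -> hasder (fun v => f (v - s)) t m.
Proof.
move=> fm; apply: hasder_eq.
  apply: (hasderComp (g := fun v => v - s)); first exact: fm.
  by apply: hasderD; [exact: hasderI|exact: hasderC].
by rewrite addr0 mulr1.
Qed.

Lemma hasder_derive1 f t m : hasder f t m -> derivable f t 1 /\ derive1 f t = m.
Proof.
move=> fm; have {}fm : is_derive t (1 : R) f m := fm; split; first exact: ex_derive.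
by rewrite derive1E; exact: derive_val.
Qed.

(** [f''/f = (log f)'' + (log f)' ^ 2]. *)
Lemma exp_second_derivative f L l t m :
  (\forall u \near t, f u = expR (L u)) -> (\forall u \near t, hasder L u (l u)) ->
  hasder l t m -> twice_derivable f t /\ derive1n 2 f t / f t = m + l t ^+ 2.
Proof.
move=> fL Ll lm.
have f1 : \forall u \near t, hasder f u (expR (L u) * l u).
  have fL2 := near_join fL; near=> u.
  have h1 : \forall v \near u, f v = expR (L v) by near: u.
  have h2 : hasder L u (l u) by near: u.
  by apply: near_eq_is_derive (hasderExp h2); apply: filterS h1 => v ->.
have d1 : \forall u \near t, expR (L u) * l u = derive1 f u.
  by apply: filterS f1 => u /hasder_derive1[_ ->].
have Lt : hasder L t (l t) := @nbhs_singleton R t _ Ll.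
have f2 : hasder (derive1 f) t (expR (L t) * (m + l t ^+ 2)).
  apply: near_eq_is_derive d1 _; apply: hasder_eq.
    by apply: hasderM; [apply: hasderExp; exact: Lt|exact: lm].
  by cbv beta; ring.
have [df2 e2] := hasder_derive1 f2.
split; first by split=> //; apply: filterS f1 => u /hasder_derive1[].
rewrite derive1nS derive1n1 e2 (@nbhs_singleton R t _ fL) mulrC mulKf //.
by rewrite gt_eqF // expR_gt0.
Unshelve. all: by end_near.
Qed.

End LogDerivatives.

Section TraceInequality.
Variables (R : realType) (d : nat).

(** Cauchy-Schwarz for the diagonal, whose squared length is at most the trace of
    the square. *)
Lemma sym_trace_sqr (B : 'M[R]_d) : B^T = B -> \tr B ^+ 2 <= d%:R * \tr (B *m B).
Proof.
move=> BT; pose v : 'rV[R]_d := \row_i B i i; pose e : 'rV[R]_d := const_mx 1.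
have -> : \tr B = dotv v e by apply: eq_bigr => i _; rewrite !mxE mulr1.
have de : d%:R = dotv e e :> R.
  rewrite /dotv (eq_bigr (fun=> 1)); last by move=> i _; rewrite !mxE mulr1.
  by rewrite sumr_const card_ord.
have cs : dotv v e ^+ 2 <= dotv e e * dotv v v.
  rewrite -real_normK ?num_real // -!enorm_sq -exprMn mulrC.
  by rewrite ler_pXn2r ?nnegrE ?mulr_ge0 ?enorm_ge0 // cauchy_schwarz.
apply: le_trans cs _; rewrite -de ler_wpM2l // /mxtrace; apply: ler_sum => i _.
rewrite !mxE (bigD1 i) //= lerDl; apply: sumr_ge0 => j _.
by rewrite -{2}BT mxE -expr2 sqr_ge0.
Qed.

Lemma trace_sqr_dim1 (B : 'M[R]_d) : d = 1%N -> \tr (B *m B) = \tr B ^+ 2.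
Proof. by move=> d1; move: B; rewrite d1 => B; rewrite /mxtrace !big_ord1 mxE big_ord1. Qed.

End TraceInequality.

Section Distortion.
Variables (R : realType) (d : nat) (a s : R) (g : 'rV[R]_d) (A : 'M[R]_d).
Hypothesis d0 : (0 < d)%N.
Hypothesis AT : A^T = A.
Hypothesis up : forall t : R, 0 < t < 1 -> 0 < flow_u a (t - s).
Hypothesis dp : forall t : R, 0 < t < 1 -> 0 < \det (flow_mx a g A (t - s)).

Definition dist_gamma t : R := Num.sqrt (flow_Q a g (t - s)).
Definition dist_rho t : R := dist_gamma t * (\det (flow_mx a g A (t - s))) `^ (d%:R^-1).

Let lg t : R := flow_dQ a g (t - s) / (2 * flow_Q a g (t - s)).
Let ld t : R := \tr (flow_mx1 a g A (t - s) *m \adj (flow_mx a g A (t - s))) / \det (flow_mx a g A (t - s)).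

Variable t : R.
Hypothesis ht : 0 < t < 1.

Let tau := t - s.
Let Q := flow_Q a g tau.
Let B := invmx (flow_mx a g A tau) *m flow_mx1 a g A tau.

Let near01 : \forall v \near t, 0 < v < 1.
Proof.
have : t \in `]0, 1[ by rewrite in_itv.
by move=> /near_in_itvoo; apply: filterS => v; rewrite in_itv.
Qed.

Let hasder_lg : hasder lg t (enorm g ^+ 2 / Q ^+ 2 - lg t ^+ 2).
Proof.
have u0 := up ht; have Q0 := @flow_Q_gt0 R d a g _ u0; have hQ := hasder_flow_Q a g tau.
have hdQ : hasder (flow_dQ a g) tau (8 * a ^+ 2 + 2 * enorm g ^+ 2).
  apply: hasder_eq; first by rewrite /flow_dQ /flow_u; der.
  by cbv beta; rewrite /=; ring.
apply: hasder_eq.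
  apply: (hasder_shift (f := fun v => flow_dQ a g v / (2 * flow_Q a g v))).
  apply: hasderM; first exact: hdQ.
  apply: hasderV; first by rewrite gt_eqF // mulr_gt0.
  by apply: hasderM; [exact: hasderC|exact: hQ].
cbv beta; rewrite /lg -/tau -/Q.
have dQ2 : flow_dQ a g tau ^+ 2 = 4 * Q * (4 * a ^+ 2 + enorm g ^+ 2) - 4 * enorm g ^+ 2.
  by rewrite /flow_dQ /Q /flow_Q /flow_u; ring.
have Qn : Q != 0 by rewrite gt_eqF.
have -> : (8 * a ^+ 2 + 2 * enorm g ^+ 2) / (2 * Q) +
   flow_dQ a g tau * (- (0 * Q + 2 * flow_dQ a g tau) / (2 * Q) ^+ 2) =
   (4 * a ^+ 2 + enorm g ^+ 2) / Q - flow_dQ a g tau ^+ 2 / (2 * Q ^+ 2) by field.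
have -> : (flow_dQ a g tau / (2 * Q)) ^+ 2 = flow_dQ a g tau ^+ 2 / (4 * Q ^+ 2) by field.
by rewrite dQ2; field.
Qed.

Let gammaE v : 0 < v < 1 -> dist_gamma v = expR (ln (flow_Q a g (v - s)) / 2).
Proof.
move=> hv; have Q0 := @flow_Q_gt0 R d a g _ (up hv); rewrite /dist_gamma.
rewrite -[X in Num.sqrt X]lnK ?posrE // [X in expR X](splitr (ln _)) expRD -expr2.
by rewrite sqrtr_sqr ger0_norm // expR_ge0.
Qed.

Let hasder_lnQ v : 0 < v < 1 -> hasder (fun v => ln (flow_Q a g (v - s)) / 2) v (lg v).
Proof.
move=> hv; have Q0 := @flow_Q_gt0 R d a g _ (up hv); apply: hasder_eq.
  apply: hasderM; last exact: hasderC.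
  by apply: hasderLn; [exact: Q0|apply: hasder_shift; exact: hasder_flow_Q].
by cbv beta; rewrite /lg; field; rewrite gt_eqF.
Qed.

Lemma gamma_second : twice_derivable dist_gamma t /\
  derive1n 2 dist_gamma t / dist_gamma t = enorm g ^+ 2 / Q ^+ 2.
Proof.
have [||h1 h2] := @exp_second_derivative _ dist_gamma (fun v => ln (flow_Q a g (v - s)) / 2) lg t _ _ _ hasder_lg.
- by apply: filterS near01 => v; exact: gammaE.
- by apply: filterS near01 => v; exact: hasder_lnQ.
by split=> //; rewrite h2 subrK.
Qed.

Let un : flow_mx a g A tau \in unitmx.
Proof. by rewrite unitmxE unitfE gt_eqF // dp. Qed.

Let adjE : \adj (flow_mx a g A tau) = \det (flow_mx a g A tau) *: invmx (flow_mx a g A tau).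
Proof. by rewrite /invmx un scalerA divff ?scale1r // gt_eqF // dp. Qed.

Let ldE : ld t = \tr B.
Proof.
rewrite /ld -/tau adjE -scalemxAr mxtraceZ mulrAC divff ?mul1r ?gt_eqF ?dp //.
by rewrite mxtrace_mulC.
Qed.

Let hasder_ld : hasder ld t (- (2 * lg t) * \tr B - 4 * enorm g ^+ 2 / Q ^+ 2 - \tr (B *m B)).
Proof.
have u0 := up ht; have Q0 := @flow_Q_gt0 R d a g _ u0.
apply: (hasder_shift (f := fun v => \tr (flow_mx1 a g A v *m \adj (flow_mx a g A v)) / \det (flow_mx a g A v))).
apply: hasder_eq (hasder_logdet (@mxder_flow_mx R d a g A _ u0) (@mxder_flow_mx1 R d a g A _ u0) (lt0r_neq0 (dp ht))) _.
rewrite -/tau; congr (_ - _); last first.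
  by rewrite mulmxA mxtrace_mulC /B !mulmxA.
rewrite /flow_mx2 mulmxBl raddfB /= -!scalemxAl !mxtraceZ; congr (_ - _).
  rewrite mxtrace_mulC -/B /lg -/tau -/Q; congr (- _ * _); field.
  by rewrite gt_eqF.
rewrite mxtrace_mulC mulmxA mulVmx // mul1mx mulrAC; congr (_ * _ / _).
rewrite enorm_sq; apply: eq_bigr => i _.
by rewrite mxE big_ord1 mxE.
Qed.

Let BT : B^T = B.
Proof.
have u0 := up ht; have e := @flow_mx1_sym R d a g A _ u0 AT.
rewrite /B trmx_mul trmx_inv.
have unT : (flow_mx a g A tau)^T \in unitmx by rewrite unitmx_tr.
apply: (can_inj (mulmxK unT)); rewrite mulmxKV //.
by rewrite -mulmxA e mulmxA mulVmx // mul1mx.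
Qed.

(** In the sum of [(log rho)''] and [(log rho)' ^ 2] the cross terms between
    growth and determinant cancel, and the traces combine to the variance of the
    eigenvalues of [B]. *)
Lemma rho_second : twice_derivable dist_rho t /\
  derive1n 2 dist_rho t / dist_rho t =
  (1 - 4 / d%:R) * (enorm g ^+ 2 / Q ^+ 2) - (\tr (B *m B) - \tr B ^+ 2 / d%:R) / d%:R.
Proof.
have dn : d%:R != 0 :> R by rewrite pnatr_eq0 -lt0n.
pose L v := ln (flow_Q a g (v - s)) / 2 + ln (\det (flow_mx a g A (v - s))) / d%:R.
pose l v := lg v + ld v / d%:R.
have [|||h1 h2] := @exp_second_derivative _ dist_rho L l t
  (enorm g ^+ 2 / Q ^+ 2 - lg t ^+ 2 + (- (2 * lg t) * \tr B - 4 * enorm g ^+ 2 / Q ^+ 2 - \tr (B *m B)) / d%:R).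
- apply: filterS near01 => v hv; rewrite /dist_rho gammaE // /L expRD; congr (_ * _).
  by rewrite /powR gt_eqF ?dp // mulrC.
- apply: filterS near01 => v hv; apply: hasderD; first exact: hasder_lnQ.
  apply: hasder_eq.
    apply: hasderM; last exact: hasderC.
    apply: hasderLn; first exact: dp.
    by apply: (hasder_shift (f := fun v => \det (flow_mx a g A v))); apply: hasder_det; exact: (@mxder_flow_mx R d a g A _ (up hv)).
  by cbv beta; rewrite /ld mulr0 addr0 [_^-1 * _]mulrC.
- apply: hasderD; first exact: hasder_lg.
  apply: hasder_eq; first by apply: hasderM; [exact: hasder_ld|exact: hasderC].
  by rewrite mulr0 addr0.
split=> //; rewrite h2 /l ldE.
have Qn : Q != 0 by rewrite gt_eqF // flow_Q_gt0 // up.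
by field; rewrite dn.
Qed.

Lemma distortion_estimates :
  [/\ twice_derivable dist_gamma t /\ twice_derivable dist_rho t,
      0 <= derive1n 2 dist_gamma t / dist_gamma t,
      derive1n 2 dist_rho t / dist_rho t <=
        (1 - 4 / d%:R) * (derive1n 2 dist_gamma t / dist_gamma t) &
      d = 1%N -> derive1n 2 dist_rho t / dist_rho t =
        (1 - 4 / d%:R) * (derive1n 2 dist_gamma t / dist_gamma t)].
Proof.
have [g2 gE] := gamma_second; have [r2 rE] := rho_second.
have dp0 : 0 < d%:R :> R by rewrite ltr0n.
split=> //.
- by rewrite gE divr_ge0 ?sqr_ge0.
- rewrite gE rE gerBl divr_ge0 ?(ltW dp0) // subr_ge0 ler_pdivrMr // mulrC.
  exact: sym_trace_sqr BT.
- move=> d1; have dR : d%:R = 1 :> R by rewrite d1.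
  by rewrite gE rE trace_sqr_dim1 // dR !divr1 subrr subr0.
Qed.

End Distortion.

(** * Positivity of the determinant *)
Section Positivity.
Variables (R : realType) (d : nat) (a : R) (g : 'rV[R]_d) (A : 'M[R]_d).

(** Reversing time amounts to changing the sign of the potential. *)
Lemma flow_mx_opp (tau : R) : flow_mx (- a) (- g) (- A) (- tau) = flow_mx a g A tau.
Proof.
have uE : flow_u (- a) (- tau) = flow_u a tau by rewrite /flow_u; ring.
have QE : flow_Q (- a) (- g) (- tau) = flow_Q a g tau by rewrite /flow_Q uE enormN sqrrN.
have kE : flow_kap (- a) (- g) (- tau) = - flow_kap a g tau.
  by rewrite /flow_kap uE enormN; case: ifP => _; rewrite !mulNr // atanN mulNr.
have eE : flow_eta (- a) (- g) (- tau) = - flow_eta a g tau.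
  by rewrite /flow_eta uE QE kE enormN; ring.
have gT : (- g)^T = - g^T by apply/matrixP => i j; rewrite !mxE.
have GE : flow_Gam (- g) = flow_Gam g by rewrite /flow_Gam gT mulNmx mulmxN opprK.
have mE : flow_mu (- a) (- g) (- tau) = flow_mu a g tau by rewrite /flow_mu QE sqrrN.
by rewrite /flow_mx kE eE GE mE mulNmx !scaleNr !scalerN !opprK.
Qed.

Lemma flow_mx_0 : flow_mx a g A 0 = 1%:M.
Proof.
have k0 : flow_kap a g 0 = 0 by rewrite /flow_kap !mul0r atan0 mul0r; case: ifP.
by rewrite /flow_mx /flow_eta /flow_mu k0 expr0n mulr0 !mul0r subr0 mul0r !scale0r !addr0 subr0.
Qed.

Variables (sp sm : R).
Hypotheses (AT : A^T = A) (sp0 : 0 < sp) (sm0 : 0 < sm).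
Hypothesis up : forall tau : R, - sm < tau < sp -> 0 < flow_u a tau.
Hypothesis hp : hess_lower a g A sp.
Hypothesis hm : hess_lower (- a) (- g) (- A) sm.

Lemma det_flow_neq0 (tau : R) : - sm < tau < sp -> \det (flow_mx a g A tau) != 0.
Proof.
move=> /andP[t1 t2]; have [t0|t0|->] := ltrgt0P tau.
- by apply: flow_nondegenerate AT hp _; rewrite t0.
- have AT' : (- A)^T = - A by rewrite linearN /= AT.
  by rewrite -flow_mx_opp; apply: flow_nondegenerate AT' hm _; rewrite oppr_gt0 t0 /=; lra.
- by rewrite flow_mx_0 det1 oner_eq0.
Qed.

(** The determinant equals 1 at time 0 and does not vanish, so the intermediate
    value theorem applies. *)
Lemma det_flow_gt0 (tau : R) : - sm < tau < sp -> 0 < \det (flow_mx a g A tau).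
Proof.
move=> /andP[t1 t2]; rewrite ltNge; apply/negP => neg.
pose f (v : R) := \det (flow_mx a g A v).
have fc (v : R) : - sm < v < sp -> {for v, continuous f}.
  by move=> hv; apply: hasderCont (hasder_det (mxder_flow_mx g A (up hv))).
have f0 : f 0 = 1 by rewrite /f flow_mx_0 det1.
pose lo : R := Num.min 0 tau; pose hi : R := Num.max 0 tau.
have lohi : lo <= hi by rewrite ge_min !le_max lexx.
have inside (v : R) : lo <= v <= hi -> - sm < v < sp.
  rewrite ge_min le_max => /andP[h1 h2]; apply/andP; split.
    by case/orP: h1 => [h1|]; [apply: lt_le_trans h1; rewrite oppr_lt0|exact: lt_le_trans].
  by case/orP: h2 => [h2|h2]; [exact: le_lt_trans h2 sp0|exact: le_lt_trans h2 t2].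
have [||c] := @IVT R f lo hi 0 lohi.
- apply: continuous_in_subspaceT => v; rewrite inE /= in_itv /= => hv.
  exact: fc (inside v hv).
- rewrite /lo /hi; have [t0|t0] := leP 0 tau.
    by rewrite f0 ge_min le_max neg ler01 orbT.
  by rewrite f0 ge_min le_max neg ler01 orbT.
rewrite in_itv /= => hc fc0; have := det_flow_neq0 (inside c hc).
by rewrite -/(f c) fc0 eqxx.
Qed.

End Positivity.

(** * Regular points *)
Section Regular.
Variables (R : realType) (d : nat) (phi0 phi1 : 'rV[R]_d -> \bar R) (s : R).
Local Notation V := ('rV[R]_d).
Hypothesis d0 : (0 < d)%N.
Hypothesis hs : 0 < s < 1.
Hypothesis phi1E : forall x1, phi1 x1 =
    ereal_inf [set phi0 x0 + L1 (x1 - x0)%R | x0 in eball x1 (pi / 2)%R]%E.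

Let s0 : 0 < s. Proof. by case/andP: hs. Qed.
Let s1 : 0 < 1 - s. Proof. by rewrite subr_gt0; case/andP: hs. Qed.

Lemma Xi_touched_below y : Xi phi0 phi1 s y ->
  touched s^-1 (fun h : V => 1 + 2 * (1 - s) * rxi phi0 s (y + h)).
Proof.
move=> Xy; apply: touched_compact => e e0.
have [z yz hz] := rxi_approx_sup hs phi1E Xy e0.
exists (weight1 phi1 s z), (y - z); split.
- exact: weight1_bounds.
- exact: ltW.
- by rewrite addr0.
- by move=> h; rewrite addrAC; exact: rxi_ge.
Qed.

Lemma xi_touched_above y :
  touched (1 - s)^-1 (fun h : V => 1 - 2 * s * rxi phi0 s (y + h)).
Proof.
apply: touched_compact => e e0.
have [z yz hz] := rxi_approx_inf hs phi1E y e0.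
exists (weight0 phi0 s z), (y - z); split.
- exact: weight0_bounds.
- exact: ltW.
- by rewrite addr0.
- by move=> h; rewrite addrAC; exact: (rxi_le hs phi1E).
Qed.

Let C := s^-1 / (2 * (1 - s)) + (1 - s)^-1 / (2 * s).

Let C0 : 0 <= C.
Proof. by rewrite addr_ge0 // divr_ge0 ?invr_ge0 ?mulr_ge0 // ltW. Qed.

Lemma Xi_taylor y : Xi phi0 phi1 s y -> forall h : V,
  `|rxi phi0 s (y + h) - rxi phi0 s y - dotv (grad_xi phi0 s y) h| <= C * enorm h ^+ 2.
Proof.
by move=> Xy h; exact: touched_taylor s0 s1 (Xi_touched_below Xy) (xi_touched_above y) h.
Qed.

(** The two Hopf-Lax formulas bound the potential by [1 / (2 s)] from above and by
    [- 1 / (2 (1 - s))] from below, which is used for [tau < 0] and [tau > 0]. *)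
Lemma flow_u_gt0 (y : V) (tau : R) : - s < tau < 1 - s -> 0 < flow_u (rxi phi0 s y) tau.
Proof.
move=> /andP[t1 t2]; have [a] := xi_bounds hs phi1E y.
rewrite /rxi => -> /= /andP[]; rewrite /flow_u.
rewrite lerNl -[(2 * (1 - s))^-1]mul1r -[(2 * s)^-1]mul1r !ler_pdivlMr ?mulr_gt0 // => h1 h2.
have [t0|t0|->] := ltrgt0P tau; last by rewrite mulr0 mul0r addr0.
  have [a0|a0] := leP 0 a; first by rewrite ltr_pwDl // !mulr_ge0 // ltW.
  have : tau * a > (1 - s) * a by rewrite ltr_nM2r.
  lra.
have [a0|a0] := leP a 0.
  by rewrite ltr_pwDl // -mulrA mulr_ge0 // mulr_le0 // ltW.
have : tau * a > - s * a by rewrite ltr_pM2r.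
lra.
Qed.

Variables (x : V) (A : 'M[R]_d).
Hypothesis Xx : Xi phi0 phi1 s x.
Hypothesis dx : density_point (Xi phi0 phi1 s) x.
Hypothesis gA : is_reldiff (Xi phi0 phi1 s) (grad_xi phi0 s) x A.

Let sx := density_surrounded d0 dx.
Let a := rxi phi0 s x.
Let g := grad_xi phi0 s x.

Lemma hessian_sym : A^T = A.
Proof.
apply/matrixP => i j; rewrite mxE.
have := reldiff_symmetric sx C0 Xi_taylor gA (delta_mx 0 i) (delta_mx 0 j).
by rewrite -!rowE !dotv_delta !mxE.
Qed.

Lemma Dtransport_flow_mx (t : R) : 0 < t < 1 -> Dtransport phi0 phi1 s t x = flow_mx a g A (t - s).
Proof.
move=> /andP[t0 t1]; apply: (reldiff_eq sx).
have Fd : rdiff (Xi phi0 phi1 s) x (rxi phi0 s) g.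
  move=> e e0; have C1 : 0 < C + 1 by rewrite ltr_wpDl.
  have := rnear_lt (Xi phi0 phi1 s) x (divr_gt0 e0 C1); apply: rnearS => y yx.
  have := Xi_taylor Xx (y - x); rewrite [x + _]addrC subrK => h; apply: le_trans h _.
  rewrite expr2 mulrA ler_wpM2r ?enorm_ge0 //.
  move: yx; rewrite ltr_pdivlMr // mulrDr mulr1 mulrC => /ltW; apply: le_trans.
  by rewrite lerDl enorm_ge0.
have up : 0 < flow_u (rxi phi0 s x) (t - s) by apply: flow_u_gt0; apply/andP; split; lra.
have -> : transport phi0 s t = ray (rxi phi0 s) (grad_xi phi0 s) (t - s) by [].
exact: (@ray_reldiff R d (Xi phi0 phi1 s) x (rxi phi0 s) (grad_xi phi0 s) A (t - s) Fd gA up).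
Qed.

Lemma hess_lower_below : hess_lower a g A (1 - s).
Proof.
have [m [w [/andP[m0 _] hw e0 hmw]]] := Xi_touched_below Xx.
rewrite addr0 in e0.
have gw := touched_gradient s1 m0 hw e0 hmw (Xi_taylor Xx).
exact: (touching_hess_lower (second_order sx C0 Xi_taylor gA) s1 m0 hw e0 hmw gw).
Qed.

(** Touching from above is touching from below for the opposite potential. *)
Lemma hess_lower_above : hess_lower (- a) (- g) (- A) s.
Proof.
have [m [w [/andP[m0 _] hw e0 hmw]]] := xi_touched_above x.
rewrite addr0 in e0.
pose F y := - rxi phi0 s y.
have e0' : 1 + 2 * s * F x = m * ckernel w by rewrite -e0 /F; ring.
have hm' (h : V) : m * ckernel (w + h) <= 1 + 2 * s * F (x + h).
  by apply: le_trans (hmw h) _; rewrite /F mulrN.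
have tay (h : V) : `|F (x + h) - F x - dotv (- g) h| <= C * enorm h ^+ 2.
  rewrite -normrN; have := Xi_taylor Xx h; rewrite -/g; congr (`|_| <= _).
  by rewrite /F dotvNl; ring.
have gF : gradient F x = - g := gradient_taylor tay.
have gw : - g = (m / (2 * s)) *: grad_ckernel w.
  by rewrite -gF; rewrite -gF in tay; exact: touched_gradient s0 m0 hw e0' hm' tay.
apply: (touching_hess_lower (F := F) _ s0 m0 hw e0' hm' gw) => k e e1.
have := second_order sx C0 Xi_taylor gA k e1.
apply: filterS => r; rewrite -normrN; congr (`|_| <= _).
by rewrite /F mulmxN !dotvNl -/g; ring.
Qed.

Lemma rhoE (t : R) : 0 < t < 1 -> rho_ phi0 phi1 s x t = dist_rho a s g A t.
Proof. by move=> ht; rewrite /rho_ Dtransport_flow_mx. Qed.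

Lemma det_transport_gt0 (t : R) : 0 < t < 1 -> 0 < \det (flow_mx a g A (t - s)).
Proof.
move=> /andP[t0 t1].
apply: (det_flow_gt0 hessian_sym s1 s0 (@flow_u_gt0 x) hess_lower_below hess_lower_above).
by apply/andP; split; lra.
Qed.

End Regular.

Lemma near_eq_second (R : realType) (f h : R -> R) (t : R) : (\forall v \near t, f v = h v) ->
  twice_derivable f t -> twice_derivable h t /\ derive1n 2 f t = derive1n 2 h t.
Proof.
move=> fh [f1 f2].
have fh1 : \forall v \near t, derive1 f v = derive1 h v.
  have := near_join fh; apply: filterS => v vfh.
  by rewrite !derive1E; exact: near_eq_derive.
split.
  split; last exact: near_eq_derivable f2.
  have fh2 := near_join fh; near=> v; apply: (@near_eq_derivable _ _ _ f).
    by near: v.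
  by near: v.
by rewrite !derive1nS !derive1n0 !derive1E; exact: near_eq_derive.
Unshelve. all: by end_near.
Qed.

Unset Implicit Arguments.

Theorem proposition5p7 (R : realType) (d : nat) (hd : (0 < d)%N)
    (mu : R -> finmeas R d) (phi0 phi1 : 'rV[R]_d -> \bar R)
    (hgeo : HK_geodesic mu)
    (hac : exists2 s0 : R, 0 < s0 < 1 & abs_continuous (mu s0))
    (hpair : tight_optimal_pair (mu 0) (mu 1) phi0 phi1)
    (s : R) (hs : 0 < s < 1) (t : R) (ht : 0 < t < 1)
    (x : 'rV[R]_d) (hx : regular_set phi0 phi1 s x) :
  let gamma := gamma_ phi0 s x in
  let rho := rho_ phi0 phi1 s x in
  [/\ twice_derivable gamma t /\ twice_derivable rho t,
      0 <= derive1n 2 gamma t / gamma t,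
      (2 <= d)%N ->
        derive1n 2 rho t / rho t <= (1 - 4 / d%:R) * (derive1n 2 gamma t / gamma t) &
      d = 1%N ->
        derive1n 2 rho t / rho t = (1 - 4 / d%:R) * (derive1n 2 gamma t / gamma t)].
Proof.
move=> gamma rho; have [Xx dx [A gA]] := hx; have dual := phi1E hpair.
have up v : 0 < v < 1 -> 0 < flow_u (rxi phi0 s x) (v - s).
  by move=> /andP[v0 v1]; apply: (flow_u_gt0 hs dual); apply/andP; split; lra.
have [[g2 r2] gp rle req] := distortion_estimates hd (hessian_sym hd hs dual dx gA) up
  (@det_transport_gt0 _ _ _ _ _ hd hs dual _ _ Xx dx gA) ht.
have near_rho : \forall v \near t, dist_rho (rxi phi0 s x) s (grad_xi phi0 s x) A v = rho v.
  have : t \in `]0, 1[ by rewrite in_itv.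
  move=> /near_in_itvoo; apply: filterS => v; rewrite in_itv /= => hv.
  by rewrite /rho (rhoE hd hs dual Xx dx gA).
have [r2' er] := near_eq_second near_rho r2.
rewrite er (nbhs_singleton near_rho) in rle req.
have gE : dist_gamma (rxi phi0 s x) s (grad_xi phi0 s x) = gamma by [].
rewrite gE in g2 gp rle req; clearbody gamma rho.
split; [by []|exact: gp|by move=> _; exact: rle|exact: req].
Qed.
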